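(* Let $k,N\in\mathbb N$, $\Omega\subset\mathbb R^k$ open, $\mathbb K\in\{\mathbb R,\mathbb C\}$, $V$ a separable Banach space over $\mathbb K$, and let $f_1,\dots,f_N\colon\Omega\to\Omega$, $g_1,\dots,g_N\colon\Omega\to\mathbb K$, $h_0\colon\Omega\to V$ satisfy hypothesis (H) (with constants $K,L$ as in (H)). Let $\psi$ be as in the context and assume $h_0\in L^{\psi,1}(\Omega,V)$. If there is $\alpha\in[0,\tfrac12)$ with $$|g_n(x)|\le \alpha\min\Big\{\frac{|J_{f_n}(x)|}{KL},\frac1N\Big\}\quad\text{for all } n\in\{1,\dots,N\}\text{ and almost all }x\in\Omega,$$ then the elementary solution of $\varphi(x)=\sum_{n=1}^N g_n(x)\varphi(f_n(x))+h_0(x)$ in $L^{\psi,1}(\Omega,V)$ exists, it is the unique solution of this equation in $L^{\psi,1}(\Omega,V)$, and for every $j\in\mathbb N\cup\{0\}$ $$\Big\|\sum_{i=j}^\infty P^i h_0\Big\|_{L^{\psi,1}(\Omega,V)}\le \frac{(2\alpha)^j}{1-2\alpha}\|h_0\|_{L^{\psi,1}(\Omega,V)}.$$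
   Context: $\mu$ denotes $k$-dimensional Lebesgue measure. A Young function is a non-decreasing, left-continuous, convex $\Psi\colon[0,\infty)\to[0,\infty]$ with $\lim_{t\to0+}\Psi(t)=\Psi(0)=0$, $\lim_{t\to\infty}\Psi(t)=\infty$. $\psi\colon[0,\infty)\to[0,\infty)$ is a strictly increasing Young function satisfying $\Delta_2$ globally (there is $d>1$ with $\psi(2t)\le d\psi(t)$ for all $t>0$) and $\lim_{t\to0+}\psi(t)/t=\lim_{t\to\infty}t/\psi(t)=0$. $\tau(0)=0$, $\tau(t)=1/\psi(1/t)$ for $t>0$, $\tau^{-1}$ its inverse, $\tau^{-1}(\infty)=\infty$. For measurable $f\colon\Omega\to\mathbb K$, $\mu_f(s)=\mu(\{x\in\Omega:|f(x)|>s\})$. $L^{\psi,1}(\Omega,\mathbb K)$ is the set of $f\in L^1_{\mathrm{loc}}(\Omega,\mathbb K)$ with $\|f\|_{L^{\psi,1}(\Omega,\mathbb K)}:=\int_0^\infty\tau^{-1}(\mu_f(s))\,ds<\infty$. $L^{\psi,1}(\Omega,V)$ is the set of Lebesgue measurable $f\colon\Omega\to V$ with $\|f(\cdot)\|_V\in L^{\psi,1}(\Omega,\mathbb K)$, normed by $\|f\|_{L^{\psi,1}(\Omega,V)}=\|\,\|f(\cdot)\|_V\|_{L^{\psi,1}(\Omega,\mathbb K)}$ (functions equal a.e. identified). Approximate differential: a linear map $A$ is an approximate differential of measurable $F\colon\Omega\to\mathbb R^k$ at $x_0$ if for every $\varepsilon>0$, $x_0$ is a density point of $\{x\in\Omega\setminus\{x_0\}:\|F(x)-F(x_0)-A(x-x_0)\|/\|x-x_0\|<\varepsilon\}$.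 $J_F(x)$ is the determinant of the approximate differential at $x$, set to $0$ where it does not exist. Luzin's condition N: null sets are mapped to null sets. Hypothesis (H): $f_1,\dots,f_N$ are measurable, a.e. approximately differentiable and satisfy Luzin's condition N; for every $n$ and null $M\subset\mathbb R^k$, $f_n^{-1}(M)$ is null; there is $K\in\mathbb N$ such that for each $n$, $\{x\in\Omega:\operatorname{card} f_n^{-1}(x)>K\}$ is null; $g_1,\dots,g_N,h_0$ are measurable; $L=\max\{l\in\{1,\dots,N\}: \mu(\bigcap_{i=1}^l f_{n_i}(\Omega))>0\text{ for some } n_1<\dots<n_l\}$. $P\psi=\sum_{n=1}^N g_n\cdot(\psi\circ f_n)$. The elementary solution in a normed function space $\mathcal F_0$ is $\sum_{i=0}^\infty P^i h_0$, when this series converges in the norm of $\mathcal F_0$ to a function in $\mathcal F_0$ solving the equation. *)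

(* Defs.v *)
From HB Require Import structures.
From mathcomp Require Import all_boot all_order all_algebra.
From mathcomp Require Import all_classical all_reals all_analysis.
From mathcomp Require Import complex.
Set Implicit Arguments. Unset Strict Implicit. Unset Printing Implicit Defensive.
Import Order.TTheory GRing.Theory Num.Theory.
Import numFieldNormedType.Exports.
Local Open Scope classical_set_scope.
Local Open Scope ring_scope.

Definition Kof (R : realType) (b : bool) : numFieldType :=
  if b then (R[i] : numFieldType) else (R : numFieldType).

Definition KtoR (R : realType) (b : bool) : Kof R b -> R :=
  match b return Kof R b -> R with
  | true => fun z => complex.Re z
  | false => fun x => x
  end.

Definition Knorm (R : realType) (b : bool) (z : Kof R b) : R := KtoR (`|z|).

Definition Vnorm (R : realType) (b : bool) (V : normedModType (Kof R b)) (v : V) : R :=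
  KtoR (`|v|).

Definition separable_space (T : topologicalType) : Prop :=
  exists D : set T, countable D /\ dense D.

Section Leb.
Variables (R : realType) (k : nat).
Local Notation Rk := 'rV[R]_k.

Definition enorm (x : Rk) : R := Num.sqrt (\sum_(i < k) x 0 i ^+ 2).
Definition eball (x : Rk) (r : R) : set Rk := [set y | enorm (y - x) < r].

Definition box (a b : Rk) : set Rk := [set x | forall i, a 0 i <= x 0 i <= b 0 i].
Definition box_vol (a b : Rk) : R := \prod_(i < k) Num.max (b 0 i - a 0 i) 0.

Definition lebo (A : set Rk) : \bar R :=
  ereal_inf [set s | exists a b : nat -> Rk,
     A `<=` \bigcup_n box (a n) (b n) /\
     s = (\sum_(0 <= n <oo) (box_vol (a n) (b n))%:E)%E].

Definition lmeas (A : set Rk) : Prop :=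
  forall E, lebo E = (lebo (E `&` A) + lebo (E `&` ~` A))%E.

Definition null (A : set Rk) : Prop := lebo A = 0%E.

Definition ae_on (Om : set Rk) (P : Rk -> Prop) : Prop :=
  null (Om `&` [set x | ~ P x]).

Definition lmeas_fun (T : topologicalType) (Om : set Rk) (F : Rk -> T) : Prop :=
  forall U : set T, open U -> lmeas (Om `&` F @^-1` U).

Definition density_point (A : set Rk) (x0 : Rk) : Prop :=
  (fun r => fine (lebo (A `&` eball x0 r)) / fine (lebo (eball x0 r)))
     r @[r --> 0^'+] --> (1 : R).

Definition approx_diff (Om : set Rk) (F : Rk -> Rk) (A : 'M[R]_k) (x0 : Rk) : Prop :=
  forall eps : R, 0 < eps ->
    density_point [set x | Om x /\ x != x0 /\
        enorm (F x - F x0 - (x - x0) *m A) / enorm (x - x0) < eps] x0.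

Definition Jac (Om : set Rk) (F : Rk -> Rk) (x : Rk) : R :=
  match pselect (exists A, approx_diff Om F A x) with
  | left h => \det (projT1 (cid h))
  | right _ => 0
  end.

Definition distrib (Om : set Rk) (u : Rk -> R) (s : R) : \bar R :=
  lebo [set x | Om x /\ s < `|u x|].

(* integral over C of a nonnegative function |u|, via the layer-cake formula *)
Definition int_abs (C : set Rk) (u : Rk -> R) : \bar R :=
  (\int[lebesgue_measure]_(s in [set s : R | (0 <= s)%R]) distrib C u s)%E.

Definition L1loc (Om : set Rk) (u : Rk -> R) : Prop :=
  forall C : set Rk, compact C -> C `<=` Om -> (int_abs C u < +oo)%E.

Definition tau (psi : R -> R) (t : R) : R := if t == 0 then 0 else 1 / psi (1 / t).
Definition tau_inv (psi : R -> R) (u : \bar R) : \bar R :=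
  ereal_sup [set t%:E | t in [set t : R | 0 <= t /\ ((tau psi t)%:E <= u)%E]].

Definition psinormR (psi : R -> R) (Om : set Rk) (u : Rk -> R) : \bar R :=
  (\int[lebesgue_measure]_(s in [set s : R | (0 <= s)%R]) tau_inv psi (distrib Om u s))%E.

Definition LpsiR (psi : R -> R) (Om : set Rk) (u : Rk -> R) : Prop :=
  lmeas_fun Om u /\ L1loc Om u /\ (psinormR psi Om u < +oo)%E.

Definition psinorm (psi : R -> R) (b : bool) (V : normedModType (Kof R b))
   (Om : set Rk) (h : Rk -> V) : \bar R :=
  psinormR psi Om (fun x => Vnorm (h x)).

Definition Lpsi (psi : R -> R) (b : bool) (V : normedModType (Kof R b))
   (Om : set Rk) (h : Rk -> V) : Prop :=
  lmeas_fun Om h /\ LpsiR psi Om (fun x => Vnorm (h x)).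

Definition Pop (b : bool) (V : normedModType (Kof R b)) (N : nat)
   (g : 'I_N -> Rk -> Kof R b) (f : 'I_N -> Rk -> Rk) (phi : Rk -> V) : Rk -> V :=
  fun x => \sum_(n < N) g n x *: phi (f n x).

Definition solves (b : bool) (V : normedModType (Kof R b)) (N : nat)
   (Om : set Rk) (g : 'I_N -> Rk -> Kof R b) (f : 'I_N -> Rk -> Rk)
   (h0 phi : Rk -> V) : Prop :=
  ae_on Om (fun x => phi x = Pop g f phi x + h0 x).

Definition Lconst (N : nat) (Om : set Rk) (f : 'I_N -> Rk -> Rk) : nat :=
  \max_(S : {set 'I_N} | `[< (0 < lebo (\bigcap_(n in [set n | n \in S]) (f n @` Om)))%E >])
     #|S|.

Definition hypH (b : bool) (V : normedModType (Kof R b)) (N : nat)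
   (Om : set Rk) (f : 'I_N -> Rk -> Rk) (g : 'I_N -> Rk -> Kof R b) (h0 : Rk -> V)
   (K L : nat) : Prop :=
  (forall n, lmeas_fun Om (f n)) /\
  (forall n, ae_on Om (fun x => exists A, approx_diff Om (f n) A x)) /\
  (forall n (M : set Rk), M `<=` Om -> null M -> null (f n @` M)) /\
  (forall n (M : set Rk), null M -> null (Om `&` f n @^-1` M)) /\
  (0 < K)%N /\
  (forall n, null [set x | Om x /\ exists s : seq Rk,
       [/\ uniq s, size s = K.+1 & forall y, y \in s -> Om y /\ f n y = x]]) /\
  (forall n, lmeas_fun Om (g n)) /\ lmeas_fun Om h0 /\
  L = Lconst Om f.

End Leb.

Definition good_psi (R : realType) (psi : R -> R) : Prop :=
  (psi 0 = 0 /\ forall t, 0 <= t -> 0 <= psi t) /\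
  (forall s t, 0 <= s -> s < t -> psi s < psi t) /\
  (forall s t l, 0 <= s -> 0 <= t -> 0 <= l <= 1 ->
      psi (l * s + (1 - l) * t) <= l * psi s + (1 - l) * psi t) /\
  (forall t, 0 < t -> psi x @[x --> t^'-] --> psi t) /\
  (psi x @[x --> 0^'+] --> 0) /\ (psi x @[x --> +oo] --> +oo) /\
  (exists d : R, 1 < d /\ forall t, 0 < t -> psi (2 * t) <= d * psi t) /\
  (psi t / t @[t --> 0^'+] --> 0) /\ (t / psi t @[t --> +oo] --> 0).

(* Main.v *)
Require Import Defs.
From HB Require Import structures.
From mathcomp Require Import all_boot all_order all_algebra.
From mathcomp Require Import all_classical all_reals all_analysis.
From mathcomp Require Import complex.
From mathcomp Require Import perm lra ring measurable_realfun lebesgue_measure.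
Set Implicit Arguments. Unset Strict Implicit. Unset Printing Implicit Defensive.
Import Order.TTheory GRing.Theory Num.Theory.
Import numFieldNormedType.Exports.
Local Open Scope classical_set_scope.
Local Open Scope ring_scope.

(* Write [phi = tau_inv psi] and [mu_u] for the distribution function of [u], so that the norm
   is [|| u || = int phi (mu_|u|)].  The function [phi] is only quasi-concave
   ([phi] increases and [phi t / t] decreases), hence [|| . ||] need not be subadditive.  It is
   however almost additive for bounded small perturbations: if [0 <= w <= e] and
   [int w <= e a], then [|| H + w || <= || H || + 2 e phi a].

   The bound [|g_n| <= alpha |J f_n| / (K L)] and the area inequality for the approximately
   differentiable maps [f_n], with multiplicities at most [K] for each [n] and at most [L]
   among the ranges, show that the positive operator [Q u = sum_n |g_n| (u o f_n)] satisfies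
   [int Q u <= alpha int u]; the bound [|g_n| <= alpha / N] gives [Q 1 <= alpha].  So [Q^i]
   maps an indicator of a set of measure [a] to a function with values at most [alpha^i] and
   integral at most [alpha^i a].  Adding up the dyadic layers of [|h_0|] and the powers
   [Q^i], [i >= j], gives
     [|| H + sum_(i >= j) Q^i |h_0| || <= || H || + 2 alpha^j / (1 - alpha) || h_0 ||],
   which for [H = 0] when [j >= 1], and for [H = |h_0|] and the powers [i >= 1] when [j = 0],
   is at most the stated bound.  Finiteness of this norm makes the series converge absolutely
   almost everywhere.  A second solution [u] satisfies
   [u = sum_(i < m) P^i h_0 + P^m u] almost everywhere, and [|P^m u| <= Q^m |u|] tends to 0
   almost everywhere because [sum_m Q^m |u|] is finite. *)

(** * Quasi-concave functions and the Lorentz functional *)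

(** The order of summation stands in for the missing triangle inequality: the layers are added one
    at a time to a running sum, and each costs twice its height times [phi] of the measure of its
    level set. These costs form a lower Riemann sum of the integral that defines the norm, so
    nothing but the factor 2 is lost. The area inequality comes from pieces on which the map is a
    small relative perturbation of an invertible linear map. Matrices, tolerances, scales and
    locations of the pieces are rational, which leaves countably many of them, and the loss on each
    tends to a factor 1 with the relative error. The Jacobian itself is never integrated: on each
    piece the weight is compared with a constant. Measurable sets are the Caratheodory sets of the
    outer measure [lebo]. Integration theory runs on that sigma-algebra, while images of arbitrary
    sets are estimated by the outer measure directly. *)

Section quasiconcave.
Context {R : realType}.
Local Open Scope ereal_scope.

(** Concavity survives only as [qc_le], the decrease of [phi t / t]; with monotonicity this already
    excludes jumps at positive reals, and [qc_unbounded] fixes the value at [+oo]. *)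
Record quasiconcave (phi : \bar R -> \bar R) : Prop := Quasiconcave {
  qc0 : phi 0 = 0 ;
  qc_homo : {homo phi : x y / x <= y} ;
  qc_le : forall a x : R, (0 < a)%R -> (a <= x)%R ->
    phi x%:E <= (x / a)%:E * phi a%:E ;
  qc_gt0 : forall a : R, (0 < a)%R -> 0 < phi a%:E ;
  qc_fin : forall a : R, phi a%:E < +oo ;
  qc_unbounded : forall M : R, exists x : R, M%:E <= phi x%:E }.

Lemma qc_ge0 phi (qphi : quasiconcave phi) x : 0 <= x -> 0 <= phi x.
Proof. by move=> x0; rewrite -(qc0 qphi) qc_homo. Qed.

Lemma qc_pinfty phi (qphi : quasiconcave phi) : phi +oo = +oo.
Proof.
apply/eqyP => r _; have [x rx] := qc_unbounded qphi r.
by rewrite (le_trans rx)// qc_homo// leey.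
Qed.

(** Jumps are excluded by [q * phi r <= phi (q * r)] for [0 < q < 1], since some [u n] exceeds
    [q * r]. An infinite limit is settled by unboundedness. *)
Lemma qc_cvg phi (qphi : quasiconcave phi) (u : (\bar R)^nat) l :
  nondecreasing_seq u -> (forall n, 0 <= u n) -> u @ \oo --> l ->
  phi (u n) @[n --> \oo] --> phi l.
Proof.
move=> ndu u0 ul.
have lE : l = ereal_sup (range u).
  by rewrite -(cvg_lim _ ul)//; apply/cvg_lim => //; exact: ereal_nondecreasing_cvgn.
have ul' n : u n <= l by rewrite lE; apply: ereal_sup_ubound; exists n.
have ndphi : nondecreasing_seq (phi \o u) by move=> m n mn; apply: qc_homo => //; exact: ndu.
have -> : phi l = ereal_sup (range (phi \o u)); last exact: ereal_nondecreasing_cvgn.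
apply/eqP; rewrite eq_le; apply/andP; split; last first.
  by apply: ge_ereal_sup => _ [n _ <-]; exact: qc_homo.
set S := ereal_sup _.
have ubS n : phi (u n) <= S by apply: ereal_sup_ubound; exists n.
have S0 : 0 <= S by rewrite (le_trans _ (ubS 0%N))// qc_ge0.
have evS (y : \bar R) : y < l -> phi y <= S.
  rewrite lE => /ereal_sup_gt[_ [n _ <-]] yn.
  by rewrite (le_trans _ (ubS n))// qc_homo// ltW.
have : 0 <= l by rewrite (le_trans (u0 0%N)).
case: (l) evS => [r| |] //= evS.
- rewrite lee_fin [X in is_true X -> _]le_eqVlt => /predU1P[<-|r0]; first by rewrite qc0.
  apply/lee_mul01Pr => [|q /andP[q0 q1]]; first by rewrite qc_ge0// lee_fin ltW.
  have qr0 : (0 < q * r)%R by rewrite mulr_gt0.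
  have qrr : (q * r < r)%R by rewrite gtr_pMl.
  rewrite (le_trans _ (evS (q * r)%:E _)) ?lte_fin//.
  have := qc_le qphi qr0 (ltW qrr).
  rewrite invfM mulrA mulrAC mulfV ?gt_eqF// mul1r => h.
  rewrite -[leRHS]mul1e -(@mulfV _ q) ?gt_eqF// EFinM -muleA.
  by rewrite lee_wpmul2l// lee_fin ltW.
- move=> _; rewrite qc_pinfty// leye_eq; apply/eqP/eqyP => A A0.
  have [x Ax] := qc_unbounded qphi A.
  by rewrite (le_trans Ax)// evS// ltry.
Qed.

(** Beyond [a] the slope of [phi] is at most [phi a / a]: [phi (x + d) <= phi x + d * phi x / x] and
    [phi x / x <= phi a / a]. The truncated terms stand on opposite sides because differences of
    infinite values make no sense. *)
Lemma qc_excess phi (qphi : quasiconcave phi) (a : R) (x d : \bar R) :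
  (0 < a)%R -> 0 <= x -> 0 <= d ->
  phi (x + d) + phi (mine x a%:E) <=
  phi x + phi (mine (x + d) a%:E) + (a^-1)%:E * phi a%:E * d.
Proof.
move=> a0; have pa0 := qc_gt0 qphi a0; have paf := qc_fin qphi a.
have fq (y : R) : (0 <= y)%R -> phi y%:E = (fine (phi y%:E))%:E.
  by move=> y0; rewrite fineK// ge0_fin_numE ?qc_fin// qc_ge0.
have ge y : 0 <= y -> 0 <= phi (mine y a%:E).
  by move=> y0; rewrite qc_ge0// le_min y0 lee_fin ltW.
have [d_y|] := eqVneq d +oo.
  move=> x0 _; suff -> : phi x + phi (mine (x + d) a%:E) + (a^-1)%:E * phi a%:E * d = +oo by rewrite leey.
  rewrite d_y gt0_muley ?mule_gt0 ?lte_fin ?invr_gt0// addey//.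
  rewrite -ltNye (@lt_le_trans _ _ 0)//; apply: adde_ge0; first exact: qc_ge0.
  by apply: ge; rewrite adde_ge0 ?leey.
case: d => [d| |]// _; case: x => [x| |]//; last first.
  move=> _ d0; rewrite qc_pinfty// addye ?addye ?leey//.
    by rewrite -ltNye (@lt_le_trans _ _ 0)// mule_ge0// ltW// mule_gt0// lte_fin invr_gt0.
  by rewrite -ltNye (@lt_le_trans _ _ 0)// ge//= addye// leey.
rewrite !lee_fin => x0 d0.
have xd0 : (0 <= x + d)%R by rewrite addr_ge0.
rewrite -EFinD -!EFin_min (fq _ x0) (fq _ xd0) (fq a)//; last exact: ltW.
have [xa|ax] := leP x a; have [xda|axd] := leP (x + d)%R a.
- rewrite (fq _ x0) (fq _ xd0) -!EFinM -!EFinD lee_fin [leLHS]addrC lerDl.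
  by rewrite !mulr_ge0// ?invr_ge0 ?fine_ge0 ?ltW.
- rewrite (fq _ x0) (fq a (ltW a0)) -!EFinM -!EFinD lee_fin.
  have := qc_le qphi a0 (ltW axd); rewrite (fq _ xd0) (fq a (ltW a0)) -EFinM lee_fin.
  move=> h.
  suff : ((x + d) / a * fine (phi a%:E) <= fine (phi a%:E) + a^-1 * fine (phi a%:E) * d)%R by lra.
  rewrite -subr_ge0.
  have -> : (fine (phi a%:E) + a^-1 * fine (phi a%:E) * d - (x + d) / a * fine (phi a%:E) =
     fine (phi a%:E) * ((a - x) / a))%R by field; rewrite gt_eqF.
  apply: mulr_ge0; first by rewrite fine_ge0// ltW.
  by apply: divr_ge0; [rewrite subr_ge0|exact: ltW].
- by exfalso; lra.
- rewrite (fq a (ltW a0)) -!EFinM -!EFinD lee_fin.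
  have x_gt0 : (0 < x)%R by exact: lt_trans ax.
  have xxd : (x <= x + d)%R by rewrite lerDl.
  have h1 := qc_le qphi x_gt0 xxd; have h2 := qc_le qphi a0 (ltW ax).
  move: h1 h2; rewrite (fq _ xd0) (fq _ x0) (fq a (ltW a0)) -!EFinM !lee_fin => h1 h2.
  suff : ((x + d) / x * fine (phi x%:E) <= fine (phi x%:E) + a^-1 * fine (phi a%:E) * d)%R by lra.
  have -> : ((x + d) / x * fine (phi x%:E) = fine (phi x%:E) + x^-1 * fine (phi x%:E) * d)%R.
    by field; rewrite gt_eqF.
  rewrite lerD2l ler_wpM2r// ler_pdivrMl//.
  by rewrite mulrA.
Qed.

(** The graph lies above the chord from the origin. On a set of finite measure this turns the norm
    into an $L^1$ bound. *)
Lemma qc_chord phi (qphi : quasiconcave phi) (c : R) (x : \bar R) :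
  (0 < c)%R -> 0 <= x -> x <= c%:E -> x * phi c%:E <= c%:E * phi x.
Proof.
move=> c0; case: x => [x| |]//; rewrite !lee_fin le_eqVlt => /predU1P[<- _|x0 xc].
  by rewrite mul0e; apply: mule_ge0; rewrite ?qc_ge0// lee_fin ltW.
have x_ge0 : 0 <= x%:E by rewrite lee_fin ltW.
rewrite (le_trans (lee_wpmul2l x_ge0 (qc_le qphi x0 xc)))//.
by rewrite muleA -EFinM mulrCA mulfV ?mulr1// gt_eqF.
Qed.

End quasiconcave.

(** * The generalized inverse [tau_inv psi] *)

Section tau_inv.
Context {R : realType}.
Variable psi : R -> R.
Hypothesis gpsi : good_psi psi.

Lemma good_psi_gt0 (t : R) : 0 < t -> 0 < psi t.
Proof. by case: gpsi => -[p0 _] [/(_ 0 t) + _] t0; rewrite p0; exact. Qed.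

Lemma tau_gt0 (t : R) : 0 < t -> 0 < tau psi t.
Proof.
by move=> t0; rewrite /tau gt_eqF// divr_gt0// good_psi_gt0// divr_gt0.
Qed.

(** Convexity of [psi] between 0 and [1 / (l t)], with [psi 0 = 0], gives
    [psi (1 / t) <= l * psi (1 / (l t))]; take inverses. *)
Lemma tau_star_shaped (l t : R) : 0 <= l <= 1 -> 0 <= t ->
  tau psi (l * t) <= l * tau psi t.
Proof.
move=> /andP[]; rewrite le_eqVlt => /predU1P[<- _|l0 l1] t0.
  by rewrite !mul0r /tau eqxx.
move: t0; rewrite le_eqVlt => /predU1P[<-|t0].
  by rewrite mulr0 /tau eqxx mulr0.
rewrite /tau !gt_eqF ?mulr_gt0// !div1r.
have lt0 : 0 < l * t by rewrite mulr_gt0.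
rewrite -[leRHS]invrK lef_pV2 ?posrE ?good_psi_gt0 ?invr_gt0//; last first.
  by rewrite mulr_gt0// invr_gt0 good_psi_gt0// invr_gt0.
rewrite invfM invrK ler_pdivrMl//.
have [[p0 _] [_ [/(_ (l * t)^-1 0 l) cvx _]]] := gpsi.
have := cvx; rewrite !mulr0 addr0 p0 mulr0 addr0 invfM mulrA mulfV ?gt_eqF//.
rewrite mul1r; apply => //; first by rewrite mulr_ge0// invr_ge0 ltW.
by rewrite l1 ltW.
Qed.

Lemma tau_inv_quasiconcave : quasiconcave (tau_inv psi).
Proof.
have t0 : tau psi 0 = 0 by rewrite /tau eqxx.
have t1 : 0 < tau psi 1 by rewrite tau_gt0.
have lb (u : \bar R) t : 0 <= t -> ((tau psi t)%:E <= u)%E -> (t%:E <= tau_inv psi u)%E.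
  by move=> t_ge0 tu; apply: ereal_sup_ubound; exists t.
split.
- apply/eqP; rewrite eq_le; apply/andP; split; last first.
    by apply: (lb 0%E 0); rewrite ?t0.
  apply: ge_ereal_sup => _ [t [t_ge0 tu] <-].
  rewrite lee_fin leNgt; apply/negP => /tau_gt0.
  by rewrite ltNge -lee_fin tu.
- move=> x y xy; apply: le_ereal_sup => _ [t [t_ge0 tx] <-].
  by exists t => //; split => //; exact: le_trans tx xy.
- move=> a x a0 ax; apply: ge_ereal_sup => _ [t [t_ge0 tx] <-].
  have x0 : 0 < x by exact: lt_le_trans ax.
  have -> : t = x / a * (a / x * t).
    by rewrite mulrA -[x / a]invf_div mulVf ?mul1r// gt_eqF// divr_gt0.
  have ax0 : 0 <= a / x by rewrite divr_ge0// ltW.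
  rewrite EFinM; apply: lee_wpmul2l; first by rewrite lee_fin divr_ge0// ltW.
  apply: lb; first by rewrite mulr_ge0.
  rewrite lee_fin (le_trans (tau_star_shaped _ _))//.
    by rewrite ax0 ler_pdivrMr// mul1r.
  rewrite lee_fin in tx.
  by rewrite mulrAC ler_pdivrMr// ler_pM2l.
(* Star-shapedness gives [tau m <= m * tau 1 <= a] for [m = min 1 (a / tau 1)], so this positive [m]
   is admissible in the supremum. *)
- move=> a a0; apply: (@lt_le_trans _ _ (Num.min 1 (a / tau psi 1))%:E).
    by rewrite lte_fin lt_min ltr01 divr_gt0.
  set m := Num.min _ _; have m01 : 0 <= m <= 1.
    by rewrite /m le_min ler01 divr_ge0 ?(ltW a0) ?(ltW t1)//= ge_min lexx.
  apply: lb; first by case/andP: m01.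
  have := tau_star_shaped m01 ler01; rewrite mulr1 lee_fin => /le_trans; apply.
  by rewrite -ler_pdivlMr// /m ge_min lexx orbT.
(* For [t > 1], star-shapedness with the factor [1 / t] gives [t * tau 1 <= tau t <= a]. *)
- move=> a; apply: (@le_lt_trans _ _ (Num.max 1 (a / tau psi 1))%:E); last by rewrite ltry.
  apply: ge_ereal_sup => _ [t [t_ge0 tx] <-]; rewrite lee_fin in tx.
  rewrite lee_fin.
  rewrite le_max; have [//|lt1t] := leP t 1; rewrite ler_pdivlMr//.
  have t_gt0 : 0 < t by exact: lt_trans lt1t.
  have : 0 <= t^-1 <= 1 by rewrite invr_ge0 t_ge0/= invf_le1// ltW.
  move=> /tau_star_shaped - /(_ t t_ge0); rewrite mulVf ?gt_eqF//.
  by rewrite ler_pdivlMl// => /le_trans; apply.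
- move=> M; exists (tau psi (Num.max M 0)); apply: (@le_trans _ _ (Num.max M 0)%:E).
    by rewrite lee_fin le_max lexx.
  by apply: lb; rewrite ?le_max ?lexx ?orbT.
Qed.

End tau_inv.

(** * Monotone functions and translations on the line *)

Section lebesgue_line.
Context {R : realType}.
Local Open Scope ereal_scope.

Lemma nonincreasing_emeasurable (D : set R) (f : R -> \bar R) : measurable D ->
  {homo f : s t / (s <= t)%R >-> t <= s} -> measurable_fun D f.
Proof.
move=> mD f_ni _; apply: (measurability _ (ErealGenCInfty.measurableE R)) => //.
move=> _ [_ [r ->] <-]; apply: measurableI => //.
apply: is_interval_measurable => s t /=.
rewrite !in_itv/= !andbT => fs ft u /andP[su ut].
by rewrite in_itv/= andbT (le_trans ft)// f_ni.
Qed.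

(** The shift carries Lebesgue measure to a measure with the same values on half-open intervals,
    hence to itself; the rest is a change of variable under a push-forward. *)
Lemma ge0_integral_shift (f : R -> \bar R) (e : R) :
  measurable_fun setT f -> (forall s, 0 <= f s) ->
  \int[lebesgue_measure]_(s in [set s : R | (e <= s)%R]) f (s - e)%R =
  \int[lebesgue_measure]_(s in [set s : R | (0 <= s)%R]) f s.
Proof.
move=> mf f0.
pose sh := (fun s : R => (s - e)%R) : measurableTypeR R -> measurableTypeR R.
have msh : measurable_fun setT sh by exact: measurable_funB.
rewrite (_ : [set s : R | (e <= s)%R] = sh @^-1` [set s : R | (0 <= s)%R]); last first.
  by apply/seteqP; split => s /=; rewrite /sh subr_ge0.
have m0 : measurable [set s : R | (0 <= s)%R] by rewrite -set_itvcy.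
have := @ge0_integral_pushforward _ _ _ _ R sh msh lebesgue_measure _ f m0.
move=> /(_ _ _)/esym ->; [|exact: measurable_funS mf|by move=> *; exact: f0].
apply: eq_measure_integral => A mA _; apply/esym.
apply: (@lebesgue_measure_unique _ (pushforward lebesgue_measure sh)) => //.
move=> _ [[a b] _ <-].
change (@lebesgue_measure R `]a, b]%classic =
  @lebesgue_measure R (sh @^-1` `]a, b]%classic)).
have -> : sh @^-1` `]a, b]%classic = `](a + e)%R, (b + e)%R]%classic.
  by apply/seteqP; split => s /=; rewrite !in_itv/= ltrBrDr lerBlDr.
rewrite !lebesgue_measure_itv/= !lte_fin ltrD2r; case: ifPn => // _.
by rewrite -!EFinB; congr EFin; ring.
Qed.

End lebesgue_line.

(** * The Lorentz functional under small perturbations *)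

Section lorentz.
Context d (X : measurableType d) (R : realType).
Variable mu : {sigma_finite_measure set X -> \bar R}.
Variables (phi : \bar R -> \bar R) (qphi : quasiconcave phi).
Local Open Scope ereal_scope.

Local Notation Rpos := [set s : R | (0 <= s)%R].

(** Values are extended reals, so that infinite series of non-negative functions can be inserted
    before they are known to be finite. *)
Definition lorentz (u : X -> \bar R) :=
  \int[lebesgue_measure]_(s in Rpos) phi (mu [set x | s%:E < u x]).

Lemma measurable_Rpos : measurable Rpos.
Proof. by rewrite -set_itvcy. Qed.
Hint Resolve measurable_Rpos : core.

Section distribution.
Variables (u : X -> \bar R) (mmu : measurable_fun setT u).

Lemma measurable_gt s : measurable [set x | s < u x].
Proof. by rewrite -[X in measurable X]setTI; exact: emeasurable_fun_o_infty. Qed.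

Lemma distribution_homo :
  {homo (fun s : R => mu [set x | s%:E < u x]) : s t / (s <= t)%R >-> t <= s}.
Proof.
move=> s t st; apply: le_measure; rewrite ?inE; try exact: measurable_gt.
by move=> x /=; apply: le_lt_trans; rewrite lee_fin.
Qed.

Lemma measurable_distribution D (f : \bar R -> \bar R) : measurable D ->
  {homo f : x y / x <= y} ->
  measurable_fun D (fun s : R => f (mu [set x | s%:E < u x])).
Proof.
move=> mD homof; apply: nonincreasing_emeasurable => // s t st.
by apply: homof; exact: distribution_homo.
Qed.

Lemma qc_mu_ge0 A : 0 <= phi (mu A).
Proof. by rewrite qc_ge0. Qed.

Lemma lorentz_ge0 : 0 <= lorentz u.
Proof. by apply: integral_ge0 => s _; exact: qc_mu_ge0. Qed.

End distribution.
Hint Resolve qc_mu_ge0 : core.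

(** Three monotone limits are nested: the level sets increase to their union, [phi] is continuous
    along increasing sequences, and the integrals converge monotonically. *)
Lemma cvg_lorentz (u : (X -> \bar R)^nat) v :
  (forall n, measurable_fun setT (u n)) -> (forall n x, 0 <= u n x) ->
  (forall x, nondecreasing_seq (u^~ x)) -> (forall x, u n x @[n --> \oo] --> v x) ->
  lorentz (u n) @[n --> \oo] --> lorentz v.
Proof.
move=> mmu u0 ndu uv.
have vE x : v x = ereal_sup (range (u^~ x)).
  rewrite -(cvg_lim _ (uv x))//; apply/cvg_lim => //.
  exact: ereal_nondecreasing_cvgn.
have nd s : nondecreasing_seq (fun n => mu [set x | s < u n x]).
  move=> m n mn; apply: le_measure; rewrite ?inE; try exact: measurable_gt.
  by move=> x /= /lt_le_trans; apply; exact: ndu.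
have cv s : mu [set x | s < u n x] @[n --> \oo] --> mu [set x | s < v x].
  have -> : [set x | s < v x] = \bigcup_n [set x | s < u n x].
    apply/seteqP; split => x /=.
      by rewrite vE => /ereal_sup_gt[_ [n _ <-]] sx; exists n.
    by move=> [n _] /lt_le_trans; apply; rewrite vE; apply: ereal_sup_ubound; exists n.
  apply: nondecreasing_cvg_mu.
  - by move=> n; exact: measurable_gt.
  - by apply: bigcup_measurable => n _; exact: measurable_gt.
  - move=> m n mn; apply/subsetPset => x /= /lt_le_trans; apply; exact: ndu.
rewrite /lorentz.
have -> : \int[lebesgue_measure]_(s in Rpos) phi (mu [set x | s%:E < v x]) =
    \int[lebesgue_measure]_(s in Rpos) limn (fun n => phi (mu [set x | s%:E < u n x])).
  apply: eq_integral => s _; apply/esym/cvg_lim => //.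
  by apply: qc_cvg.
apply: cvg_monotone_convergence => //.
- by move=> n; apply: measurable_distribution => //; exact: qc_homo.
- by move=> s _ m n mn; apply: qc_homo => //; exact: nd.
Qed.

Lemma lorentz_lim_le (u : (X -> \bar R)^nat) v C :
  (forall n, measurable_fun setT (u n)) -> (forall n x, 0 <= u n x) ->
  (forall x, nondecreasing_seq (u^~ x)) -> (forall x, u n x @[n --> \oo] --> v x) ->
  (forall n, lorentz (u n) <= C) -> lorentz v <= C.
Proof.
move=> mmu u0 ndu uv uC; rewrite -(cvg_lim _ (cvg_lorentz mmu u0 ndu uv))//.
apply: lime_le; last exact: nearW.
by apply/cvg_ex; exists (lorentz v); exact: cvg_lorentz.
Qed.

Section add_bounded.
Variables (H w : X -> \bar R) (e a : R).
Hypotheses (mH : measurable_fun setT H) (mw : measurable_fun setT w).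
Hypotheses (H0 : forall x, 0 <= H x) (w0 : forall x, 0 <= w x).
Hypotheses (we : forall x, w x <= e%:E) (e0 : (0 <= e)%R).

Let m s := mu [set x | s%:E < H x].
Let M s := mu [set x | s%:E < H x + w x].
Let dd s := mu [set x | H x <= s%:E /\ s%:E < H x + w x].

Let mHw : measurable_fun setT (fun x => H x + w x).
Proof. exact: emeasurable_funD. Qed.

Let mdd s : measurable [set x | H x <= s%:E /\ s%:E < H x + w x].
Proof.
rewrite (_ : [set _ | _] = (setT `&` [set x | H x <= s%:E]) `&` (setT `&` [set x | s%:E < H x + w x])).
  by apply: measurableI; [exact: emeasurable_fun_infty_c|exact: emeasurable_fun_o_infty].
by rewrite !setTI.
Qed.

Let ME s : M s = m s + dd s.
Proof.
rewrite /M /m /dd -measureU//; first last.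
- by apply/seteqP; split => x //= -[] /lt_le_trans h [] /h; rewrite ltxx.
- exact: measurable_gt.
congr (mu _); apply/seteqP; split => x /=.
  by move=> sM; have [|] := leP (H x) s%:E; [right|left].
by case=> [/lt_le_trans|[]//]; apply; rewrite leeDl.
Qed.

(** [dd s] measures the points that [w] lifts above level [s]. By Tonelli on the region between the
    graphs of [H] and [H + w]: its section over [x] is an interval of length [w x], or empty when
    [H x] is infinite. *)
Lemma integral_gain : measurable_fun setT dd /\
  \int[lebesgue_measure]_(s in Rpos) dd s <= \int[mu]_x w x.
Proof.
pose A := [set z : X * measurableTypeR R | H z.1 <= (z.2 : R)%:E /\ (z.2 : R)%:E < H z.1 + w z.1].
have m2 : measurable_fun setT (fun z : X * measurableTypeR R => (z.2 : R)%:E).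
  by apply: measurableT_comp => //; exact: EFin_measurable.
have m1 (f : X -> \bar R) : measurable_fun setT f ->
    measurable_fun setT (fun z : X * measurableTypeR R => f z.1).
  by move=> mf; apply: measurableT_comp.
have mA : measurable A.
  rewrite (_ : A = (setT `&` [set z | H z.1 <= (z.2 : R)%:E]) `&`
      (setT `&` [set z | (z.2 : R)%:E < H z.1 + w z.1])).
    by apply: measurableI; [apply: measurable_lee => //; exact: m1
      |apply: measurable_lte => //; exact: (m1 _ mHw)].
  by rewrite !setTI.
have GE := indic_fubini_tonelli_GE mu mA.
have FE := indic_fubini_tonelli_FE lebesgue_measure mA.
have ddE : dd = mu \o ysection A.
  apply/funext => s /=; congr (mu _); apply/seteqP; split => x /=.
    by move=> h; rewrite /ysection/= inE.
  by rewrite /ysection/= inE.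
have mdd' : measurable_fun setT dd by rewrite ddE; exact: measurable_fun_ysection.
split => //.
apply: (@le_trans _ _ (\int[lebesgue_measure]_s dd s)).
  by apply: ge0_subset_integral => // s _; exact: measure_ge0.
have := indic_fubini_tonelli mu lebesgue_measure mA.
rewrite GE FE -ddE => <-.
apply: ge0_le_integral => //.
- by apply: (measurable_fun_xsection _ mA).
move=> x _ /=.
case Hx: (H x) => [h| |].
- have /ge0_fin_numE wf := w0 x.
  have wxf : w x \is a fin_num by rewrite wf (le_lt_trans (we x))// ltry.
  rewrite (_ : xsection A x = `[h, (h + fine (w x))%R[%classic); last first.
    apply/seteqP; split => s /=; rewrite in_itv/= /xsection/= inE/= /A/= Hx lee_fin.
      by rewrite -(fineK wxf) -EFinD lte_fin => -[-> ->].
    by move=> /andP[-> sw]; split => //; rewrite -(fineK wxf) -EFinD lte_fin.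
  rewrite lebesgue_measure_itv/= lte_fin ltrDl; case: ifPn => // _.
  by rewrite -EFinB -[leRHS](fineK wxf) lee_fin addrAC subrr add0r.
- rewrite (_ : xsection A x = set0) ?measure0//.
  by apply/seteqP; split => s //=; rewrite /xsection/= inE/= /A/= Hx => -[].
- by have := H0 x; rewrite Hx.
Qed.

Hypothesis wa : \int[mu]_x w x <= (e * a)%:E.

Let homomin b : {homo (fun y => phi (mine y b)) : x y / x <= y}.
Proof.
by move=> x y xy; apply: qc_homo => //; rewrite le_min !ge_min xy lexx orbT.
Qed.

(* [phi] splits as [min phi (phi a)] plus a part that is [phi a / a]-Lipschitz.  The first
   part is handled by [mu_(H + w) s <= mu_H (s - e)], the second one by the [L^1] bound on
   [w]; each contributes [e phi a]. *)
Lemma lorentzD_le : (0 < a)%R ->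
  lorentz (fun x => H x + w x) <= lorentz H + (2 * e)%:E * phi a%:E.
Proof.
move=> a0; have [mdd' intdd] := integral_gain.
have ea0 : 0 <= (2 * e)%:E * phi a%:E.
  by apply: mule_ge0; rewrite ?qc_ge0 ?lee_fin ?mulr_ge0// ltW.
have [Hy|] := eqVneq (lorentz H) +oo.
  by rewrite Hy addye ?leey// -ltNye (lt_le_trans _ ea0).
rewrite -ltey => Hfin.
have pae : 0 <= phi a%:E by rewrite qc_ge0// lee_fin ltW.
pose pa y := phi (mine y a%:E).
have pa0 y : 0 <= y -> 0 <= pa y.
  by move=> y0; rewrite /pa qc_ge0// le_min y0 lee_fin ltW.
have mm : measurable_fun Rpos (fun s => phi (m s)).
  by apply: measurable_distribution => //; exact: qc_homo.
have mM : measurable_fun Rpos (fun s => phi (M s)).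
  by apply: (measurable_distribution mHw) => //; exact: qc_homo.
have mpm D : measurable D -> measurable_fun D (fun s => pa (m s)).
  by move=> mD; apply: (measurable_distribution mH) => //; exact: homomin.
have mpM D : measurable D -> measurable_fun D (fun s => pa (M s)).
  by move=> mD; apply: (measurable_distribution mHw) => //; exact: homomin.
have phm0 s : 0 <= phi (m s) by exact: qc_mu_ge0.
have phM0 s : 0 <= phi (M s) by exact: qc_mu_ge0.
have pm0 s : 0 <= pa (m s) by exact: pa0.
have pM0 s : 0 <= pa (M s) by exact: pa0.
(* This integral occurs on both sides of the final inequality and can be cancelled only because it
   is finite. *)
have pmfin : \int[lebesgue_measure]_(s in Rpos) pa (m s) \is a fin_num.
  rewrite ge0_fin_numE ?integral_ge0// (le_lt_trans _ Hfin)//.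
  apply: ge0_le_integral => //; first exact: mpm.
  by move=> s _; apply: qc_homo => //; rewrite ge_min lexx.
have c0 : 0 <= (a^-1)%:E * phi a%:E.
  by apply: mule_ge0 => //; rewrite lee_fin invr_ge0 ltW.
have step1 : lorentz (fun x => H x + w x) +
    \int[lebesgue_measure]_(s in Rpos) pa (m s) <=
    lorentz H + \int[lebesgue_measure]_(s in Rpos) pa (M s) + e%:E * phi a%:E.
  have -> : e%:E * phi a%:E = (a^-1)%:E * phi a%:E * (e * a)%:E.
    by rewrite -muleA muleCA muleC -EFinM mulrCA mulVf ?mulr1 1?muleC// gt_eqF.
  apply: (@le_trans _ _ (lorentz H + \int[lebesgue_measure]_(s in Rpos) pa (M s) +
     (a^-1)%:E * phi a%:E * \int[lebesgue_measure]_(s in Rpos) dd s)); last first.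
    by apply: leeD2l; apply: lee_wpmul2l => //; exact: le_trans intdd wa.
  rewrite -ge0_integralZl//; last exact: measurable_funS mdd'.
  have mpMR := mpM _ measurable_Rpos; have mpmR := mpm _ measurable_Rpos.
  have mcd : measurable_fun Rpos (fun s => (a^-1)%:E * phi a%:E * dd s).
    by apply: measurable_funeM; exact: measurable_funS mdd'.
  have cd0 s : 0 <= (a^-1)%:E * phi a%:E * dd s by apply: mule_ge0.
  have -> : lorentz (fun x => H x + w x) + \int[lebesgue_measure]_(s in Rpos) pa (m s) =
      \int[lebesgue_measure]_(s in Rpos) (phi (M s) + pa (m s)) by rewrite ge0_integralD.
  have -> : lorentz H + \int[lebesgue_measure]_(s in Rpos) pa (M s) =
      \int[lebesgue_measure]_(s in Rpos) (phi (m s) + pa (M s)) by rewrite ge0_integralD.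
  rewrite -ge0_integralD//; [|by move=> s _; exact: adde_ge0|exact: emeasurable_funD].
  apply: ge0_le_integral => //.
  - by move=> s _; exact: adde_ge0.
  - exact: emeasurable_funD.
  - by apply: emeasurable_funD => //; exact: emeasurable_funD.
  - by move=> s _; rewrite ME; apply: qc_excess.
have step2 : \int[lebesgue_measure]_(s in Rpos) pa (M s) <=
    e%:E * phi a%:E + \int[lebesgue_measure]_(s in Rpos) pa (m s).
  have -> : Rpos = `[0%R, e[%classic `|` [set s : R | (e <= s)%R].
    apply/seteqP; split => s /=; rewrite in_itv/=.
      by move=> s0; have [|] := ltP s e; [left; rewrite s0|right].
    by move=> [/andP[]//|]; exact: le_trans.
  have me : measurable [set s : R | (e <= s)%R] by rewrite -set_itvcy.
  rewrite ge0_integral_setU//; first last.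
  - rewrite disj_set2E; apply/eqP/seteqP; split => s //=; rewrite in_itv/=.
    by case=> /andP[_ se]; rewrite leNgt se.
  - by apply: mpM; exact: measurableU.
  apply: leeD.
    apply: (@le_trans _ _ (\int[lebesgue_measure]_(s in `[0%R, e[) phi a%:E)).
      apply: ge0_le_integral => //; first exact: mpM.
      by move=> s _; apply: qc_homo => //; rewrite ge_min lexx orbT.
    rewrite integral_cst//= lebesgue_measure_itv/= lte_fin.
    by case: ifPn => [_|]; rewrite ?mule0 ?sube0 1?muleC// mule_ge0.
  rewrite -(_ : [set s : R | (0 <= s)%R] = `[0%R, e[%classic `|` [set s : R | (e <= s)%R]); last first.
    apply/seteqP; split => s /=; rewrite in_itv/=.
      by move=> s0; have [|] := ltP s e; [left; rewrite s0|right].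
    by move=> [/andP[]//|]; exact: le_trans.
  rewrite -(ge0_integral_shift e)//; last exact: mpm.
  apply: ge0_le_integral => //; first exact: mpM.
    apply: nonincreasing_emeasurable => // s t st; apply: homomin.
    by apply: distribution_homo => //; rewrite lerB.
  move=> s _; apply: homomin; apply: le_measure; rewrite ?inE; try exact: measurable_gt.
  move=> x /= sHw; rewrite EFinB lteBlDr//.
  by rewrite (lt_le_trans sHw)// leeD2l.
set I := \int[lebesgue_measure]_(s in Rpos) pa (m s) in pmfin step1 step2.
suff : lorentz (fun x => H x + w x) + I <= lorentz H + (2 * e)%:E * phi a%:E + I.
  by rewrite leeD2rE.
rewrite (le_trans step1)//.
rewrite -addeA (le_trans (leeD2l _ (leeD2r _ step2)))//.
rewrite -[leRHS]addeA; apply: leeD2l.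
rewrite addeAC; apply: leeD2r.
by rewrite mulr_natl mulr2n EFinD ge0_muleDl// lee_fin.
Qed.

(** In the degenerate case the quotient [phi a / a] is meaningless, but then [w] has integral 0,
    vanishes almost everywhere, and no level set gains measure. *)
Lemma lorentzD_eq : a = 0%R -> lorentz (fun x => H x + w x) = lorentz H.
Proof.
move=> a0; apply: eq_integral => s _; congr phi; rewrite -/(M s) ME.
suff -> : dd s = 0 by rewrite adde0.
have : \int[mu]_x `|w x| = 0.
  apply/eqP; rewrite eq_le integral_ge0// andbT.
  by under eq_integral do rewrite gee0_abs//; rewrite (le_trans wa)// a0 mulr0.
move=> /(ae_eq_integral_abs mu measurableT mw) [N [mN N0 wN]].
apply/eqP; rewrite eq_le measure_ge0 andbT -N0.
apply: le_measure; rewrite ?inE//.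
move=> x /= [Hs sHw]; apply: wN => /= /(_ Logic.I) wx0.
by move: sHw; rewrite wx0 /= adde0 ltNge Hs.
Qed.

End add_bounded.

End lorentz.

(** * Positive transfer operators *)

Section layers.
Context {R : realType}.
Implicit Types (y : \bar R) (t r : R).

(** The successor makes each level the right end of its dyadic interval, so that sums over levels
    are lower Riemann sums of nonincreasing functions. It also keeps the levels positive, where
    level sets of functions of finite norm have finite measure. *)
Definition level (n l : nat) : R := l.+1%:R / 2 ^+ n.

(* [layer n] increases to the identity, and it is a combination of indicators of
   upper level sets. *)
Definition layer (n : nat) y : R :=
  \sum_(l < n * 2 ^ n) (2 ^- n) * ((level n l)%:E < y)%E%:R.

Lemma count_below_le t M : 0 <= t -> \sum_(l < M) ((l.+1%:R < t)%R%:R : R) <= t.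
Proof.
move=> t0; elim: M => [|M IH]; first by rewrite big_ord0.
have [tM|Mt] := leP t M.+1%:R.
  by rewrite big_ord_recr/= ltNge tM/= addr0.
apply: (le_trans _ (ltW Mt)).
have -> : M.+1%:R = \sum_(l < M.+1) (1 : R) by rewrite sumr_const card_ord.
by apply: ler_sum => l _; case: (_ < _); rewrite /= ?ler01 ?lexx.
Qed.

Lemma count_below_ge t M :
  Num.min M%:R (t - 1) <= \sum_(l < M) ((l.+1%:R < t)%R%:R : R).
Proof.
elim: M => [|M IH]; first by rewrite big_ord0 ge_min lexx.
have [tM|Mt] := leP t M.+1%:R; rewrite big_ord_recr/=.
  rewrite ltNge tM/= addr0 (le_trans _ IH)// le_min !ge_min lexx orbT andbT.
  by rewrite lerBlDr -natr1 in tM *; rewrite tM orbT.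
rewrite Mt/= -natr1 ge_min; apply/orP; left; rewrite lerD2r (le_trans _ IH)//.
by rewrite le_min lexx/= lerBrDr natr1 ltW.
Qed.

Lemma layerE n r : layer n r%:E =
  2 ^- n * \sum_(l < n * 2 ^ n) ((l.+1%:R < r * 2 ^+ n)%R%:R : R).
Proof.
rewrite /layer -mulr_sumr; congr (_ * _); apply: eq_bigr => l _.
by rewrite lte_fin /level ltr_pdivrMr// exprn_gt0.
Qed.

Lemma layer_ge0 n y : 0 <= layer n y.
Proof. by rewrite /layer sumr_ge0// => l _; rewrite mulr_ge0// invr_ge0 exprn_ge0. Qed.

(** Refinement splits a step of height [2 ^- n] into two of half the height, one at the same level
    and one below it, so a step that is present stays present. *)
Lemma layer_nd y : nondecreasing_seq (layer^~ y).
Proof.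
apply/nondecreasing_seqP => n; rewrite /layer.
have pair (F : nat -> R) M : \sum_(l < M * 2) F l = \sum_(l < M) (F (l * 2)%N + F (l * 2).+1).
  elim: M => [|M IH]; first by rewrite !big_ord0.
  by rewrite mulSn addSn add1n !big_ord_recr/= IH -addrA.
rewrite -(big_mkord xpredT (fun l => 2 ^- n.+1 * ((level n.+1 l)%:E < y)%E%:R)).
rewrite (big_cat_nat _ (n := n * 2 ^ n * 2))//=; last first.
  by rewrite -mulnA -expnSr leq_mul.
rewrite ler_wpDr//.
  by apply: sumr_ge0 => l _; rewrite mulr_ge0// invr_ge0 exprn_ge0.
rewrite big_mkord (pair (fun l => 2 ^- n.+1 * ((level n.+1 l)%:E < y)%E%:R)); apply: ler_sum => l _.
have lev : level n.+1 (l * 2).+1 = level n l.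
  by rewrite /level exprSr -[(l * 2).+2]/(l.+1 * 2)%N natrM -mulf_div divff// mulr1.
have lev' : level n.+1 (l * 2) <= level n l.
  by rewrite -lev /level ler_pM2r ?invr_gt0 ?exprn_gt0// ler_nat.
rewrite lev; case: ltP => /= ly; last first.
  by rewrite !mulr0 addr0 mulr_ge0// invr_ge0 exprn_ge0.
rewrite (le_lt_trans _ ly) ?lee_fin//= !mulr1 -mulr2n -[leRHS]mulr_natr.
by rewrite exprSr invfM -mulrA mulVf// mulr1.
Qed.

Lemma layer_le n r : 0 <= r -> layer n r%:E <= r.
Proof.
move=> r0; rewrite layerE ler_pdivrMl ?exprn_gt0// mulrC count_below_le//.
by rewrite mulr_ge0// exprn_ge0.
Qed.

Lemma layer_ge n r : r <= n%:R -> r - 2 ^- n <= layer n r%:E.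
Proof.
move=> rn; rewrite layerE ler_pdivlMl ?exprn_gt0// (le_trans _ (count_below_ge _ _))//.
rewrite le_min mulrBr mulfV ?gt_eqF ?exprn_gt0// [_ * r]mulrC lexx andbT.
by rewrite natrM natrX (@le_trans _ _ (r * 2 ^+ n))// ?gerBl// ler_pM2r ?exprn_gt0.
Qed.

Lemma layer_pinfty n : layer n +oo%E = n%:R.
Proof.
rewrite /layer (eq_bigr (fun=> 2 ^- n)); last by move=> l _; rewrite ltry mulr1.
by rewrite sumr_const card_ord -[LHS]mulr_natr natrM natrX mulrCA mulVf ?mulr1// gt_eqF ?exprn_gt0.
Qed.

Lemma layer_cvg y : (0 <= y)%E -> (layer n y)%:E @[n --> \oo] --> y.
Proof.
case: y => [r| |]// r0; last first.
  by under eq_fun do rewrite layer_pinfty; exact/cvgenyP.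
rewrite lee_fin in r0; apply: cvg_EFin; first exact: nearW.
apply: (@squeeze_cvgr _ _ _ _ (fun n => r - 2 ^- n) (cst r)).
- near=> n; rewrite layer_le// andbT layer_ge//.
  near: n; exact: nbhs_infty_ger.
- rewrite -[X in _ --> X]subr0; apply: cvgB; first exact: cvg_cst.
  have -> : (fun n => 2 ^- n) = (fun n => (2^-1) ^+ n) :> (nat -> R).
    by apply/funext => n; rewrite exprVn.
  by apply: cvg_expr; rewrite ger0_norm ?invr_ge0// invf_lt1 ?ltr1n.
- exact: cvg_cst.
Unshelve. all: by end_near. Qed.

End layers.

(** * Iterates of a positive transfer operator *)

Section transfer.
Context d (X : measurableType d) (R : realType).
Variable mu : {sigma_finite_measure set X -> \bar R}.
Local Open Scope ereal_scope.
Local Notation Rpos := [set s : R | (0 <= s)%R].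
Implicit Types u v h H : X -> \bar R.

Definition levset h n l := [set x | (level n l)%:E < h x].

Definition layer_fun h (n : nat) : X -> \bar R :=
  fun x => \sum_(l < n * 2 ^ n) (2 ^- n)%:E * (\1_(levset h n l) x)%:E.

Lemma layer_funE h n x : layer_fun h n x = (layer n (h x))%:E.
Proof.
rewrite /layer_fun /layer -sumEFin; apply: eq_bigr => l _.
rewrite -EFinM; congr (_ * _)%:E; rewrite indicE; congr (nat_of_bool _)%:R.
by apply/idP/idP; rewrite inE.
Qed.

Lemma layer_fun_ge0 h n x : 0 <= layer_fun h n x.
Proof. by rewrite layer_funE lee_fin layer_ge0. Qed.

Lemma measurable_levset h n l : measurable_fun setT h -> measurable (levset h n l).
Proof. by move=> mh; exact: measurable_gt. Qed.

Lemma measurable_layer_fun h n : measurable_fun setT h ->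
  measurable_fun setT (layer_fun h n).
Proof.
move=> mh; apply: emeasurable_sum => l; apply: measurable_funeM.
by apply/measurable_EFinP; apply: measurable_indic; exact: measurable_levset.
Qed.

Section riemann_sum.
Variables (F : R -> \bar R) (F0 : forall s, 0 <= F s).
Hypothesis Fni : {homo F : s t / (s <= t)%R >-> t <= s}.

Lemma lower_sum_le n M :
  \sum_(l < M) (2 ^- n)%:E * F (level n l) <= \int[lebesgue_measure]_(s in Rpos) F s.
Proof.
pose b (l : nat) : R := (l%:R / 2 ^+ n)%R.
have b0 l : (0 <= b l)%R by rewrite divr_ge0// exprn_ge0.
have bS l : (b l < b l.+1)%R by rewrite ltr_pM2r ?invr_gt0 ?exprn_gt0// ltr_nat.
have mF D : measurable D -> measurable_fun D F.
  by move=> mD; exact: nonincreasing_emeasurable.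
apply: (@le_trans _ _ (\int[lebesgue_measure]_(s in `[0%R, b M[) F s)); last first.
  apply: ge0_subset_integral => //; [exact: measurable_Rpos|apply: mF; exact: measurable_Rpos|].
  by move=> s /=; rewrite in_itv/= => /andP[].
elim: M => [|M IH]; first by rewrite big_ord0 integral_ge0.
rewrite big_ord_recr/=.
have -> : `[0%R, b M.+1[%classic = `[0%R, b M[%classic `|` `[b M, b M.+1[%classic.
  apply/seteqP; split => s /=; rewrite !in_itv/=.
    by move=> /andP[-> ->]; rewrite andbT; have [|] := ltP s (b M); [left|right].
  move=> [/andP[-> sM]|/andP[Ms ->]]; first exact: lt_trans (bS M).
  by rewrite (le_trans (b0 M)).
rewrite ge0_integral_setU//; first last.
- rewrite disj_set2E; apply/eqP/seteqP; split => s //=; rewrite !in_itv/=.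
  by case=> /andP[_ se] /andP[]; rewrite leNgt se.
- by apply: nonincreasing_emeasurable => //; apply: measurableU; exact: measurable_itv.
apply: leeD => //.
apply: (@le_trans _ _ (\int[lebesgue_measure]_(s in `[b M, b M.+1[) cst (F (level n M)) s)).
  rewrite integral_cst//= lebesgue_measure_itv/= lte_fin bS muleC -EFinB.
  by rewrite /b -mulrBl -natrB// subSnn mul1r.
apply: ge0_le_integral => //; [by move=> s _ /=; exact: F0|by apply: mF|].
by move=> s /=; rewrite in_itv/= => /andP[_ /ltW]; exact: Fni.
Qed.

End riemann_sum.

Variables (N : nat) (gam : 'I_N -> X -> R) (f : 'I_N -> X -> X) (alpha : R).
Hypotheses (mgam : forall n, measurable_fun setT (gam n)) (mf : forall n, measurable_fun setT (f n)).
Hypotheses (gam0 : forall n x, (0 <= gam n x)%R)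
  (gam_le : forall x, (\sum_n gam n x <= alpha)%R).
Hypothesis gam_int : forall A, measurable A ->
  \int[mu]_x (\sum_n (gam n x)%:E * (\1_A (f n x))%:E) <= alpha%:E * mu A.
Hypothesis alpha0 : (0 <= alpha)%R.

Definition transfer u : X -> \bar R := fun x => \sum_n (gam n x)%:E * u (f n x).

Lemma transfer_ge0 u : (forall x, 0 <= u x) -> forall x, 0 <= transfer u x.
Proof. by move=> u0 x; apply: sume_ge0 => n _; rewrite mule_ge0// lee_fin. Qed.

Lemma measurable_transfer u : measurable_fun setT u -> measurable_fun setT (transfer u).
Proof.
move=> mmu; apply: emeasurable_sum => n; apply: emeasurable_funM.
  exact/measurable_EFinP.
by apply: measurableT_comp => //; exact: mf.
Qed.

Lemma le_transfer u v : (forall x, u x <= v x) -> forall x, transfer u x <= transfer v x.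
Proof. by move=> uv x; apply: lee_sum => n _; rewrite lee_wpmul2l// lee_fin. Qed.

Lemma transfer_le (c : R) u : (0 <= c)%R -> (forall x, u x <= c%:E) ->
  forall x, transfer u x <= (alpha * c)%:E.
Proof.
move=> c0 uc x; apply: (@le_trans _ _ (\sum_n (gam n x)%:E * c%:E)).
  by apply: lee_sum => n _; rewrite lee_wpmul2l// lee_fin.
under eq_bigr do rewrite -EFinM.
by rewrite sumEFin lee_fin -mulr_suml ler_wpM2r.
Qed.

Lemma transfer_sum M (k : R) (u : nat -> X -> \bar R) : (0 <= k)%R ->
  (forall l x, 0 <= u l x) ->
  transfer (fun x => \sum_(l < M) k%:E * u l x) =
  fun x => \sum_(l < M) k%:E * transfer (u l) x.
Proof.
move=> k0 u0; apply/funext => x; rewrite /transfer.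
transitivity (\sum_n \sum_(l < M) (gam n x)%:E * (k%:E * u l (f n x))).
  apply: eq_bigr => n _; rewrite ge0_sume_distrr// => l _.
  by rewrite mule_ge0// lee_fin.
rewrite exchange_big/=; apply: eq_bigr => l _.
rewrite ge0_sume_distrr//; last by move=> n _; rewrite mule_ge0// lee_fin.
by apply: eq_bigr => n _; rewrite muleCA.
Qed.

Lemma cvg_transfer (u : (X -> \bar R)^nat) v :
  (forall n x, 0 <= u n x) -> (forall x, u n x @[n --> \oo] --> v x) ->
  forall x, transfer (u n) x @[n --> \oo] --> transfer v x.
Proof.
move=> u0 uv x; apply: cvg_nnesum => [n _|n _].
  by apply: nearW => k; rewrite mule_ge0// lee_fin.
exact: cvgeZl.
Qed.

Lemma iter_transfer_ge0 i u : (forall x, 0 <= u x) -> forall x, 0 <= iter i transfer u x.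
Proof. by move=> u0; elim: i => [|i IH]//=; exact: transfer_ge0. Qed.

Lemma measurable_iter_transfer i u : measurable_fun setT u ->
  measurable_fun setT (iter i transfer u).
Proof. by move=> mmu; elim: i => [|i IH]//=; exact: measurable_transfer. Qed.

Lemma le_iter_transfer i u v : (forall x, u x <= v x) ->
  forall x, iter i transfer u x <= iter i transfer v x.
Proof. by move=> uv; elim: i => [|i IH]//=; exact: le_transfer. Qed.

Lemma iter_transfer_le i u : (forall x, u x <= 1) ->
  forall x, iter i transfer u x <= (alpha ^+ i)%:E.
Proof.
move=> u1; elim: i => [|i IH] x //=; rewrite exprS.
by apply: transfer_le => //; rewrite exprn_ge0.
Qed.

Lemma iter_transfer_sum i M (k : R) (u : nat -> X -> \bar R) : (0 <= k)%R ->
  (forall l x, 0 <= u l x) ->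
  iter i transfer (fun x => \sum_(l < M) k%:E * u l x) =
  fun x => \sum_(l < M) k%:E * iter i transfer (u l) x.
Proof.
move=> k0 u0; elim: i => [//|i IH] /=; rewrite IH.
by rewrite (transfer_sum _ (u := fun l => iter i transfer (u l)))// => l; exact: iter_transfer_ge0.
Qed.

Lemma cvg_iter_transfer i (u : (X -> \bar R)^nat) v :
  (forall n x, 0 <= u n x) -> (forall x, u n x @[n --> \oo] --> v x) ->
  forall x, iter i transfer (u n) x @[n --> \oo] --> iter i transfer v x.
Proof.
move=> u0 uv; elim: i => [//|i IH] /=; apply: cvg_transfer => //.
by move=> n; exact: iter_transfer_ge0.
Qed.

Lemma layer_fun_nd h x : nondecreasing_seq (fun n => layer_fun h n x).
Proof. by move=> m n mn; rewrite !layer_funE lee_fin; exact: layer_nd. Qed.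

Lemma layer_fun_cvg h x : 0 <= h x -> layer_fun h n x @[n --> \oo] --> h x.
Proof. by move=> h0; under eq_fun do rewrite layer_funE; exact: layer_cvg. Qed.

(** The hypothesis on indicators extends by linearity to the layered approximations of [u], and by
    monotone convergence to [u]. *)
Lemma integral_transfer u : measurable_fun setT u -> (forall x, 0 <= u x) ->
  \int[mu]_x transfer u x <= alpha%:E * \int[mu]_x u x.
Proof.
move=> mmu u0.
have indE n l : \int[mu]_x (\1_(levset u n l) x)%:E = mu (levset u n l).
  by rewrite integral_indic ?setIT//; exact: measurable_levset.
have mind n l : measurable_fun setT (fun x => (\1_(levset u n l) x)%:E : \bar R).
  by apply/measurable_EFinP; apply: measurable_indic; exact: measurable_levset.
have k0 n : (0 <= (2 : R) ^- n)%R by rewrite invr_ge0 exprn_ge0.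
have i0 n l x : 0 <= (\1_(levset u n l) x)%:E :> \bar R by rewrite lee_fin.
have simple n : \int[mu]_x transfer (layer_fun u n) x <= alpha%:E * \int[mu]_x u x.
  apply: (@le_trans _ _ (alpha%:E * \int[mu]_x layer_fun u n x)); last first.
    apply: lee_wpmul2l; first by rewrite lee_fin.
    apply: ge0_le_integral => //; [by move=> x _; exact: layer_fun_ge0|exact: measurable_layer_fun|].
    move=> x _; have := u0 x; rewrite layer_funE.
    by case: (u x) => [r| |]// r0; rewrite ?leey// lee_fin layer_le.
  rewrite (transfer_sum _ (u := fun l x => (\1_(levset u n l) x)%:E))//.
  have mk (g : X -> \bar R) : measurable_fun setT g ->
    measurable_fun setT (fun x => (2 ^- n)%:E * g x) by move=> ?; exact: measurable_funeM.
  rewrite ge0_integral_sum//; last 2 first.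
  - by move=> l; apply: mk; exact: measurable_transfer.
  - by move=> l x _; rewrite mule_ge0 ?lee_fin// transfer_ge0.
  rewrite /layer_fun ge0_integral_sum//; last by move=> l; exact: mk.
  rewrite ge0_sume_distrr; last first.
    by move=> l _; apply: integral_ge0 => x _; rewrite mule_ge0 ?lee_fin.
  apply: lee_sum => l _.
  rewrite ge0_integralZl; [|by []|exact: measurable_transfer
    |by move=> x _; exact: transfer_ge0|by rewrite lee_fin].
  rewrite ge0_integralZl; [|by []|by []|by []|by rewrite lee_fin].
  rewrite muleCA lee_wpmul2l ?lee_fin// indE.
  by apply: gam_int; exact: measurable_levset.
have cv x : transfer (layer_fun u n) x @[n --> \oo] --> transfer u x.
  by apply: cvg_transfer => [n y|y]; [exact: layer_fun_ge0|exact: layer_fun_cvg].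
have -> : \int[mu]_x transfer u x = \int[mu]_x limn (fun n => transfer (layer_fun u n) x).
  by apply: eq_integral => x _; apply/esym/cvg_lim.
have mlt n : measurable_fun setT (transfer (layer_fun u n)).
  by apply: measurable_transfer; exact: measurable_layer_fun.
have lt0 n x : 0 <= transfer (layer_fun u n) x.
  by apply: transfer_ge0; exact: layer_fun_ge0.
have nd x : nondecreasing_seq (fun n => transfer (layer_fun u n) x).
  by move=> m n mn; apply: le_transfer => y; exact: layer_fun_nd.
rewrite monotone_convergence//; apply: lime_le; last exact: nearW.
apply: ereal_nondecreasing_is_cvgn => m n mn.
by apply: ge0_le_integral => // x _; exact: nd.
Qed.

Lemma integral_iter_transfer i u : measurable_fun setT u -> (forall x, 0 <= u x) ->
  \int[mu]_x iter i transfer u x <= (alpha ^+ i)%:E * \int[mu]_x u x.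
Proof.
move=> mmu u0; elim: i => [|i IH] /=; first by rewrite mul1e.
rewrite (le_trans (integral_transfer _ _))//.
- exact: measurable_iter_transfer.
- exact: iter_transfer_ge0.
by rewrite exprS EFinM -muleA lee_wpmul2l// lee_fin.
Qed.

Definition transfer_partial j m u : X -> \bar R := fun x => \sum_(j <= i < m) iter i transfer u x.
Definition geo_sum j m : R := \sum_(j <= i < m) alpha ^+ i.

Lemma geo_sum_ge0 j m : (0 <= geo_sum j m)%R.
Proof. by apply: sumr_ge0 => i _; rewrite exprn_ge0. Qed.

Lemma transfer_partial_ge0 j m u : (forall x, 0 <= u x) -> forall x, 0 <= transfer_partial j m u x.
Proof. by move=> u0 x; apply: sume_ge0 => i _; exact: iter_transfer_ge0. Qed.

Lemma measurable_transfer_partial j m u : measurable_fun setT u -> measurable_fun setT (transfer_partial j m u).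
Proof. by move=> mmu; apply: emeasurable_sum => i; exact: measurable_iter_transfer. Qed.

Lemma transfer_partial_le j m u : (forall x, u x <= 1) -> forall x, transfer_partial j m u x <= (geo_sum j m)%:E.
Proof. by move=> u1 x; rewrite -sumEFin; apply: lee_sum => i _; exact: iter_transfer_le. Qed.

Lemma integral_transfer_partial j m u : measurable_fun setT u -> (forall x, 0 <= u x) ->
  \int[mu]_x transfer_partial j m u x <= (geo_sum j m)%:E * \int[mu]_x u x.
Proof.
move=> mmu u0; rewrite ge0_integral_sum//; first last.
- by move=> i x _; exact: iter_transfer_ge0.
- by move=> i; exact: measurable_iter_transfer.
rewrite -sumEFin ge0_sume_distrl; last by move=> i _; rewrite lee_fin exprn_ge0.
by apply: lee_sum => i _; exact: integral_iter_transfer.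
Qed.

Lemma transfer_partialZ j m M (k : R) (u : nat -> X -> \bar R) : (0 <= k)%R ->
  (forall l x, 0 <= u l x) ->
  transfer_partial j m (fun x => \sum_(l < M) k%:E * u l x) =
  fun x => \sum_(l < M) k%:E * transfer_partial j m (u l) x.
Proof.
move=> k0 u0; apply/funext => x; rewrite /transfer_partial.
under eq_bigr do rewrite iter_transfer_sum//.
rewrite exchange_big/=; apply: eq_bigr => l _.
by rewrite ge0_sume_distrr// => i _; exact: iter_transfer_ge0.
Qed.

Variables (phi : \bar R -> \bar R) (qphi : quasiconcave phi).
Local Notation lorentz := (lorentz mu phi).

Section fixed_function.
Variables (h H : X -> \bar R).
Hypotheses (mh : measurable_fun setT h) (mH : measurable_fun setT H).
Hypotheses (h0 : forall x, 0 <= h x) (H0 : forall x, 0 <= H x).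
Hypothesis hfin : lorentz h < +oo.

Let F s := phi (mu [set x | s%:E < h x]).
Let F0 s : 0 <= F s. Proof. exact: qc_mu_ge0. Qed.
Let Fni : {homo F : s t / (s <= t)%R >-> t <= s}.
Proof. by move=> s t st; apply: qc_homo => //; exact: distribution_homo. Qed.

(** A level set of infinite measure would put the infinite term [phi +oo] into a lower sum of a
    finite integral. *)
Let levset_fin n l : mu (levset h n l) \is a fin_num.
Proof.
rewrite ge0_fin_numE//.
have := lower_sum_le F0 Fni n l.+1 => /le_lt_trans /(_ hfin).
rewrite big_ord_recr/= ltNge => /negP h1.
rewrite ltey; apply/negP => /eqP muy; apply: h1.
have -> : F (level n l) = +oo by rewrite /F -/(levset h n l) muy qc_pinfty.
rewrite gt0_muley ?lte_fin ?invr_gt0 ?exprn_gt0// addey//.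
rewrite -ltNye (@lt_le_trans _ _ 0)//; apply: sume_ge0 => i _.
by rewrite mule_ge0// lee_fin invr_ge0 exprn_ge0.
Qed.

(** Induction on the number of layers, with everything added so far in the role of [H];
    subadditivity of the functional is never invoked. *)
Lemma lorentz_layers j m n M :
  lorentz (fun x => H x + \sum_(l < M) (2 ^- n)%:E * transfer_partial j m (fun x => (\1_(levset h n l) x)%:E) x)
  <= lorentz H + (2 * geo_sum j m)%:E * \sum_(l < M) (2 ^- n)%:E * F (level n l).
Proof.
have k0 : (0 <= (2 : R) ^- n)%R by rewrite invr_ge0 exprn_ge0.
have mind l : measurable_fun setT (fun x => (\1_(levset h n l) x)%:E : \bar R).
  by apply/measurable_EFinP; apply: measurable_indic; exact: measurable_levset.
have i0 l x : 0 <= (\1_(levset h n l) x)%:E :> \bar R by rewrite lee_fin.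
have i1 l x : (\1_(levset h n l) x)%:E <= 1 :> \bar R.
  by rewrite lee_fin indicE; case: (_ \in _).
pose w l x := (2 ^- n)%:E * transfer_partial j m (fun x => (\1_(levset h n l) x)%:E) x.
have w0 l x : 0 <= w l x by rewrite mule_ge0 ?lee_fin// transfer_partial_ge0.
have mw l : measurable_fun setT (w l).
  by apply: measurable_funeM; exact: measurable_transfer_partial.
elim: M => [|M IH].
  rewrite big_ord0 mule0 adde0; under eq_fun do rewrite big_ord0 adde0.
  exact: lexx.
under eq_fun do rewrite big_ord_recr/= addeA.
rewrite big_ord_recr/=.
(* A layer is [2 ^- n] times an indicator, so its partial sum of iterates is at most [e] pointwise
   and has integral at most [e * a], with [a] the measure of the level set. *)
set e := (geo_sum j m * 2 ^- n)%R; set a := fine (mu (levset h n M)).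
have e0 : (0 <= e)%R by rewrite mulr_ge0// geo_sum_ge0.
have we x : w M x <= e%:E.
  rewrite /w /e mulrC EFinM; apply: lee_wpmul2l; first by rewrite lee_fin.
  exact: transfer_partial_le.
have wa : \int[mu]_x w M x <= (e * a)%:E.
  rewrite ge0_integralZl; [|by []|exact: measurable_transfer_partial
    |by move=> x _; exact: transfer_partial_ge0|by rewrite lee_fin].
  rewrite /e mulrAC mulrC [in leRHS]EFinM; apply: lee_wpmul2l; first by rewrite lee_fin.
  rewrite (le_trans (integral_transfer_partial _ _ _ _))//.
  rewrite integral_indic// ?setIT; last exact: measurable_levset.
  by rewrite EFinM fineK.
set H' := fun x => H x + \sum_(l < M) w l x.
have mH' : measurable_fun setT H' by apply: emeasurable_funD => //; exact: emeasurable_sum.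
have H'0 x : 0 <= H' x by rewrite adde_ge0// sume_ge0.
have a0 : (0 <= a)%R by rewrite fine_ge0.
have S0 M' : 0 <= \sum_(l < M') (2 ^- n)%:E * F (level n l).
  by apply: sume_ge0 => l _; rewrite mule_ge0// lee_fin.
have c0 : 0 <= (2 * geo_sum j m)%:E by rewrite lee_fin mulr_ge0// geo_sum_ge0.
rewrite ge0_muleDr ?addeA; [|exact: S0|by rewrite mule_ge0// lee_fin].
apply: (@le_trans _ _ (lorentz H' + (2 * geo_sum j m)%:E * ((2 ^- n)%:E * F (level n M)))); last exact: leeD2r.
change (lorentz (fun x => H' x + w M x) <= lorentz H' + (2 * geo_sum j m)%:E * ((2 ^- n)%:E * F (level n M))).
move: a0; rewrite le_eqVlt => /predU1P[/esym a0|a0].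
  have -> : lorentz (fun x => H' x + w M x) = lorentz H'.
    by apply: (lorentzD_eq _ (a := a) (e := e)).
  by rewrite leeDl// mule_ge0// mule_ge0// lee_fin.
rewrite (le_trans (lorentzD_le qphi mH' (mw M) H'0 (w0 M) we e0 wa a0))//.
rewrite leeD2l// muleA -EFinM /e mulrA /F -/(levset h n M).
by rewrite /a fineK.
Qed.

(** The bound for finitely many layers is uniform in [n], because the lower sums stay below
    [lorentz h]; the layers increase to [h]. *)
Lemma lorentzD_transfer_partial j m :
  lorentz (fun x => H x + transfer_partial j m h x) <= lorentz H + (2 * geo_sum j m)%:E * lorentz h.
Proof.
have k0 n : (0 <= (2 : R) ^- n)%R by rewrite invr_ge0 exprn_ge0.
have c0 : 0 <= (2 * geo_sum j m)%:E by rewrite lee_fin mulr_ge0// geo_sum_ge0.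
have pl n : (transfer_partial j m (layer_fun h n) = fun x => \sum_(l < n * 2 ^ n)
    (2 ^- n)%:E * transfer_partial j m (fun x => (\1_(levset h n l) x)%:E) x).
  by rewrite (transfer_partialZ _ _ _ (u := fun l x => (\1_(levset h n l) x)%:E))// => l x; rewrite lee_fin.
apply: (lorentz_lim_le qphi (u := fun n x => H x + transfer_partial j m (layer_fun h n) x)).
- move=> n; apply: emeasurable_funD => //; apply: measurable_transfer_partial.
  exact: measurable_layer_fun.
- by move=> n x; apply: adde_ge0 => //; apply: transfer_partial_ge0; exact: layer_fun_ge0.
- move=> x p q pq; apply: leeD2l; apply: lee_sum => i _; apply: le_iter_transfer => y.
  exact: layer_fun_nd.
- move=> x; apply: cvgeD; [|exact: cvg_cst|].
    by rewrite ge0_adde_def// inE// transfer_partial_ge0.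
  apply: cvg_nnesum => i _; first by apply: nearW => n; apply: iter_transfer_ge0; exact: layer_fun_ge0.
  apply: cvg_iter_transfer => [n y|y]; first exact: layer_fun_ge0.
  exact: layer_fun_cvg.
- move=> n; rewrite pl (le_trans (lorentz_layers _ _ _ _))// leeD2l// lee_wpmul2l//.
  exact: lower_sum_le.
Qed.

Definition transfer_tail j u : X -> \bar R := fun x => \sum_(j <= i <oo) iter i transfer u x.

Hypothesis alpha1 : (alpha < 1)%R.

Lemma geo_sum_le j m : (geo_sum j m <= alpha ^+ j / (1 - alpha))%R.
Proof.
have a1 : (0 < 1 - alpha)%R by rewrite subr_gt0.
have [jm|mj] := leqP j m; last first.
  by rewrite /geo_sum big_geq 1?ltnW// divr_ge0 ?exprn_ge0// ltW.
rewrite ler_pdivlMr//.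
suff -> : (geo_sum j m * (1 - alpha) = alpha ^+ j - alpha ^+ m)%R by rewrite gerBl exprn_ge0.
rewrite /geo_sum mulr_suml (telescope_sumr_eq (fun i => - alpha ^+ i)%R)//; first by rewrite opprK addrC.
by move=> i _; rewrite mulrBr mulr1 -exprSr opprK addrC.
Qed.

Lemma lorentzD_transfer_tail j :
  lorentz (fun x => H x + transfer_tail j h x) <=
  lorentz H + (2 * (alpha ^+ j / (1 - alpha)))%:E * lorentz h.
Proof.
apply: (lorentz_lim_le qphi (u := fun m x => H x + transfer_partial j m h x)).
- by move=> n; apply: emeasurable_funD => //; exact: measurable_transfer_partial.
- by move=> n x; apply: adde_ge0 => //; exact: transfer_partial_ge0.
- move=> x p q pq; apply: leeD2l.
  by apply: lee_sum_nneg_natr => // i _ _; exact: iter_transfer_ge0.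
- move=> x; apply: cvgeD; [|exact: cvg_cst|].
    by rewrite ge0_adde_def// inE//; apply: nneseries_ge0 => i _ _; exact: iter_transfer_ge0.
  by apply: is_cvg_nneseries => i _ _; exact: iter_transfer_ge0.
- move=> n; rewrite (le_trans (lorentzD_transfer_partial _ _))// leeD2l// lee_wpmul2r ?lorentz_ge0//.
  by rewrite lee_fin ler_pM2l// geo_sum_le.
Qed.

End fixed_function.

Lemma lorentz0 : lorentz (cst 0) = 0.
Proof.
apply: integral0_eq => s /= s0.
rewrite (_ : [set x | _] = set0) ?measure0 ?qc0//.
by apply/seteqP; split => x //=; rewrite lte_fin ltNge s0.
Qed.

(** Every level set contains the set where [u] is infinite. If that set had positive measure, the
    integrand would exceed a positive constant on a half-line. *)
Lemma lorentz_pinfty u : measurable_fun setT u -> lorentz u < +oo ->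
  mu [set x | u x = +oo] = 0.
Proof.
move=> mmu ufin; set A := [set x | _].
have mA : measurable A.
  by rewrite -[A]setTI; exact: measurable_eqe.
apply/eqP/negPn/negP => muA0; move: ufin; apply/negP; rewrite -leNgt.
have phiA : 0 < phi (mu A).
  have : 0 < mu A by rewrite lt0e muA0 measure_ge0.
  case: (mu A) => [r| |]// r0; last by rewrite qc_pinfty.
  exact: qc_gt0.
apply: (@le_trans _ _ (\int[lebesgue_measure]_(s in Rpos) cst (phi (mu A)) s)).
  rewrite integral_cst//=; last exact: measurable_Rpos.
  by rewrite -set_itvcy lebesgue_measure_itv/= ?ltry addye// gt0_muley.
apply: ge0_le_integral => //.
- exact: measurable_Rpos.
- by move=> s _ /=; exact: ltW.
- by apply: measurable_distribution => //; [exact: measurable_Rpos|exact: qc_homo].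
- move=> s _; apply: qc_homo => //; apply: le_measure; rewrite ?inE//; first exact: measurable_gt.
  by move=> x /= ->; rewrite ltry.
Qed.

Lemma measurable_transfer_tail j u : measurable_fun setT u -> (forall x, 0 <= u x) ->
  measurable_fun setT (transfer_tail j u).
Proof.
move=> mmu u0; apply: (emeasurable_fun_cvg (fun m => transfer_partial j m u)).
  by move=> m; exact: measurable_transfer_partial.
by move=> x _; apply: is_cvg_nneseries => i _ _; exact: iter_transfer_ge0.
Qed.

Lemma lorentz_transfer_tail_le j h : (alpha < 1 / 2)%R -> measurable_fun setT h ->
  (forall x, 0 <= h x) -> lorentz h < +oo ->
  lorentz (transfer_tail j h) <= ((2 * alpha) ^+ j / (1 - 2 * alpha))%:E * lorentz h.
Proof.
move=> ahalf mh h0 hfin; have a1 : (alpha < 1)%R by lra.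
have b1 : (0 < 1 - alpha)%R by lra.
have b2 : (0 < 1 - 2 * alpha)%R by lra.
have hL : 0 <= lorentz h by exact: lorentz_ge0.
case: j => [|j].
  (* Treating [h] as one more perturbation would give [2 / (1 - alpha)], which is too large for
     [alpha < 1 / 3]. With [h] as the unperturbed function the constant is
     [1 + 2 * alpha / (1 - alpha)]. *)
  have -> : transfer_tail 0 h = fun x => h x + transfer_tail 1 h x.
    apply/funext => x; rewrite /transfer_tail (nneseries_split _ 1); last first.
      by move=> i _; exact: iter_transfer_ge0.
    by rewrite big_nat1.
  rewrite (le_trans (lorentzD_transfer_tail mh mh h0 h0 hfin a1 1))//.
  rewrite -{1}[lorentz h]mul1e -ge0_muleDl ?lee_fin//; last first.
    by rewrite mulr_ge0// divr_ge0 ?exprn_ge0// ltW.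
  apply: lee_wpmul2r => //; rewrite lee_fin expr0 expr1 -subr_ge0.
  have -> : (1 / (1 - 2 * alpha) - (1 + 2 * (alpha / (1 - alpha))) =
    (2 * alpha ^+ 2) / ((1 - 2 * alpha) * (1 - alpha)))%R.
    by field; rewrite !gt_eqF.
  by rewrite divr_ge0 ?mulr_ge0 ?sqr_ge0// ltW.
(* From the first power on, [2 ^+ j.+1] absorbs the factor 2. *)
have -> : transfer_tail j.+1 h = fun x => cst 0 x + transfer_tail j.+1 h x.
  by apply/funext => x; rewrite add0e.
rewrite (le_trans (lorentzD_transfer_tail mh (measurable_cst 0) h0 (fun=> lexx _) hfin a1 j.+1))//.
rewrite lorentz0 add0e; apply: lee_wpmul2r => //; rewrite lee_fin mulrA exprMn.
have aj : (0 <= alpha ^+ j.+1)%R by rewrite exprn_ge0.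
have two : (2 <= 2 ^+ j.+1 :> R)%R by rewrite exprS ler_peMr// exprn_ege1// ler1n.
apply: ler_pM; rewrite ?invr_ge0 ?mulr_ge0//; first exact: ltW.
  by rewrite ler_wpM2r.
by rewrite lef_pV2 ?posrE// lerD2l lerN2 ler_peMl// ler1n.
Qed.

End transfer.

(** * Lebesgue outer measure *)

Section lebesgue_outer.
Context {R : realType} {k : nat}.
Local Notation Rk := 'rV[R]_k.+1.
Local Open Scope ereal_scope.
Implicit Types (a b x : Rk) (A B : set Rk).

(** In dimension 0 every box has volume 1, the empty product; the successor gives degenerate boxes
    volume 0. The name also carries the outer measure structure. *)
Definition leb : set Rk -> \bar R := @lebo R k.+1.

Lemma box_vol_ge0 a b : (0 <= box_vol a b)%R.
Proof. by apply: prodr_ge0 => i _; rewrite le_max lexx orbT. Qed.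

Lemma box_vol_eq0 a : box_vol a a = 0%R.
Proof. by rewrite /box_vol big_ord_recl subrr maxxx mul0r. Qed.

Lemma leb_cover_le A (a b : nat -> Rk) : A `<=` \bigcup_n box (a n) (b n) ->
  leb A <= \sum_(n <oo) (box_vol (a n) (b n))%:E.
Proof. by move=> Aab; apply: ereal_inf_lbound; exists a, b. Qed.

Lemma leb_ge0 A : 0 <= leb A.
Proof.
apply: le_ereal_inf_tmp => _ [a [b [_ ->]]]; apply: nneseries_ge0 => n _ _.
by rewrite lee_fin box_vol_ge0.
Qed.

Lemma leb0 : leb set0 = 0.
Proof.
apply/eqP; rewrite eq_le leb_ge0 andbT.
have /leb_cover_le/le_trans : set0 `<=` \bigcup_(n : nat) box (0%R : Rk) 0%R by [].
by apply; rewrite eseries0// => n _ _; rewrite box_vol_eq0.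
Qed.

Lemma le_leb : {homo leb : A B / A `<=` B >-> A <= B}.
Proof.
move=> A B AB; apply/ereal_inf_le_tmp => _ [a [b [Bab ->]]].
by exists a, b; split => //; exact: subset_trans Bab.
Qed.

Lemma leb_cover A (e : R) : leb A < +oo -> (0 < e)%R ->
  exists ab : nat -> Rk * Rk, A `<=` \bigcup_n box (ab n).1 (ab n).2 /\
    \sum_(n <oo) (box_vol (ab n).1 (ab n).2)%:E <= leb A + e%:E.
Proof.
move=> Afin e0; have fA : leb A \is a fin_num by rewrite ge0_fin_numE// leb_ge0.
have [_ [a [b [Aab ->]]] /ltW le] := lb_ereal_inf_adherent e0 fA.
by exists (fun n => (a n, b n)); split.
Qed.

Lemma leb_sigma_subadditive : sigma_subadditive leb.
Proof.
move=> A; have [[i ioo]|] := pselect (exists i, leb (A i) = +oo).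
  by rewrite (eseries_pinfty _ _ ioo) ?leey// => n _; rewrite -ltNye (lt_le_trans _ (leb_ge0 _)).
rewrite -forallNE => Afin; apply/lee_addgt0Pr => e e0.
rewrite (le_trans _ (epsilon_trick _ _ (ltW e0)))//; last by move=> n; exact: leb_ge0.
have [G PG] : {G : nat -> nat -> Rk * Rk & forall n,
    A n `<=` \bigcup_m box (G n m).1 (G n m).2 /\
    \sum_(m <oo) (box_vol (G n m).1 (G n m).2)%:E <= leb (A n) + (e / (2 ^ n.+1)%:R)%:E}.
  apply: (@choice _ _ (fun n (ab : nat -> Rk * Rk) => A n `<=` \bigcup_m box (ab m).1 (ab m).2 /\
    \sum_(m <oo) (box_vol (ab m).1 (ab m).2)%:E <= leb (A n) + (e / (2 ^ n.+1)%:R)%:E)) => n.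
  apply: leb_cover; first by rewrite ltey; exact/eqP.
  by rewrite divr_gt0// ltr0n expn_gt0.
pose v p := (box_vol (G p.1 p.2).1 (G p.1 p.2).2)%:E.
have v0 p : 0 <= v p by rewrite lee_fin box_vol_ge0.
have /card_esym/card_set_bijP[f fbij] := card_nat2.
apply: (@le_trans _ _ (\sum_(i <oo) v (f i))).
  apply: (@leb_cover_le _ (fun i => (G (f i).1 (f i).2).1) (fun i => (G (f i).1 (f i).2).2)).
  move=> x [n _ /(PG n).1[m _ xnm]].
  have [_ _ /(_ (n, m) Logic.I)[i _ fi]] := fbij.
  by exists i => //; rewrite fi.
rewrite nneseries_esumT// -(reindex_esum setT setT f v)//.
have -> : [set: nat * nat] = [set: nat] `*`` (fun=> [set: nat]) by apply/seteqP; split.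
rewrite -(@esum_esum _ _ _ _ _ (fun n m => v (n, m)))// -nneseries_esumT; last first.
  by move=> n; apply: esum_ge0.
apply: lee_nneseries => n _; first by move=> _; exact: esum_ge0.
by rewrite -nneseries_esumT//; exact: (PG n).2.
Qed.

HB.instance Definition _ := isOuterMeasure.Build R Rk leb
  leb0 leb_ge0 le_leb leb_sigma_subadditive.

Lemma leb_box a b : leb (box a b) <= (box_vol a b)%:E.
Proof.
apply: (@le_trans _ _ (\sum_(n <oo)
  (box_vol (if n is 0%N then a else 0%R) (if n is 0%N then b else 0%R))%:E)).
  by apply: leb_cover_le => x abx; exists 0%N.
rewrite (nneseries_split _ 1); last by move=> n _; rewrite lee_fin box_vol_ge0.
rewrite big_nat1 eseries0 ?adde0//.
by move=> n n1 _; case: n n1 => // n _; rewrite box_vol_eq0.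
Qed.

(** A bound on the images of boxes passes to [A] through a nearly optimal cover by boxes and
    countable subadditivity. *)
Lemma leb_image_le A (F : Rk -> Rk) (c : R) : (0 < c)%R ->
  (forall a b, leb (F @` (A `&` box a b)) <= (c * box_vol a b)%:E) ->
  leb (F @` A) <= c%:E * leb A.
Proof.
move=> c0 Fbox.
have [Ay|] := eqVneq (leb A) +oo; first by rewrite Ay gt0_muley ?leey// lte_fin.
rewrite -ltey => Afin; apply/lee_addgt0Pr => e e0.
have [ab [Aab sumab]] := leb_cover Afin (divr_gt0 e0 c0).
have -> : c%:E * leb A + e%:E = c%:E * (leb A + (e / c)%:E).
  by rewrite ge0_muleDr ?leb_ge0 ?lee_fin ?divr_ge0 ?(ltW e0) ?(ltW c0)// -EFinM mulrCA mulfV ?mulr1// gt_eqF.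
apply: le_trans (lee_wpmul2l _ sumab); last by rewrite lee_fin ltW.
rewrite -nneseriesZl//; last by move=> n _; rewrite lee_fin box_vol_ge0.
apply: (@le_trans _ _ (leb (\bigcup_n (F @` (A `&` box (ab n).1 (ab n).2))))).
  by apply: le_leb => _ [x Ax <-]; have [n _ xn] := Aab _ Ax; exists n => //; exists x.
apply: le_trans (leb_sigma_subadditive _) _.
by apply: lee_nneseries => n _; [move=> _; exact: leb_ge0|rewrite -EFinM].
Qed.

(** Together with [clip_lo], the two parts of a box cut by a coordinate hyperplane. Because
    [box_vol] truncates negative sides at 0, the volumes add up even if the hyperplane misses the
    box. *)
Definition clip_hi (i : 'I_k.+1) (c : R) b : Rk :=
  \row_j (if j == i then Num.min (b 0 j) c else b 0 j)%R.
Definition clip_lo (i : 'I_k.+1) (c : R) a : Rk :=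
  \row_j (if j == i then Num.max (a 0 j) c else a 0 j)%R.

Lemma box_vol_clip i c a b :
  (box_vol a (clip_hi i c b) + box_vol (clip_lo i c a) b)%R = box_vol a b.
Proof.
rewrite /box_vol (bigD1 i)//= [X in (_ + X)%R](bigD1 i)//= [in RHS](bigD1 i)//=.
rewrite !mxE eqxx.
under eq_bigr => j /negPf ji do rewrite mxE ji.
under [X in (_ + _ * X)%R]eq_bigr => j /negPf ji do rewrite mxE ji.
rewrite -mulrDl; congr (_ * _)%R.
move: (a 0%R i) (b 0%R i) => s t.
by case: (leP t c) => ?; case: (leP s c) => ?; case: (leP (t - s)%R 0%R) => ?;
  case: (leP (t - c)%R 0%R) => ?; case: (leP (c - s)%R 0%R) => ?; lra.
Qed.

Local Notation X := (caratheodory_type leb).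

(** Cutting every box of a cover of [E] along the hyperplane gives covers of both parts of [E] with
    the same total volume. *)
Lemma measurable_halfspace i (c : R) : measurable ([set x : Rk | (x 0 i <= c)%R] : set X).
Proof.
apply: le_caratheodory_measurable => E.
apply: le_ereal_inf_tmp => _ [a [b [Eab ->]]].
have -> : \sum_(n <oo) (box_vol (a n) (b n))%:E =
  \sum_(n <oo) (box_vol (a n) (clip_hi i c (b n)))%:E +
  \sum_(n <oo) (box_vol (clip_lo i c (a n)) (b n))%:E.
  rewrite -nneseriesD; [|by move=> *; rewrite lee_fin box_vol_ge0..].
  by apply: eq_eseriesr => n _; rewrite -EFinD box_vol_clip.
apply: leeD; apply: leb_cover_le => x [/Eab[n _ abx]] /=.
  move=> xc; exists n => // j; rewrite mxE; have /andP[-> xb] := abx j => /=.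
  by case: eqVneq => [->|//]; rewrite le_min xc andbT; have /andP[] := abx i.
move=> /negP; rewrite -ltNge => cx; exists n => // j; rewrite mxE; have /andP[ax ->] := abx j.
by rewrite andbT; case: eqVneq => [->|//]; rewrite ge_max (ltW cx) andbT; have /andP[] := abx i.
Qed.

Lemma measurable_coord i : measurable_fun setT (fun x : X => (x : Rk) 0%R i).
Proof.
move=> _; apply: (measurability _ (RGenOInfty.measurableE R)) => //.
move=> _ [_ [r ->] <-]; rewrite setTI.
rewrite (_ : _ @^-1` _ = ~` [set x : Rk | (x 0 i <= r)%R]).
  by apply: measurableC; exact: measurable_halfspace.
by apply/seteqP; split => x /=; rewrite in_itv/= andbT ltNge => /negP.
Qed.

Lemma rV_norm_le x (r : R) : (0 <= r)%R ->
  ((`|x| <= r)%R <-> forall i, (`|x 0 i| <= r)%R).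
Proof.
move=> r0; rewrite /Num.norm/= mx_normrE; split.
  move=> /bigmax_leP[_ h] i; exact: (h (0%R, i) isT).
by move=> h; apply/bigmax_leP; split => // -[i j] _ /=; rewrite (ord1 i); exact: h.
Qed.

Lemma rV_norm_coord x i : (`|x 0 i| <= `|x|)%R.
Proof. by have /(rV_norm_le x) := normr_ge0 x; move=> [/(_ (lexx _)) + _]; exact. Qed.

Lemma measurable_rV_ball x (r : R) : measurable ([set y : Rk | forall i, (`|y 0 i - x 0 i| < r)%R] : set X).
Proof.
rewrite (_ : [set y | _] = \bigcap_(i in [set: 'I_k.+1]) [set y : Rk | (`|y 0 i - x 0 i| < r)%R]); last first.
  by apply/seteqP; split => y h i //; [move=> _; exact: h|exact: (h i Logic.I)].
apply: fin_bigcap_measurable => // i _.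
rewrite (_ : [set y | _] = (fun y : X => (y : Rk) 0%R i) @^-1` (ball (x 0%R i) r)).
  by rewrite -[X in measurable X]setTI; apply: measurable_coord => //; exact: measurable_ball.
by apply/seteqP; split => y /=; rewrite /ball/= distrC.
Qed.

(** Countably many cubes with rational centre and radius [1 / (n + 1)] lie in [U] and exhaust it. *)
Lemma measurable_open_rV (U : set Rk) : open U -> measurable (U : set X).
Proof.
move=> oU.
pose B (p : 'rV[rat]_k.+1 * nat) := [set y : Rk | forall i, (`|y 0 i - ratr (p.1 0 i)| < p.2.+1%:R^-1)%R].
rewrite (_ : U = \bigcup_p (if `[< B p `<=` U >] then B p else set0)).
  apply: countable_bigcupT_measurable; first exact: countableP.
  move=> p; case: asboolP => // _.
  have := measurable_rV_ball (map_mx ratr p.1) (p.2.+1%:R^-1).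
  by congr measurable; apply/seteqP; split => y h i; have := h i; rewrite mxE.
apply/seteqP; split => [x Ux|x [p _]]; last by case: asboolP => // pU /pU.
have /nbhs_ballP[e /= e0 eU] := open_nbhs_nbhs (conj oU Ux).
have [n ne] : exists n : nat, (2 * n.+1%:R^-1 < e)%R.
  have /ltr_add_invr[n] : (0 < e / 2)%R by rewrite divr_gt0.
  by rewrite add0r ltr_pdivlMr// mulrC => ?; exists n.
have n0 : (0 < n.+1%:R^-1 :> R)%R by rewrite invr_gt0.
have /choice[q qP] (i : 'I_k.+1) : exists q : rat, (`|x 0 i - ratr q| < n.+1%:R^-1)%R.
  have /rat_in_itvoo[q] : (x 0 i - n.+1%:R^-1 < x 0 i + n.+1%:R^-1)%R.
    by rewrite ltrBlDr -addrA ltrDl addr_gt0.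
  rewrite in_itv/= => /andP[q1 q2]; exists q.
  by rewrite distrC ltr_distl q1.
exists ((\row_i q i), n) => //; case: asboolP => [_ i /=|]; first by rewrite mxE.
case; move=> y /= yB; apply: eU; split => // i j; rewrite (ord1 i) /ball/=.
rewrite -(subrK (ratr (q j)) (x 0%R j)) -addrA (le_lt_trans (ler_normD _ _))//.
rewrite (lt_trans _ ne)// mulr_natl mulr2n ltrD// distrC.
by have := yB j; rewrite mxE.
Qed.

End lebesgue_outer.

(** * Coordinate widths and Lipschitz images *)

Section widths.
Context {R : realType} {k : nat}.
Local Notation Rk := 'rV[R]_k.+1.
Implicit Types (a b x y : Rk) (A B : set Rk).

(** Subdivision into [n + 1] parts leaves an error of order [1 / (n + 1)] in each factor of a
    volume; here these errors vanish in the limit. *)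
Lemma le_prod_limit (x : \bar R) (l M : 'I_k.+1 -> R) :
  (forall n : nat, (x <= (\prod_i (l i + M i / n.+1%:R))%:E)%E) ->
  (x <= (\prod_i l i)%:E)%E.
Proof.
move=> xn.
have cv (s : seq 'I_k.+1) : \prod_(i <- s) (l i + M i / n.+1%:R) @[n --> \oo] --> \prod_(i <- s) l i.
  elim: s => [|i s IH].
    by under eq_fun do rewrite big_nil; rewrite big_nil; exact: cvg_cst.
  under eq_fun do rewrite big_cons; rewrite big_cons.
  apply: cvgM => //; rewrite -[X in _ --> X]addr0; apply: cvgD; first exact: cvg_cst.
  rewrite -(mulr0 (M i)); apply: cvgM; [exact: cvg_cst|exact: cvg_harmonic].
have {}cv : (\prod_i (l i + M i / n.+1%:R))%:E @[n --> \oo] --> (\prod_i l i)%:E.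
  by apply: cvg_EFin; [exact: nearW|exact: cv].
rewrite -(cvg_lim _ cv)//; apply: lime_ge; last exact: nearW.
by apply/cvg_ex; eexists; exact: cv.
Qed.

(** The box with sides [d] whose lower corner consists of the coordinatewise infima contains [B]. *)
Lemma leb_width B (d : 'I_k.+1 -> R) : (forall i, 0 <= d i) ->
  (forall x y, B x -> B y -> forall i, x 0 i - y 0 i <= d i) ->
  (leb B <= (\prod_i d i)%:E)%E.
Proof.
move=> d0 Bd; have [->|/set0P[z Bz]] := eqVneq B set0.
  by rewrite leb0 lee_fin prodr_ge0.
pose a : Rk := \row_i inf [set x 0 i | x in B].
have inf_has i : has_inf [set x 0 i | x in B].
  split; first by exists (z 0 i), z.
  by exists (z 0 i - d i) => _ [x Bx <-]; rewrite lerBlDr addrC -lerBlDr; exact: Bd.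
apply: (@le_trans _ _ (leb (box a (a + \row_i d i)))).
  apply: le_leb => x Bx i; rewrite !mxE; apply/andP; split.
    by apply: ge_inf; [exact: (inf_has i).2|exists x].
  rewrite -lerBlDr; apply: lb_le_inf; first exact: (inf_has i).1.
  by move=> _ [y By <-]; rewrite lerBlDr addrC -lerBlDr; exact: Bd.
rewrite (le_trans (leb_box _ _))// lee_fin /box_vol.
by apply: ler_prod => i _; rewrite le_max lexx orbT !mxE addrAC subrr add0r ge_max lexx d0.
Qed.

Lemma leb_bigsetU (I : finType) (P : pred I) (B : I -> set Rk) :
  (leb (\big[setU/set0]_(i | P i) B i) <= \sum_(i | P i) leb (B i))%E.
Proof.
elim/big_rec2: _ => [|i y1 y2 _ IH]; first by rewrite leb0.
by rewrite (le_trans (outer_measureU2 _ _ _))// leeD2l.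
Qed.

(** A box is cut into cubes of side [s]. In the maximum norm the image of a cube has widths at most
    [l * s], and at most [(b_i - a_i) / s + 1] cubes lie along axis [i], so the total is at most the
    product of [l * (b_i - a_i + s)]. *)
Lemma leb_lipschitz A (F : Rk -> Rk) (l : R) : 0 < l ->
  (forall x y, A x -> A y -> `|F x - F y| <= l * `|x - y|) ->
  (leb (F @` A) <= (l ^+ k.+1)%:E * leb A)%E.
Proof.
move=> l0 Fl; apply: leb_image_le; first by rewrite exprn_gt0.
move=> a b.
have [->|/set0P[z [_ abz]]] := eqVneq (A `&` box a b) set0.
  by rewrite image_set0 leb0 lee_fin mulr_ge0 ?box_vol_ge0// exprn_ge0// ltW.
have ab i : a 0 i <= b 0 i by have /andP[] := abz i; exact: le_trans.
have -> : l ^+ k.+1 * box_vol a b = \prod_i (l * (b 0 i - a 0 i)).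
  rewrite big_split/= prodr_const card_ord; congr (_ * _); apply: eq_bigr => i _.
  by rewrite max_l// subr_ge0.
apply: (@le_prod_limit _ _ (fun=> l)) => n.
set s := n.+1%:R^-1; have s0 : 0 < s :> R by rewrite invr_gt0.
(* [N i] counts the cells along axis [i], with a last partial one. The common bound [M] makes the
   cell indices a finite type, and [P] selects the genuine ones. *)
pose N (i : 'I_k.+1) := (Num.trunc ((b 0 i - a 0 i) / s)).+1.
pose M := \max_i N i.
have NM i : (N i <= M)%N by exact: leq_bigmax.
pose cell (g : {ffun 'I_k.+1 -> 'I_M}) := [set x : Rk | forall i,
  a 0 i + s * (g i)%:R <= x 0 i <= a 0 i + s * (g i).+1%:R].
pose P (g : {ffun 'I_k.+1 -> 'I_M}) := [forall i, (g i < N i)%N].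
apply: (@le_trans _ _ (leb (\big[setU/set0]_(g | P g) (F @` (A `&` cell g))))).
  apply: le_leb => _ [x [Ax abx] <-].
  pose t i := Num.trunc ((x 0 i - a 0 i) / s).
  have tN i : (t i < N i)%N.
    rewrite ltnS le_truncn// ler_pM2r ?invr_gt0// lerB//.
    by have /andP[] := abx i.
  have tM i : (t i < M)%N by exact: leq_trans (tN i) (NM i).
  pose g := [ffun i => Ordinal (tM i)].
  have : (F @` (A `&` cell g)) (F x).
    exists x => //; split => // i; rewrite ffunE/=.
    have /andP[ax _] := abx i.
    have /truncn_itv/andP[t1 t2] : 0 <= (x 0 i - a 0 i) / s by rewrite divr_ge0 ?subr_ge0// ltW.
    apply/andP; split; first by rewrite -lerBrDl mulrC -ler_pdivlMr.
    by rewrite -lerBlDl mulrC -ler_pdivrMr// ltW.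
  have Pg : P g by apply/forallP => i; rewrite ffunE; exact: tN.
  by move=> Fgx; rewrite (bigD1 g)//; left.
rewrite (le_trans (leb_bigsetU _ _))//.
apply: (@le_trans _ _ (\sum_(g | P g) (\prod_(i : 'I_k.+1) (l * s))%:E)%E).
  apply: lee_sum => g _; apply: leb_width => [i|_ _ [x [Ax xg] <-] [y [Ay yg] <-] i].
    by rewrite mulr_ge0// ltW.
  rewrite (le_trans (ler_norm _))//.
  have -> : F x 0 i - F y 0 i = (F x - F y) 0 i by rewrite !mxE.
  rewrite (le_trans (rV_norm_coord _ _))// (le_trans (Fl _ _ Ax Ay))//.
  rewrite ler_pM2l//; apply/rV_norm_le => [|j]; first exact: ltW.
  rewrite !mxE; have /andP[x1 x2] := xg j; have /andP[y1 y2] := yg j.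
  rewrite -natr1 mulrDr mulr1 in x2 y2.
  by rewrite ler_norml; apply/andP; split; lra.
rewrite sumEFin lee_fin.
have -> : \sum_(g | P g) \prod_(i : 'I_k.+1) (l * s) = \prod_(i : 'I_k.+1) \sum_(j < M | (j < N i)%N) (l * s).
  rewrite (@bigA_distr_big_dep _ _ _ _ _ _ _
    (fun (i : 'I_k.+1) (j : 'I_M) => (j < N i)%N) (fun _ _ => l * s)).
  by apply: eq_bigl => g; apply/forallP/familyP.
apply: ler_prod => i _; rewrite sumr_ge0/=; last by move=> j _; rewrite mulr_ge0// ltW.
rewrite (big_ord_narrow (NM i)) sumr_const card_ord -mulr_natr -mulrA -mulrDr ler_pM2l//.
rewrite /N -natr1 mulrDr mulr1 lerD2r mulrC -ler_pdivlMr//.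
by rewrite truncn_le// divr_ge0 ?subr_ge0// ltW.
Qed.

End widths.

(** * Linear images and the determinant *)

Section linear.
Context {R : realType} {k : nat}.
Local Notation Rk := 'rV[R]_k.+1.
Local Notation Mk := 'M[R]_k.+1.
Implicit Types (a b x y r : Rk) (A B : set Rk) (S T : Mk).

(** Elementary factor for the elimination below: it replaces the [j]-th unit vector by [r] and fixes
    the others. *)
Definition row_replace (j : 'I_k.+1) r : Mk :=
  \matrix_(i, l) if i == j then r 0 l else (i == l)%:R.

Lemma mul_row_replace j r x l :
  (x *m row_replace j r) 0 l = (if l == j then 0 else x 0 l) + x 0 j * r 0 l.
Proof.
rewrite mxE (bigD1 j)//= mxE eqxx addrC; congr (_ + _).
rewrite (eq_bigr (fun i => x 0 i * (i == l)%:R)); last first.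
  by move=> i /negPf ij; rewrite mxE ij.
case: eqVneq => [->|lj].
  by rewrite big1// => i /negPf ij; rewrite ij mulr0.
rewrite (bigD1 l)//= eqxx mulr1 big1 ?addr0// => i /andP[_ /negPf il].
by rewrite il mulr0.
Qed.

Lemma det_row_replace j r : \det (row_replace j r) = r 0 j.
Proof.
rewrite (expand_det_col _ j) (bigD1 j)//= big1 ?addr0; last first.
  by move=> i /negPf ij; rewrite mxE ij mul0r.
rewrite mxE eqxx /cofactor addnn -signr_odd odd_double expr0 mul1r.
rewrite (_ : row' j _ = 1%:M) ?det1 ?mulr1//.
apply/matrixP => p q; rewrite !mxE eq_sym (negPf (neq_lift _ _)).
by rewrite (inj_eq lift_inj).
Qed.

(** Half of the linear change of variables. It is stable under products, and for invertible matrices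
    the other half follows by applying it to the inverse. *)
Definition contracts S := forall A, (leb ((fun x => x *m S) @` A) <= `|\det S|%:E * leb A)%E.

Lemma contractsM S T : contracts S -> contracts T -> contracts (S *m T).
Proof.
move=> cS cT A; rewrite (_ : _ @` A = (fun x => x *m T) @` ((fun x => x *m S) @` A)).
  rewrite (le_trans (cT _))// det_mulmx normrM mulrC EFinM -muleA lee_wpmul2l//.
apply/seteqP; split => [_ [x Ax <-]|_ [_ [x Ax <-] <-]].
  by exists (x *m S); [exists x|rewrite mulmxA].
by exists x => //; rewrite mulmxA.
Qed.

Lemma contracts1 : contracts 1%:M.
Proof.
move=> A; rewrite det1 normr1 mul1e; apply: le_leb => _ [x Ax <-].
by rewrite mulmx1.
Qed.

Lemma contracts_tperm (i j : 'I_k.+1) : contracts (tperm_mx i j).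
Proof.
move=> A; rewrite det_perm normr_sign.
apply: leb_image_le => // a b; rewrite mul1r.
rewrite (_ : box_vol a b = box_vol (a *m tperm_mx i j) (b *m tperm_mx i j)).
  apply: le_trans (leb_box _ _); apply: le_leb => _ [x [_ abx] <-] l.
  by rewrite -!xcolE !mxE; exact: abx.
rewrite /box_vol (reindex_inj (@perm_inj _ (tperm i j)))/=.
by apply: eq_bigr => l _; rewrite -!xcolE !mxE.
Qed.

(** A box is cut into [n + 1] slabs orthogonal to axis [j]. Within a slab [x_j] is nearly constant,
    so the image has width [|r_j| w_j / (n + 1)] along [j] and nearly [w_i] along the other axes;
    summing over the slabs restores [|r_j| w_j]. *)
Lemma contracts_row_replace j r : r 0 j != 0 -> contracts (row_replace j r).
Proof.
move=> rj A; rewrite det_row_replace; apply: leb_image_le; first by rewrite normr_gt0.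
move=> a b.
have [->|/set0P[z [_ abz]]] := eqVneq (A `&` box a b) set0.
  by rewrite image_set0 leb0 lee_fin mulr_ge0 ?box_vol_ge0.
have ab i : a 0 i <= b 0 i by have /andP[] := abz i; exact: le_trans.
pose w i := b 0 i - a 0 i.
have w0 i : 0 <= w i by rewrite subr_ge0.
have -> : `|r 0 j| * box_vol a b = \prod_i (if i == j then `|r 0 j| * w j else w i).
  rewrite /box_vol (eq_bigr w); last by move=> i _; exact: (max_l (w0 i)).
  rewrite (bigD1 j)//= [RHS](bigD1 j)//= eqxx mulrA; congr (_ * _).
  by apply: eq_bigr => i /negPf ->.
apply: (@le_prod_limit _ _ _ _ (fun i => if i == j then 0 else `|r 0 i| * w j)) => n.
set s := n.+1%:R^-1; have s0 : 0 < s :> R by rewrite invr_gt0.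
pose slab (p : 'I_n.+1) := [set x : Rk | a 0 j + p%:R * (w j * s) <= x 0 j <= a 0 j + p.+1%:R * (w j * s)].
set F := fun x => x *m row_replace j r.
apply: (@le_trans _ _ (leb (\big[setU/set0]_(p : 'I_n.+1) (F @` (A `&` box a b `&` slab p))))).
  apply: le_leb => _ [x [Ax abx] <-].
  have [p xp] : exists p, slab p x.
    have /andP[ax xb] := abx j.
    have [wj|wj] := eqVneq (w j) 0.
      exists ord0; rewrite /slab/= wj !mul0r !mulr0 addr0 ax/=.
      by move: wj; rewrite /w => /subr0_eq <-.
    have wj0 : 0 < w j by rewrite lt0r wj w0.
    have ws : 0 < w j * s by rewrite mulr_gt0.
    pose t := (x 0 j - a 0 j) / (w j * s).
    have t0 : 0 <= t by rewrite divr_ge0 ?subr_ge0// ltW.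
    have tn : t <= n.+1%:R.
      rewrite ler_pdivrMr// mulrCA mulfV// mulr1 lerB//.
    have /andP[t1 t2] := truncn_itv t0.
    have tE : x 0 j = a 0 j + t * (w j * s).
      by rewrite /t divfK ?gt_eqF// addrC subrK.
    have [tn'|tn'] := ltnP (Num.trunc t) n.+1.
      exists (Ordinal tn'); rewrite /slab/= tE !lerD2l !ler_pM2r// t1 ltW//.
    (* Only the upper face [t = n + 1] escapes the indices; it belongs to the last slab. *)
    exists ord_max; rewrite /slab/= tE !lerD2l !ler_pM2r// tn andbT.
    by rewrite (le_trans _ t1)// ler_nat ltnW.
  by rewrite (bigD1 p)//; left; exists x.
rewrite (le_trans (leb_bigsetU _ _))//.
set d := fun i : 'I_k.+1 => if i == j then `|r 0 j| * (w j * s) else w i + `|r 0 i| * (w j * s).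
apply: (@le_trans _ _ (\sum_(p : 'I_n.+1) (\prod_i d i)%:E)%E).
  apply: lee_sum => p _; apply: leb_width => [i|_ _ [x [[Ax xab] xp] <-] [y [[Ay yab] yp] <-] i].
    have ws0 : 0 <= w j * s by rewrite mulr_ge0// ltW.
    by rewrite /d; case: ifP => _; [|apply: addr_ge0 => //]; exact: mulr_ge0.
  rewrite /F !mul_row_replace /d.
  have xyj : `|x 0 j - y 0 j| <= w j * s.
    have pS : p.+1%:R * (w j * s) = p%:R * (w j * s) + w j * s.
      by rewrite -natr1 mulrDl mul1r.
    move: xp yp; rewrite /slab/= pS => /andP[x1 x2] /andP[y1 y2].
    by rewrite ler_norml; apply/andP; split; lra.
  have rxy : x 0 j * r 0 i - y 0 j * r 0 i <= `|r 0 i| * (w j * s).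
    by rewrite -mulrBl (le_trans (ler_norm _))// normrM mulrC ler_wpM2l.
  case: eqVneq => [ij|ij]; first by rewrite !add0r (le_trans rxy)// ij.
  rewrite opprD addrACA lerD// /w.
  by have /andP[? ?] := xab i; have /andP[? ?] := yab i; lra.
rewrite sumEFin lee_fin sumr_const card_ord -mulr_natr.
rewrite (bigD1 j)//= [leRHS](bigD1 j)//= /d !eqxx mul0r addr0 mulrAC.
rewrite (_ : `|r 0 j| * (w j * s) * n.+1%:R = `|r 0 j| * w j); last first.
  by rewrite -!mulrA mulVf ?mulr1// pnatr_eq0.
rewrite le_eqVlt; apply/orP; left; apply/eqP; congr (_ * _).
by apply: eq_bigr => i /negPf ->; rewrite mulrA.
Qed.

(** Gaussian elimination by induction on the number of rows that are not yet the corresponding unit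
    vectors; each step splits off one [row_replace] and one transposition. *)
Lemma unitmx_contracts S : S \in unitmx -> contracts S.
Proof.
have [n] := ubnP #|[pred i | row i S != delta_mx 0 i]|.
elim: n S => // n IH S; rewrite ltnS => Sn uS.
have [i Si|Sid] := pickP [pred i | row i S != delta_mx 0 i]; last first.
  suff -> : S = 1%:M by exact: contracts1.
  by apply/row_matrixP => i; rewrite row1; apply/eqP; have /negbFE := Sid i.
pose I := [pred p | row p S == delta_mx 0 p].
have [j /andP[jI Sij]|noj] := pickP [pred j | (j \notin I) && (S i j != 0)]; last first.
  (* If row [i] is supported on the columns in [I], it is a combination of unit rows of [S]; [v] is
     the resulting linear relation, with coefficient 1 at [i]. *)
  exfalso; pose v : Rk := delta_mx 0 i - \sum_(p | p \in I) S i p *: delta_mx 0 p.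
  have vS : v *m S = 0.
    rewrite mulmxBl -rowE mulmx_suml; apply/eqP; rewrite subr_eq0; apply/eqP.
    rewrite [LHS]row_sum_delta [LHS](bigID (mem I))/= [X in _ + X]big1 ?addr0; last first.
      move=> p pI; rewrite mxE; have := noj p; rewrite /= pI/= => /negbFE/eqP ->.
      by rewrite scale0r.
    apply: eq_bigr => p; rewrite inE => /eqP pI.
    by rewrite -scalemxAl -rowE pI mxE.
  have v0 : v = 0 by rewrite -(mulmxK uS v) vS mul0mx.
  have := congr1 (fun x : Rk => x 0 i) v0.
  rewrite !mxE !eqxx/= summxE big1 ?subr0; last first.
    move=> p pI; rewrite !mxE eqxx/=; case: eqVneq => [ip|_]; last by rewrite mulr0.
    by move: Si; rewrite /= ip -[_ == _]/(p \in I) pI.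
  by move/eqP; rewrite oner_eq0.
set E := row_replace j (row i S).
have uE : E \in unitmx by rewrite unitmxE det_row_replace mxE unitfE.
(* [E] maps [e_j] to row [i] of [S], so dividing by [E] turns that row into [e_j], and the
   transposition moves it to [e_i]. A row already equal to its [e_p] has [p] different from [i] and
   [j] and is preserved. *)
pose S' := S *m invmx E *m tperm_mx i j.
have SE : S = S' *m (tperm_mx i j *m E).
  rewrite /S' -!mulmxA (mulmxA (tperm_mx i j)) -perm_mxM tperm2 perm_mx1.
  by rewrite mul1mx mulVmx// mulmx1.
have uS' : S' \in unitmx by rewrite !unitmx_mul uS unitmx_inv uE unitmx_perm.
have deltaE p : p != j -> delta_mx 0 p *m E = delta_mx 0 p :> Rk.
  move=> pj; apply/rowP => l; rewrite mul_row_replace !mxE/= [j == p]eq_sym (negPf pj) mul0r addr0.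
  by case: eqVneq => // ->; rewrite eq_sym (negPf pj).
have deltaEj : delta_mx 0 j *m E = row i S.
  by apply/rowP => l; rewrite mul_row_replace !mxE !eqxx mul1r/=; case: eqVneq => _; rewrite ?mulr0n add0r.
have deltat p : delta_mx 0 p *m tperm_mx i j = delta_mx 0 (tperm i j p) :> Rk.
  by apply/rowP => l; rewrite -xcolE !mxE -(inj_eq (@perm_inj _ (tperm i j))) tpermK.
have deltaV p x : delta_mx 0 p *m E = x -> x *m invmx E = delta_mx 0 p.
  by move=> <-; rewrite mulmxK.
rewrite SE; apply: contractsM; last first.
  by apply: contractsM; [exact: contracts_tperm|apply: contracts_row_replace; rewrite mxE].
apply: IH => //.
apply: leq_trans Sn; apply: proper_card; apply/properP; split.
  apply/fintype.subsetP => p; rewrite !inE; apply: contraNN => /eqP pS.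
  have pj : p != j by apply: contraNN jI => /eqP <-; rewrite inE pS.
  have pi : p != i by apply: contraNN Si => /eqP <-; rewrite /= pS.
  rewrite rowE !mulmxA -rowE pS (deltaV p _ (deltaE p pj)) deltat tpermD// eq_sym//.
exists i; first by rewrite inE.
by rewrite !inE negbK rowE !mulmxA -rowE (deltaV j _ deltaEj) deltat tpermR.
Qed.

Lemma leb_mulmx_le S A : S \in unitmx ->
  (leb ((fun x => x *m S) @` A) <= `|\det S|%:E * leb A)%E.
Proof. by move=> uS; exact: unitmx_contracts. Qed.

Lemma leb_mulmx_ge S A : S \in unitmx ->
  (`|\det S|%:E * leb A <= leb ((fun x => x *m S) @` A))%E.
Proof.
move=> uS; have uS' : invmx S \in unitmx by rewrite unitmx_inv.
have dS : \det S != 0 by rewrite -unitfE -unitmxE.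
have := leb_mulmx_le ((fun x => x *m S) @` A) uS'.
rewrite (_ : _ @` (_ @` A) = A); last first.
  apply/seteqP; split => [_ [_ [x Ax <-] <-]|x Ax]; first by rewrite mulmxK.
  by exists (x *m S); [exists x|rewrite mulmxK].
move=> h; rewrite (le_trans (lee_wpmul2l _ h)) ?lee_fin//.
by rewrite muleA -EFinM -normrM -det_mulmx mulmxV// det1 normr1 mul1e.
Qed.

End linear.

(** * Regularity of Lebesgue measure *)

Section regularity.
Context {R : realType} {k : nat}.
Local Notation Rk := 'rV[R]_k.+1.
Local Notation X := (caratheodory_type (@leb R k)).
Implicit Types (a b x y r : Rk) (A B : set Rk).

Lemma measurable_box a b : measurable (box a b : set X).
Proof.
rewrite (_ : box a b = \bigcap_(i in [set: 'I_k.+1])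
    ((fun y : X => (y : Rk) 0 i) @^-1` `[a 0 i, b 0 i]%classic)); last first.
  apply/seteqP; split => y h i; first by move=> _ /=; rewrite in_itv/=; exact: h.
  by have := h i Logic.I; rewrite /= in_itv.
apply: fin_bigcap_measurable => // i _.
by rewrite -[X in measurable X]setTI; apply: measurable_coord.
Qed.

Definition cube (n : nat) : set Rk := box (const_mx (- n%:R)) (const_mx n%:R).

Lemma cubeP n x : cube n x <-> `|x| <= n%:R.
Proof.
split=> [h|/rV_norm_le - /(_ (ler0n _ _)) h i].
  by apply/rV_norm_le => // i; have := h i; rewrite !mxE ler_norml.
by rewrite !mxE -ler_norml.
Qed.

Lemma cube_cover x : exists n, cube n x.
Proof.
exists (Num.trunc `|x|).+1; apply/cubeP; apply: ltW.
by have /andP[] := truncn_itv (normr_ge0 x).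
Qed.

Lemma leb_cube_fin n : (leb (cube n) < +oo)%E.
Proof. exact: le_lt_trans (leb_box _ _) (ltry _). Qed.

(** The same set function on the Caratheodory sigma-algebra, under its own name to carry the measure
    structure. *)
Definition lebX : set X -> \bar R := @leb R k.

HB.instance Definition _ := isMeasure.Build _ _ _ lebX
  (caratheodory_measure0 (@leb R k)) (caratheodory_measure_ge0 (mu := @leb R k))
  (caratheodory_measure_sigma_additive (mu := @leb R k)).

Lemma leb_sigma_finite : sigma_finite setT lebX.
Proof.
exists cube; last by move=> i; split; [exact: measurable_box|exact: leb_cube_fin].
by apply/seteqP; split => // x _; have [n nx] := cube_cover x; exists n.
Qed.

HB.instance Definition _ := Measure_isSigmaFinite.Build _ _ _ lebX leb_sigma_finite.

Lemma null_measurable A : leb A = 0%E -> measurable (A : set X).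
Proof.
move=> A0; apply: le_caratheodory_measurable => E.
change (leb (E `&` A) + leb (E `&` ~` A) <= leb E)%E.
rewrite (_ : leb (E `&` A) = 0%E).
  by rewrite add0e; apply: le_leb => x [].
by apply/eqP; rewrite eq_le leb_ge0 andbT -A0; apply: le_leb => x [].
Qed.

Lemma null_subset A B : A `<=` B -> leb B = 0%E -> leb A = 0%E.
Proof. by move=> /le_leb AB B0; apply/eqP; rewrite eq_le leb_ge0 andbT -B0. Qed.

Lemma null_bigcup (F : nat -> set Rk) : (forall n, leb (F n) = 0%E) ->
  leb (\bigcup_n F n) = 0%E.
Proof.
move=> F0; apply/eqP; rewrite eq_le leb_ge0 andbT.
by rewrite (le_trans (leb_sigma_subadditive _))// eseries0.
Qed.

Lemma null_bigcup_count (I : countType) (F : I -> set Rk) : (forall i, leb (F i) = 0%E) ->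
  leb (\bigcup_i F i) = 0%E.
Proof.
move=> F0; apply: (@null_subset _ (\bigcup_n (if unpickle n is Some i then F i else set0))).
  by move=> x [i _ Fix]; exists (pickle i) => //; rewrite pickleK.
by apply: null_bigcup => n; case: unpickle => // ; exact: leb0.
Qed.

Lemma null_setU A B : leb A = 0%E -> leb B = 0%E -> leb (A `|` B) = 0%E.
Proof.
move=> A0 B0; apply/eqP; rewrite eq_le leb_ge0 andbT.
by apply: (le_trans (outer_measureU2 leb _ _)); rewrite [X in (X + _)%E]A0 [X in (_ + X)%E]B0 adde0.
Qed.

(** Failure for every [t = 1 / (n + 1)] would give [box_vol a b + e <= box_vol a b] in the limit. *)
Lemma box_thicken a b (e : R) : 0 < e -> exists t : R, 0 < t /\
  box_vol (a - const_mx t) (b + const_mx t) <= box_vol a b + e.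
Proof.
move=> e0; apply: contrapT => /forallNP h.
pose l i := Num.max (b 0 i - a 0 i) 0.
have : ((box_vol a b + e)%:E <= (\prod_i l i)%:E)%E.
  apply: (@le_prod_limit _ _ _ _ (fun=> 2)) => n.
  have n0 : 0 < n.+1%:R^-1 :> R by rewrite invr_gt0.
  have := h n.+1%:R^-1; rewrite n0 => /not_andP[//|/negP]; rewrite -ltNge => /ltW h1.
  rewrite lee_fin (le_trans h1)//; apply: ler_prod => i _.
  rewrite le_max lexx orbT/= !mxE /l; move: (n.+1%:R^-1 : R) n0 => t t0.
  by case: (leP (b 0 i - a 0 i) 0) => ?; rewrite ge_max; apply/andP; split; lra.
by rewrite lee_fin gerDl leNgt e0.
Qed.

Definition obox a b : set Rk := [set x | forall i, a 0 i < x 0 i < b 0 i].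

Lemma open_obox a b : open (obox a b).
Proof.
rewrite openE => x abx.
have : \forall e \near 0^'+, forall i, a 0 i + e < x 0 i < b 0 i - e.
  apply: filter_forall => i; have /andP[ax xb] := abx i.
  near=> e; apply/andP; split.
    by rewrite -ltrBrDl; near: e; apply: nbhs_right_lt; rewrite subr_gt0.
  by rewrite ltrBrDr -ltrBrDl; near: e; apply: nbhs_right_lt; rewrite subr_gt0.
move=> /(filterI (nbhs_right_gt 0)) /filter_ex[e [e0 he]].
apply/nbhs_ballP; exists e => //= y [_ xy] i.
have /andP[h1 h2] := he i; have := xy 0 i; rewrite /ball/= ltr_distl => /andP[h3 h4].
by apply/andP; split; lra.
Unshelve. all: by end_near. Qed.

Lemma leb_open A (e : R) : (leb A < +oo)%E -> 0 < e ->
  exists U, [/\ open U, A `<=` U & (leb U <= leb A + e%:E)%E].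
Proof.
move=> Afin e0; have e20 : 0 < e / 2 by rewrite divr_gt0.
have [ab [Aab sumab]] := leb_cover Afin e20.
have /choice[t tP] n : exists t : R, 0 < t /\
    box_vol ((ab n).1 - const_mx t) ((ab n).2 + const_mx t) <=
    box_vol (ab n).1 (ab n).2 + (e / 2) / (2 ^ n.+1)%:R.
  by apply: box_thicken; rewrite divr_gt0// ltr0n expn_gt0.
exists (\bigcup_n obox ((ab n).1 - const_mx (t n)) ((ab n).2 + const_mx (t n))); split.
- by apply: bigcup_open => n _; exact: open_obox.
- move=> x /Aab[n _ xn]; exists n => // i; rewrite !mxE; have /andP[h1 h2] := xn i.
  by have [t0 _] := tP n; apply/andP; split; lra.
- apply: (@le_trans _ _ (\sum_(n <oo) (box_vol (ab n).1 (ab n).2 + (e / 2) / (2 ^ n.+1)%:R)%:E)%E).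
    apply: le_trans (leb_sigma_subadditive _) _.
    apply: lee_nneseries => n _; first by move=> _; exact: leb_ge0.
    apply: (@le_trans _ _ (box_vol ((ab n).1 - const_mx (t n)) ((ab n).2 + const_mx (t n)))%:E).
      apply: le_trans (leb_box _ _); apply: le_leb => x xn i.
      by have /andP[h1 h2] := xn i; rewrite (ltW h1) (ltW h2).
    by rewrite lee_fin; exact: (tP n).2.
  have := @epsilon_trick R (fun n => (box_vol (ab n).1 (ab n).2)%:E) (e / 2) xpredT.
  under eq_eseriesr do rewrite -EFinD.
  move=> /(_ _ (ltW e20)) /le_trans; apply.
    by move=> n; rewrite lee_fin box_vol_ge0.
  rewrite (le_trans (leeD2r _ sumab))// -addeA -EFinD -mulr2n -[_ *+ 2]mulr_natr divfK//.
Qed.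

(** The Caratheodory criterion turns an excess of measure into a bound on the difference set only
    for finite measure, hence the cut into cubes with errors [e / 2 ^ n.+1]. *)
Lemma measurable_outer A (e : R) : measurable (A : set X) -> 0 < e ->
  exists U, [/\ open U, A `<=` U & (leb (U `\` A) <= e%:E)%E].
Proof.
move=> mA e0.
have /choice[U UP] n : exists U, [/\ open U, A `&` cube n `<=` U &
    (leb (U `\` (A `&` cube n)) <= (e / (2 ^ n.+1)%:R)%:E)%E].
  have Afin : (leb (A `&` cube n) < +oo)%E.
    by apply: le_lt_trans (leb_cube_fin n); apply: le_leb => x [].
  have en : 0 < e / (2 ^ n.+1)%:R by rewrite divr_gt0// ltr0n expn_gt0.
  have [U [oU AU leU]] := leb_open Afin en; exists U; split => //.
  have mAn : measurable (A `&` cube n : set X) by apply: measurableI => //; exact: measurable_box.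
  have := mAn U; rewrite setIidr// => UE; move: leU; rewrite -/leb [X in (X <= _)%E]UE -setDE.
  by rewrite leeD2lE// ge0_fin_numE// leb_ge0.
exists (\bigcup_n U n); split.
- by apply: bigcup_open => n _; have [] := UP n.
- move=> x Ax; have [n nx] := cube_cover x; exists n => //.
  by have [_ + _] := UP n; apply.
- apply: (@le_trans _ _ (leb (\bigcup_n (U n `\` (A `&` cube n))))).
    by apply: le_leb => x [[n _ Unx] nAx]; exists n => //; split => // -[].
  apply: le_trans (leb_sigma_subadditive _) _.
  apply: le_trans (epsilon_trick0 xpredT (ltW e0)).
  apply: lee_nneseries => n _; first by move=> _; exact: leb_ge0.
  by have [] := UP n.
Qed.

(** Complements of open sets around the complement of [A] are closed subsets of [A], and cubes make
    them compact. Compact parts have tractable images and preimages; the null remainder is left to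
    the null-set hypotheses on the maps. *)
Lemma measurable_sigma_compact A : measurable (A : set X) ->
  exists C : nat * nat -> set Rk, [/\ forall p, compact (C p), forall p, C p `<=` A
    & leb (A `\` \bigcup_p C p) = 0%E].
Proof.
move=> mA; have mAC : measurable (~` A : set X) by exact: measurableC.
have /choice[U UP] n : exists U, [/\ open U, ~` A `<=` U & (leb (U `\` ~` A) <= (n.+1%:R^-1)%:E)%E].
  by apply: measurable_outer => //; rewrite invr_gt0.
exists (fun p => ~` U p.1 `&` cube p.2); split.
- move=> [n m] /=; apply: bounded_closed_compact.
    exists m%:R; split; first exact: num_real.
    by move=> M mM x [_ /cubeP xm]; exact: le_trans xm (ltW mM).
  apply: closedI; first by rewrite closedC; have [] := UP n.
  rewrite (_ : cube m = (fun x : Rk => `|x|) @^-1` [set r | r <= m%:R]); last first.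
    by apply/seteqP; split => x /cubeP.
  by apply: closed_comp => [x _|]; [exact: norm_continuous|exact: closed_le].
- by move=> [n m] x /= [nUx _]; apply: contrapT => nAx; apply: nUx; have [_ + _] := UP n; apply.
- apply/eqP; rewrite eq_le leb_ge0 andbT; apply/lee_addgt0Pr => e e0; rewrite add0e.
  have /ltr_add_invr[n] := e0; rewrite add0r => ne.
  have [_ _ Un] := UP n.
  apply: (@le_trans _ _ (leb (U n `\` ~` A))).
    apply: le_leb => x [Ax nC]; split; last by move=> /(_ Ax).
    apply: contrapT => nUx; apply: nC; have [m mx] := cube_cover x.
    by exists (n, m).
  by rewrite (le_trans Un)// lee_fin ltW.
Qed.

End regularity.

(** * Euclidean balls and the maximum norm *)

Section euclidean.
Context {R : realType} {k : nat}.
Local Notation Rk := 'rV[R]_k.+1.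
Local Notation Mk := 'M[R]_k.+1.
Local Notation X := (caratheodory_type (@leb R k)).
Implicit Types (a b x y u : Rk) (A B : set Rk).

Lemma norm_le_enorm x : `|x| <= enorm x.
Proof.
apply/rV_norm_le => [|i]; first exact: sqrtr_ge0.
rewrite -sqrtr_sqr /enorm ler_wsqrtr// (bigD1 i)//= lerDl.
by apply: sumr_ge0 => j _; exact: sqr_ge0.
Qed.

Lemma enorm_le_norm x : enorm x <= k.+1%:R * `|x|.
Proof.
rewrite -[leRHS]ger0_norm ?mulr_ge0// -sqrtr_sqr /enorm ler_wsqrtr//.
apply: (@le_trans _ _ (\sum_(i < k.+1) `|x| ^+ 2)).
  apply: ler_sum => i _; rewrite -[leLHS]ger0_norm ?sqr_ge0// normrX.
  by rewrite lerXn2r ?nnegrE// rV_norm_coord.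
rewrite sumr_const card_ord -[leLHS]mulr_natl exprMn ler_wpM2r ?sqr_ge0//.
by rewrite expr2 ler_peMl// ler1n.
Qed.

Lemma enormZ (c : R) x : 0 <= c -> enorm (c *: x) = c * enorm x.
Proof.
move=> c0; rewrite /enorm -{2}(ger0_norm c0) -sqrtr_sqr -sqrtrM ?sqr_ge0//.
by rewrite mulr_sumr; congr Num.sqrt; apply: eq_bigr => i _; rewrite mxE exprMn.
Qed.

Lemma norm_mulmx_le u (M : Mk) (c : R) : 0 <= c -> (forall i j, `|M i j| <= c) ->
  `|u *m M| <= k.+1%:R * c * `|u|.
Proof.
move=> c0 Mc; apply/rV_norm_le => [|j]; first by rewrite !mulr_ge0.
rewrite mxE (le_trans (ler_norm_sum _ _ _))//.
apply: (@le_trans _ _ (\sum_(i < k.+1) c * `|u|)).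
  by apply: ler_sum => i _; rewrite normrM mulrC ler_pM// rV_norm_coord.
by rewrite sumr_const card_ord -[leLHS]mulr_natl mulrA.
Qed.

Lemma norm_mulmx_bound (M : Mk) : exists2 C : R, 0 < C & forall u, `|u *m M| <= C * `|u|.
Proof.
pose c := 1 + \sum_i \sum_j `|M i j|.
have s0 : 0 <= \sum_i \sum_j `|M i j| by apply: sumr_ge0 => i _; exact: sumr_ge0.
have c0 : 0 < c by rewrite /c ltr_pwDl.
exists (k.+1%:R * c); first by rewrite mulr_gt0.
move=> u; apply: norm_mulmx_le; first exact: ltW.
move=> i j; have h1 : `|M i j| <= \sum_j `|M i j| by rewrite (bigD1 j)//= lerDl sumr_ge0.
have h2 : \sum_j `|M i j| <= \sum_i \sum_j `|M i j|.
  by rewrite [leRHS](bigD1 i)//= lerDl sumr_ge0// => p _; exact: sumr_ge0.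
by rewrite (le_trans h1)// (le_trans h2)// /c lerDr.
Qed.

Lemma measurable_coordB x i : measurable_fun setT (fun y : X => (y : Rk) 0 i - x 0 i).
Proof. by apply: measurable_funB; [exact: measurable_coord|exact: measurable_cst]. Qed.

Let eball_affine x (r : R) : 0 < r -> eball x r = (fun y => x + r *: y) @` eball 0 1.
Proof.
move=> r0; apply/seteqP; split => [y|_ [y + <-]]; rewrite /eball/=.
  move=> yr; exists (r^-1 *: (y - x)).
    by rewrite /= subr0 enormZ ?invr_ge0 ?(ltW r0)// mulrC ltr_pdivrMr// mul1r.
  by rewrite scalerA mulfV ?gt_eqF// scale1r addrC subrK.
rewrite subr0 => y1; rewrite addrAC subrr add0r enormZ ?(ltW r0)//.
by rewrite -[ltRHS]mulr1 ltr_pM2l.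
Qed.

(** Both inequalities are Lipschitz bounds, for the homothety and for its inverse; the measure of
    the unit ball is left unevaluated. *)
Lemma leb_eball x (r : R) : 0 < r ->
  leb (eball x r) = ((r ^+ k.+1)%:E * leb (eball (0 : Rk) 1))%E.
Proof.
move=> r0; have rn0 : 0 < r ^+ k.+1 by rewrite exprn_gt0.
apply/eqP; rewrite eq_le; apply/andP; split.
  rewrite (eball_affine x r0); apply: leb_lipschitz => // y z _ _.
  by rewrite opprD addrACA subrr add0r -scalerBr normrZ gtr0_norm.
have inv0 : 0 < r^-1 by rewrite invr_gt0.
have := @leb_lipschitz _ _ (eball x r) (fun y => r^-1 *: (y - x)) _ inv0.
rewrite (_ : _ @` eball x r = eball 0 1); last first.
  rewrite (eball_affine x r0); apply/seteqP; split => [_ [_ [y yB <-] <-]|y yB].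
    by rewrite addrAC subrr add0r scalerA mulVf ?gt_eqF// scale1r.
  exists (x + r *: y); first by exists y.
  by rewrite addrAC subrr add0r scalerA mulVf ?gt_eqF// scale1r.
move=> h; rewrite (le_trans (lee_wpmul2l _ (h _))) ?lee_fin ?(ltW rn0)//.
  by move=> y z _ _; rewrite -scalerBr opprB addrA subrK normrZ gtr0_norm.
by rewrite muleA -EFinM -exprMn mulfV ?gt_eqF// expr1n mul1e.
Qed.

Lemma leb_eball1_fin : (leb (eball (0 : Rk) 1) < +oo)%E.
Proof.
apply: le_lt_trans (leb_cube_fin 1); apply: le_leb => x; rewrite /eball/= subr0 => /ltW x1.
by apply/cubeP; exact: le_trans (norm_le_enorm _) x1.
Qed.

End euclidean.

(** * The area inequality for approximately differentiable maps *)

Section good_sets.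
Context {R : realType} {k : nat}.
Local Notation Rk := 'rV[R]_k.+1.
Local Notation Mk := 'M[R]_k.+1.
Local Notation X := (caratheodory_type (@leb R k)).
Implicit Types (x y u : Rk) (A B : set Rk) (T : Mk).
Variables (Om : set Rk) (F : Rk -> Rk).
Hypotheses (oOm : open Om) (mF : lmeas_fun Om F).

Lemma measurable_continuous (u : Rk -> R) : continuous u ->
  measurable_fun setT (u : X -> R).
Proof.
move=> cu _; apply: (measurability _ (RGenOInfty.measurableE R)) => //.
move=> _ [_ [r ->] <-]; rewrite setTI; apply: measurable_open_rV.
apply: open_comp; first by move=> x _; exact: cu.
by rewrite set_itvoy; exact: open_gt.
Qed.

Lemma lmeas_fun_measurable (u : Rk -> R) : lmeas_fun Om u ->
  measurable_fun (Om : set X) (u : X -> R).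
Proof.
move=> mmu mOm; apply: (measurability _ (RGenOInfty.measurableE R)) => //.
by move=> _ [_ [r ->] <-]; rewrite set_itvoy; exact: (mmu _ (@open_gt _ r)).
Qed.

Lemma lmeas_fun_comp (S T : topologicalType) (u : Rk -> S) (h : S -> T) :
  lmeas_fun Om u -> continuous h -> lmeas_fun Om (h \o u).
Proof.
move=> mmu ch U oU; apply: (mmu (h @^-1` U)).
by apply: open_comp => // x _; exact: ch.
Qed.

Lemma measurable_map_coord i : measurable_fun (Om : set X) (fun x : X => F x 0 i).
Proof.
apply: lmeas_fun_measurable; apply: (lmeas_fun_comp (h := fun y : Rk => y 0 i)) => //.
exact: coord_continuous.
Qed.

Definition good T (e : R) x : set Rk :=
  [set y | Om y /\ `|F y - F x - (y - x) *m T| <= e * `|y - x|].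

Lemma measurable_good T e x : 0 <= e -> measurable (good T e x : set X).
Proof.
move=> e0.
have E (y : Rk) i : (F y - F x - (y - x) *m T) 0 i =
    F y 0 i - F x 0 i - \sum_j (y 0 j - x 0 j) * T j i.
  by rewrite !mxE; congr (_ - _); apply: eq_bigr => j _; rewrite !mxE.
rewrite (_ : good T e x = \bigcap_(i in [set: 'I_k.+1])
   (Om `&` [set y : X | `|F y 0 i - F x 0 i - \sum_j ((y : Rk) 0 j - x 0 j) * T j i|
      <= e * `|(y : Rk) - x| ])); last first.
  apply/seteqP; split => y.
    move=> [Oy /rV_norm_le h] i _; split => //=.
    by rewrite -E; apply: h; rewrite mulr_ge0.
  move=> h; split; first by have [] := h 0 Logic.I.
  apply/rV_norm_le => [|i]; first by rewrite mulr_ge0.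
  by have [_ /=] := h i Logic.I; rewrite E.
apply: fin_bigcap_measurable => // i _.
apply: measurable_fun_le; first exact: measurable_open_rV.
  apply: measurableT_comp; first exact: normr_measurable.
  apply: measurable_funB.
    by apply: measurable_funB; [exact: measurable_map_coord|exact: measurable_cst].
  apply: measurable_sum => j; apply: measurable_funM; last exact: measurable_cst.
  by apply: measurable_funTS; exact: measurable_coordB.
apply: measurable_funM; first exact: measurable_cst.
apply: measurable_funTS.
apply: (@measurable_continuous (fun y : Rk => `|y - x|)) => y.
apply: (@continuous_comp _ _ _ (fun y : Rk => y - x) (fun y : Rk => `|y|)).
  by apply: (@continuousB _ _ _ id (fun=> x)); [exact: cvg_id|exact: cst_continuous].
exact: norm_continuous.
Qed.

(* Chosen so that exceptional sets of relative measure at most [theta] in balls of radii [r]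
   and [2 (k + 1) r] cannot cover the smaller ball. *)
Definition theta : R := (2 + (2 * k.+1%:R) ^+ k.+1)^-1.

Lemma theta_gt0 : 0 < theta.
Proof. by rewrite invr_gt0 addr_gt0// exprn_gt0// mulr_gt0. Qed.

(** Approximate differentiability made uniform: one matrix, one tolerance and one scale [d], with
    the density condition relaxed to the fixed defect [theta]. *)
Definition fat T (e d : R) : set Rk := [set x | Om x /\ forall r, 0 < r < d ->
  (leb (eball x r `\` good T e x) <= theta%:E * leb (eball x r))%E].

(** The two balls share a point [z] that is good for both [x] and [y]. Subtracting the estimates
    along [z - x], of length at most [r], and [z - y], of length at most [2 * r], gives the factor
    3. *)
Lemma fat_lipschitz T e d x y : (0 < leb (eball (0 : Rk) 1))%E ->
  0 <= e -> fat T e d x -> fat T e d y -> 2 * k.+1%:R * `|x - y| < d ->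
  `|F x - F y - (x - y) *m T| <= 3 * e * `|x - y|.
Proof.
move=> v0 e0 [Ox fx] [Oy fy] xyd.
have [->|xy] := eqVneq x y; first by rewrite !subrr mul0mx subr0 !normr0 mulr0.
set r := `|x - y| in xyd *; have r0 : 0 < r by rewrite normr_gt0 subr_eq0.
(* A point near [x] is within [2 * r] of [y] in the maximum norm; the factor [k + 1] passes to the
   Euclidean balls in which densities are taken. *)
set c : R := 2 * k.+1%:R in xyd.
have c1 : 1 <= c by rewrite /c -natrM ler1n.
have c0 : 0 < c by exact: lt_le_trans c1.
have rd : 0 < r < d by rewrite r0 (le_lt_trans _ xyd)// ler_peMl// ltW.
have crd : 0 < c * r < d by rewrite mulr_gt0.
set v := leb (eball 0 1) in v0.
have vfin : v \is a fin_num by rewrite ge0_fin_numE ?leb_ge0//; exact: leb_eball1_fin.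
have [z [zx [gx gy]]] : exists z, eball x r z /\ good T e x z /\ good T e y z.
  apply: contrapT => /forallNP nz.
  have sub : eball x r `<=` (eball x r `\` good T e x) `|` (eball y (c * r) `\` good T e y).
    move=> z zx; have [gx|] := pselect (good T e x z); last by left.
    right; split; last by move=> gy; apply: (nz z).
    rewrite /eball/= (le_lt_trans (enorm_le_norm _))// /c -mulrA mulrCA ltr_pM2l//.
    have zxr : `|z - x| < r by exact: le_lt_trans (norm_le_enorm _) zx.
    rewrite -(subrK x z) -addrA (le_lt_trans (ler_normD _ _))// mulr_natl mulr2n.
    by rewrite ltr_leD.
  have : (leb (eball x r) <= theta%:E * leb (eball x r) + theta%:E * leb (eball y (c * r)))%E.
    apply: le_trans (le_leb sub) _; apply: le_trans (outer_measureU2 leb _ _) _.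
    by apply: leeD; [exact: fx|exact: fy].
  rewrite (leb_eball x r0) (leb_eball y (mulr_gt0 c0 r0)) -/v -(fineK vfin) -!EFinM -EFinD lee_fin.
  rewrite !mulrA -mulrDl ler_pM2r; last by rewrite fine_gt0// v0/= -ge0_fin_numE// leb_ge0.
  rewrite exprMn mulrA -mulrDl ler_pMl ?exprn_gt0// -[X in X + _]mulr1 -mulrDr.
  rewrite /theta mulrC ler_pdivlMr ?mul1r ?addr_gt0 ?exprn_gt0//.
  by rewrite -/c lerD2r leNgt ltr1n.
have [_ hx] := gx; have [_ hy] := gy.
have zxr : `|z - x| <= r by apply: ltW; exact: le_lt_trans (norm_le_enorm _) zx.
have zyr : `|z - y| <= 2 * r.
  rewrite -(subrK x z) -addrA (le_trans (ler_normD _ _))// mulr_natl mulr2n.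
  by rewrite lerD.
have -> : F x - F y - (x - y) *m T =
    (F z - F y - (z - y) *m T) - (F z - F x - (z - x) *m T).
  rewrite !mulmxBl; apply/rowP => i; rewrite !mxE; ring.
rewrite (le_trans (ler_normB _ _))//.
have h1 : `|F z - F y - (z - y) *m T| <= e * (2 * r) by rewrite (le_trans hy)// ler_wpM2l.
have h2 : `|F z - F x - (z - x) *m T| <= e * r by rewrite (le_trans hx)// ler_wpM2l.
by rewrite (le_trans (lerD h1 h2))// le_eqVlt; apply/orP; left; apply/eqP; ring.
Qed.

(** If the unit ball were null, so would be all balls, and the density quotients, being 0 by the
    convention for division by 0, could not tend to 1. *)
Lemma approx_diff_eball_gt0 (A : Mk) x : approx_diff Om F A x -> (0 < leb (eball (0 : Rk) 1))%E.
Proof.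
move=> /(_ 1 ltr01) dx; rewrite lt0e leb_ge0 andbT; apply/negP => /eqP v0.
have := cvgr_gt _ dx => /(_ _ 0 ltr01).
move=> /(filterI (nbhs_right_gt 0)) /filter_ex[r [r0]].
by have := leb_eball x r0; rewrite v0 mule0 /leb => ->; rewrite invr0 mulr0 ltxx.
Qed.

Lemma approx_diff_fat (A : Mk) T e x : Om x -> approx_diff Om F A x -> 0 < e ->
  (forall u, `|u *m (A - T)| <= e / 2 * `|u|) ->
  exists2 d : R, 0 < d & forall d', d' <= d -> fat T e d' x.
Proof.
move=> Ox dA e0 AT.
have v0 := approx_diff_eball_gt0 dA.
set v := leb (eball 0 1) in v0.
have vfin : v \is a fin_num by rewrite ge0_fin_numE ?leb_ge0//; exact: leb_eball1_fin.
(* Half of [e] is reserved for replacing [A] by [T]; dividing by [k + 1] pays for passing from the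
   Euclidean to the maximum norm. *)
have e1 : 0 < e / 2 / k.+1%:R by rewrite !divr_gt0.
set D := [set y | Om y /\ y != x /\
  enorm (F y - F x - (y - x) *m A) / enorm (y - x) < e / 2 / k.+1%:R].
have Dgood : D `<=` good T e x.
  move=> y [Oy [yx ye]]; split => //.
  have yx0 : 0 < enorm (y - x) by apply: lt_le_trans (norm_le_enorm _); rewrite normr_gt0 subr_eq0.
  rewrite ltr_pdivrMr// in ye.
  have -> : F y - F x - (y - x) *m T = (F y - F x - (y - x) *m A) + (y - x) *m (A - T).
    by rewrite mulmxBr; apply/rowP => i; rewrite !mxE; ring.
  rewrite (le_trans (ler_normD _ _))// [X in X * _](splitr e) mulrDl lerD//.
  rewrite (le_trans (norm_le_enorm _))// (le_trans (ltW ye))//.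
  rewrite -[leLHS]mulrA ler_pM2l ?divr_gt0// ler_pdivrMl//; exact: enorm_le_norm.
have : \forall r \near 0^'+, 1 - theta < fine (leb (D `&` eball x r)) / fine (leb (eball x r)).
  have /cvgr_gt := dA _ e1; apply.
  by rewrite gtrBl theta_gt0.
move=> /nbhs_ballP[d /= d0 hd]; exists d => // d' d'd; split => // r /andP[r0 rd].
have := hd r _ r0; rewrite /ball/= sub0r normrN gtr0_norm// => /(_ (lt_le_trans rd d'd)).
have bfin : leb (eball x r) \is a fin_num.
  rewrite ge0_fin_numE ?leb_ge0// leb_eball// -/v -(fineK vfin) -EFinM ltry//.
have b0 : 0 < fine (leb (eball x r)).
  rewrite fine_gt0// -ge0_fin_numE ?leb_ge0// bfin andbT leb_eball// mule_gt0//.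
  by rewrite lte_fin exprn_gt0.
rewrite ltr_pdivlMr// => h.
have mg : measurable (good T e x : set X) by apply: measurable_good; exact: ltW.
have := mg (eball x r); rewrite -setDE => bE.
have leg : (leb (D `&` eball x r) <= leb (eball x r `&` good T e x))%E.
  by apply: le_leb => y [Dy yr]; split => //; exact: Dgood.
have gfin : leb (eball x r `&` good T e x) \is a fin_num.
  rewrite ge0_fin_numE ?leb_ge0//; apply: (@le_lt_trans _ _ (leb (eball x r))).
    by apply: le_leb => y [].
  by rewrite -ge0_fin_numE// leb_ge0.
have Dfin : leb (D `&` eball x r) \is a fin_num.
  rewrite ge0_fin_numE ?leb_ge0//; apply: (@le_lt_trans _ _ (leb (eball x r))).
    by apply: le_leb => y [].
  by rewrite -ge0_fin_numE// leb_ge0.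
have ngfin : leb (eball x r `\` good T e x) \is a fin_num.
  rewrite ge0_fin_numE ?leb_ge0//; apply: (@le_lt_trans _ _ (leb (eball x r))).
    by apply: le_leb => y [].
  by rewrite -ge0_fin_numE// leb_ge0.
have {bE} : fine (leb (eball x r)) =
    fine (leb (eball x r `&` good T e x)) + fine (leb (eball x r `\` good T e x)).
  by rewrite -fineD//; congr fine.
move: leg; rewrite -(fineK ngfin) -(fineK bfin) -(fineK gfin) -(fineK Dfin) /= -EFinM !lee_fin.
by move: h; rewrite mulrBl mul1r => ? ? ?; lra.
Qed.

(* [P] need not be measurable: [Q] is cut out of [Om] by the inequalities against a
   countable dense subset of [P]. *)
Lemma lipschitz_enlarge T (c : R) (P : set Rk) : 0 <= c -> P `<=` Om ->
  (forall x y, P x -> P y -> `|F x - F y - (x - y) *m T| <= c * `|x - y|) ->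
  exists Q : set Rk, [/\ measurable (Q : set X), P `<=` Q, Q `<=` Om &
    forall x y, Q x -> Q y -> `|F x - F y - (x - y) *m T| <= c * `|x - y|].
Proof.
move=> c0 POm Plip.
have [->|/set0P[z Pz]] := eqVneq P set0; first by exists set0; split.
pose near_ (i : 'rV[rat]_k.+1 * nat) (x : Rk) := `|x - map_mx ratr i.1| < i.2.+1%:R^-1.
(* In each rational cell that meets [P] a point of [P] is chosen, and [z] serves as default
   elsewhere, so the [p i] are dense in [P]. *)
have /choice[p pP] i : exists x, P x /\ ((exists y, P y /\ near_ i y) -> near_ i x).
  have [[y [Py iy]]|no] := pselect (exists y, P y /\ near_ i y); last by exists z.
  by exists y.
have dense_p x n : P x -> exists i, `|x - p i| < n.+1%:R^-1.
  (* Twice the precision, because [x] and the chosen point are each within [1 / (m + 1)] of the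
     rational centre. *)
  move=> Px; pose m := (n.+1 * 2)%N.
  have m0 : 0 < m.+1%:R^-1 :> R by rewrite invr_gt0.
  have /choice[q qP] (i : 'I_k.+1) : exists q : rat, `|x 0 i - ratr q| <= m.+1%:R^-1 / 2.
    have m20 : 0 < m.+1%:R^-1 / 2 :> R by rewrite divr_gt0.
    have /rat_in_itvoo[q] : x 0 i - m.+1%:R^-1 / 2 < x 0 i + m.+1%:R^-1 / 2.
      by rewrite ltrBlDr -addrA ltrDl addr_gt0.
    rewrite in_itv/= => /andP[q1 q2]; exists q.
    by rewrite distrC ler_distl !ltW.
  have xq : near_ (\row_i q i, m) x.
    rewrite /near_/= (@le_lt_trans _ _ (m.+1%:R^-1 / 2))//; last first.
      by rewrite ltr_pdivrMr// ltr_pMr// ltr1n.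
    by apply/rV_norm_le => [|i]; [rewrite divr_ge0// ltW|rewrite !mxE].
  have [_ /(_ _)] := pP (\row_i q i, m); move=> /(_ (ex_intro _ x (conj Px xq))) pq.
  exists (\row_i q i, m).
  rewrite -(subrK (map_mx ratr (\row_i q i)) x) -addrA (le_lt_trans (ler_normD _ _))//.
  rewrite (@lt_le_trans _ _ (m.+1%:R^-1 + m.+1%:R^-1))//.
    by rewrite ltrD// distrC.
  rewrite -mulr2n -[_ *+ 2]mulr_natl ler_pdivrMr// mulrC ler_pdivlMr//.
  by rewrite -natrM ler_nat mulnC /m ltnW.
exists [set x | Om x /\ (forall n, exists i, `|x - p i| < n.+1%:R^-1) /\ forall i, good T c (p i) x].
split.
- rewrite (_ : [set x | _] = Om `&` (\bigcap_n (\bigcup_i [set x : Rk | `|x - p i| < n.+1%:R^-1])) `&`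
      \bigcap_i good T c (p i)).
    apply: measurableI; last first.
      rewrite -[X in measurable X]setCK setC_bigcap; apply: measurableC.
      apply: countable_bigcupT_measurable; first exact: countableP.
      by move=> i; apply: measurableC; exact: measurable_good.
    apply: measurableI; first exact: measurable_open_rV.
    apply: bigcap_measurable => // n _.
    apply: countable_bigcupT_measurable; first exact: countableP.
    move=> i; apply: measurable_open_rV.
    rewrite (_ : [set x : Rk | _] = ball (p i) n.+1%:R^-1); first exact: ball_open.
    by rewrite -ball_normE; apply/seteqP; split => y /=; rewrite distrC.
  apply/seteqP; split => x.
    move=> [Ox [h1 h2]]; split; last by move=> i _.
    by split => // n _; have [i ?] := h1 n; exists i.
  move=> [[Ox h1] h2]; split => //; split; last by move=> i; exact: h2.
  by move=> n; have [i _ ?] := h1 n Logic.I; exists i.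
- move=> x Px; split; first exact: POm.
  split; first by move=> n; exact: dense_p.
  by move=> i; split; [exact: POm|apply: Plip => //; have [] := pP i].
- by move=> x [].
- move=> x y [Ox [xp xg]] [Oy [yp yg]].
  have step n : `|F x - F y - (x - y) *m T| <= c * `|x - y| + 2 * c * n.+1%:R^-1.
    have [i xi] := xp n.
    have [_ h1] := xg i; have [_ h2] := yg i.
    have -> : F x - F y - (x - y) *m T =
       (F x - F (p i) - (x - p i) *m T) - (F y - F (p i) - (y - p i) *m T).
      by rewrite !mulmxBl; apply/rowP => j; rewrite !mxE; ring.
    rewrite (le_trans (ler_normB _ _))// (le_trans (lerD h1 h2))//.
    have h3 : `|y - p i| <= `|x - y| + n.+1%:R^-1.
      rewrite -(subrK x y) -addrA (le_trans (ler_normD _ _))//.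
      by apply: lerD; [rewrite subrK distrC|exact: ltW].
    have h4 : c * `|x - p i| <= c * n.+1%:R^-1 by rewrite ler_wpM2l// ltW.
    have h5 : c * `|y - p i| <= c * (`|x - y| + n.+1%:R^-1) by rewrite ler_wpM2l.
    rewrite (le_trans (lerD h4 h5))// le_eqVlt; apply/orP; left; apply/eqP; ring.
  apply/ler_addgt0Pr => e e0.
  have c20 : 0 < 2 * c + 1 by rewrite ltr_wpDl// mulr_ge0.
  have /ltr_add_invr[n] : 0 < e / (2 * c + 1) by rewrite divr_gt0.
  rewrite add0r ltr_pdivlMr// => /ltW ne.
  rewrite (le_trans (step n))// lerD2l (le_trans _ ne)// mulrC ler_wpM2l ?invr_ge0//.
  by rewrite lerDl.
Qed.

End good_sets.

(** * Decomposition into nearly linear pieces *)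

Section pieces.
Context {R : realType} {k : nat}.
Local Notation Rk := 'rV[R]_k.+1.
Local Notation Mk := 'M[R]_k.+1.
Local Notation X := (caratheodory_type (@leb R k)).
Implicit Types (x y u : Rk) (A B : set Rk) (S T : Mk).

(* The exact measure of the unit ball cancels, so its positivity suffices. *)
Lemma det_le_lipschitz S (c : R) : (0 < leb (eball (0 : Rk) 1))%E -> S \in unitmx ->
  0 < c -> (forall u, `|u *m S| <= c * `|u|) -> `|\det S| <= c ^+ k.+1.
Proof.
move=> v0 uS c0 Sc; set v := leb (eball 0 1) in v0.
have vfin : v \is a fin_num by rewrite ge0_fin_numE ?leb_ge0//; exact: leb_eball1_fin.
have := leb_mulmx_ge (eball 0 1) uS.
have h2 : (leb ((fun x => x *m S) @` eball 0 1) <= (c ^+ k.+1)%:E * v)%E.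
  by apply: leb_lipschitz => // x y _ _; rewrite -mulmxBl.
move=> /le_trans/(_ h2); rewrite -/v -(fineK vfin) -!EFinM lee_fin ler_pM2r//.
by rewrite fine_gt0// v0/= -ge0_fin_numE// leb_ge0.
Qed.

Variables (Om : set Rk) (F : Rk -> Rk).
Hypotheses (oOm : open Om) (mF : lmeas_fun Om F).

Lemma leb_piece_ge T (kap : R) (E : set Rk) : 0 < kap < 1 -> T \in unitmx ->
  (forall x y, E x -> E y -> `|F x - F y - (x - y) *m T| <= kap * `|(x - y) *m T|) ->
  (`|\det T|%:E * leb E <= ((1 - kap)^-1 ^+ k.+1)%:E * leb (F @` E))%E.
Proof.
move=> /andP[kap0 kap1] uT ET; apply: le_trans (leb_mulmx_ge E uT) _.
have k1 : 0 < 1 - kap by rewrite subr_gt0.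
have low x y : E x -> E y -> `|(x - y) *m T| <= (1 - kap)^-1 * `|F x - F y|.
  move=> Ex Ey; rewrite ler_pdivlMl// mulrBl mul1r lerBlDr.
  have := ler_normB (F x - F y) (F x - F y - (x - y) *m T); rewrite subKr => /le_trans; apply.
  by rewrite lerD2l; exact: ET.
have /choice[G GP] y : exists x, (F @` E) y -> E x /\ F x = y.
  have [[x Ex xy]|] := pselect ((F @` E) y); first by exists x.
  by move=> ny; exists 0.
apply: (@le_trans _ _ (leb ((fun y => G y *m T) @` (F @` E)))).
  apply: le_leb => _ [x Ex <-]; exists (F x); first by exists x.
  have [EG FG] := GP (F x) (ex_intro2 _ _ x Ex erefl).
  have := low _ _ EG Ex; rewrite FG subrr normr0 mulr0 normr_le0 mulmxBl subr_eq0.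
  by move=> /eqP.
apply: leb_lipschitz; first by rewrite invr_gt0.
move=> y z Fy Fz; have [EGy FGy] := GP _ Fy; have [EGz FGz] := GP _ Fz.
by rewrite -mulmxBl (le_trans (low _ _ EGy EGz))// FGy FGz.
Qed.

(** Compact parts of [Q] have compact images, by continuity on [Q]; the null remainder has a null
    image by condition N. *)
Lemma measurable_image_lipschitz (Q : set Rk) (C : R) :
  (forall M, M `<=` Om -> leb M = 0%E -> leb (F @` M) = 0%E) ->
  measurable (Q : set X) -> Q `<=` Om ->
  (forall x y, Q x -> Q y -> `|F x - F y| <= C * `|x - y|) -> 0 < C ->
  measurable (F @` Q : set X).
Proof.
move=> luzin mQ QOm QC C0.
have [K [cK KQ K0]] := measurable_sigma_compact mQ.
have -> : F @` Q = (\bigcup_p F @` K p) `|` F @` (Q `\` \bigcup_p K p).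
  rewrite -image_bigcup -image_setU; congr (_ @` _).
  apply/seteqP; split => x; last by case=> [[p _ /KQ]|[]].
  by move=> Qx; have [] := pselect ((\bigcup_p K p) x); [left|right].
apply: measurableU; last first.
  by apply: null_measurable; apply: luzin => // x [/QOm].
apply: countable_bigcupT_measurable; first exact: countableP.
move=> p; have cF : compact (F @` K p).
  apply: continuous_compact; last exact: cK.
  apply/subspace_continuousP => x Kx; apply/cvgrPdist_lt => e e0.
  rewrite near_withinE; apply/nbhs_ballP; exists (e / C); first by rewrite /= divr_gt0.
  move=> y; rewrite -ball_normE/= => xy Ky.
  have := QC _ _ (KQ _ _ Kx) (KQ _ _ Ky) => /le_lt_trans; apply.
  by rewrite mulrC -ltr_pdivlMr.
rewrite -[X in measurable X]setCK; apply: measurableC; apply: measurable_open_rV.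
by rewrite openC; apply: compact_closed => //; exact: norm_hausdorff.
Qed.

(** A piece is a fat set for a rational matrix, tolerance and scale, localized in a cell and
    enlarged to a measurable set. Every point with invertible approximate differential lies in a
    piece whose matrix is close to that differential. *)
Lemma linear_pieces (kap : R) : 0 < kap < 1 ->
  exists PT : nat -> set Rk * Mk, [/\ forall i, measurable ((PT i).1 : set X),
    forall i, (PT i).1 `<=` Om, forall i, (PT i).2 \in unitmx,
    forall i x y, (PT i).1 x -> (PT i).1 y ->
      `|F x - F y - (x - y) *m (PT i).2| <= kap * `|(x - y) *m (PT i).2| &
    forall x S, Om x -> approx_diff Om F S x -> \det S != 0 ->
      exists2 i, (PT i).1 x & `|\det S| <= (1 + kap) ^+ k.+1 * `|\det (PT i).2|].
Proof.
move=> /andP[kap0 kap1].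
have u1 : (1%:M : Mk) \in unitmx by exact: unitmx1.
(* If the unit ball is null, no approximate differential exists and empty pieces do. *)
have [v0|nv0] := pselect (0 < leb (eball (0 : Rk) 1))%E; last first.
  exists (fun=> (set0, 1%:M)); split; first by move=> i; exact: measurable0.
  - by move=> i x.
  - by move=> i; exact: u1.
  - by move=> i x y.
  - by move=> x S _ /approx_diff_eball_gt0.
pose I : countType := ('M[rat]_k.+1 * nat * nat * 'rV[rat]_k.+1)%type.
pose T (i : I) : Mk := map_mx ratr i.1.1.1.
pose e (i : I) : R := i.1.1.2.+1%:R^-1.
pose d (i : I) : R := i.1.2.+1%:R^-1.
have e0 i : 0 < e i by rewrite invr_gt0.
have d0 i : 0 < d i by rewrite invr_gt0.
(* Any two points of a cell are close enough for [fat_lipschitz]. *)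
pose cell (i : I) : set Rk := [set x | 2 * k.+1%:R * `|x - map_mx ratr i.2| < d i / 2].
(* Admissibility turns the absolute error [3 * e * |u|] into the relative error [kap * |u T|] and
   forces [T] to be injective. *)
pose adm (i : I) := forall u, 3 * e i * `|u| <= kap * `|u *m T i|.
have adm_unit i : adm i -> T i \in unitmx.
  move=> ai; rewrite -row_free_unit; apply: inj_row_free => u uT0.
  have := ai u; rewrite uT0 normr0 mulr0 pmulr_rle0 ?mulr_gt0//.
  by rewrite normr_le0 => /eqP.
have /choice[Q QP] (i : I) : exists Q : set Rk, [/\ measurable (Q : set X), Q `<=` Om,
    adm i -> fat Om F (T i) (e i) (d i) `&` cell i `<=` Q &
    (exists x, Q x) -> adm i /\ forall x y, Q x -> Q y ->
      `|F x - F y - (x - y) *m T i| <= kap * `|(x - y) *m T i|].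
  have [ai|nai] := pselect (adm i); last first.
    by exists set0; split; [exact: measurable0|by move=> x|by []|by case].
  have e30 : 0 <= 3 * e i by rewrite mulr_ge0// ltW.
  have [||Q [mQ PQ QOm Qlip]] := @lipschitz_enlarge _ _ Om F oOm mF (T i) (3 * e i)
      (fat Om F (T i) (e i) (d i) `&` cell i) e30.
  - by move=> x [[]].
  - move=> x y [fx cx] [fy cy]; apply: (fat_lipschitz v0 (ltW (e0 i)) fx fy).
    move: cx cy; rewrite /cell/= => cx cy.
    have := ler_distD (map_mx ratr i.2) x y; rewrite (distrC (map_mx _ _)) => xy.
    rewrite (le_lt_trans (ler_wpM2l _ xy)) ?mulr_ge0//.
    by rewrite mulrDr [ltRHS]splitr ltrD.
  - exists Q; split => // _; split => // x y Qx Qy.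
    exact: le_trans (Qlip _ _ Qx Qy) (ai _).
exists (fun n => if unpickle n is Some i then (Q i, if `[< adm i >] then T i else 1%:M) else (set0, 1%:M)).
split.
- move=> n; case: unpickle => [i|]; last exact: measurable0.
  by have [] := QP i.
- by move=> n; case: unpickle => [i|]//; have [] := QP i.
- by move=> n; case: unpickle => //= i; case: asboolP => // /adm_unit.
- move=> n x y; case: unpickle => //= i Qx Qy.
  have [_ _ _ /(_ (ex_intro _ x Qx))[ai h]] := QP i.
  by case: asboolP => // _; exact: h.
move=> x S Ox dS detS.
have uS : S \in unitmx by rewrite unitmxE unitfE.
have [C C0 hC] := norm_mulmx_bound (invmx S).
have lowS u : `|u| <= C * `|u *m S| by rewrite -{1}(mulmxK uS u).
(* The choice ensures [4 ep |u| <= kap |u S|]. Replacing [S] by a rational matrix within [ep / 2]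
   costs at most [ep |u| / 2], so that [3 ep |u| <= kap |u T|] survives. *)
have /ltr_add_invr[p] : 0 < kap / (4 * C) by rewrite divr_gt0// mulr_gt0.
rewrite add0r => hp; set ep : R := p.+1%:R^-1 in hp.
have ep0 : 0 < ep by rewrite invr_gt0.
have epC : ep * (4 * C) < kap by rewrite -ltr_pdivlMr// mulr_gt0.
have /choice[q qP] (ij : 'I_k.+1 * 'I_k.+1) : exists q : rat, `|S ij.1 ij.2 - ratr q| <= ep / 2 / k.+1%:R.
  have m0 : 0 < ep / 2 / k.+1%:R by rewrite !divr_gt0.
  have /rat_in_itvoo[q] : S ij.1 ij.2 - ep / 2 / k.+1%:R < S ij.1 ij.2 + ep / 2 / k.+1%:R.
    by rewrite ltrBlDr -addrA ltrDl addr_gt0.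
  rewrite in_itv/= => /andP[q1 q2]; exists q.
  by rewrite distrC ler_distl !ltW.
pose Tq : 'M[rat]_k.+1 := \matrix_(i, j) q (i, j).
have ST u : `|u *m (S - map_mx ratr Tq)| <= ep / 2 * `|u|.
  apply: (@le_trans _ _ (k.+1%:R * (ep / 2 / k.+1%:R) * `|u|)).
    apply: norm_mulmx_le; first by rewrite !divr_ge0// ltW.
    by move=> i j; rewrite !mxE; exact: (qP (i, j)).
  by rewrite [k.+1%:R * _]mulrC divfK// pnatr_eq0.
have [dd dd0 hdd] := approx_diff_fat oOm mF Ox dS ep0 ST.
have /ltr_add_invr[m] := dd0; rewrite add0r => /ltW hm.
have m0 : 0 < m.+1%:R^-1 / 2 / (2 * k.+1%:R) / 2 :> R by rewrite !divr_gt0// ?mulr_gt0// invr_gt0.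
have /choice[qc qcP] (i : 'I_k.+1) : exists q : rat, `|x 0 i - ratr q| <= m.+1%:R^-1 / 2 / (2 * k.+1%:R) / 2.
  have /rat_in_itvoo[q'] : x 0 i - m.+1%:R^-1 / 2 / (2 * k.+1%:R) / 2 <
      x 0 i + m.+1%:R^-1 / 2 / (2 * k.+1%:R) / 2.
    by rewrite ltrBlDr -addrA ltrDl addr_gt0.
  rewrite in_itv/= => /andP[q1 q2]; exists q'.
  by rewrite distrC ler_distl !ltW.
pose i : I := (Tq, p, m, \row_j qc j).
have key u : 3 * ep * `|u| <= kap * `|u *m T i| /\ `|u *m S| <= (1 + kap) * `|u *m T i|.
  have h1 := lowS u; have h2 := ST u; have u0 := normr_ge0 u.
  have h3 : `|u *m S| <= `|u *m T i| + ep / 2 * `|u|.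
    have -> : u *m S = u *m T i + u *m (S - T i) by rewrite -mulmxDr addrC subrK.
    by rewrite (le_trans (ler_normD _ _))// lerD2l.
  have h4 : `|u| * ep * 4 <= kap * `|u *m S|.
    have : ep * 4 * `|u| <= ep * 4 * (C * `|u *m S|) by rewrite ler_wpM2l// mulr_ge0// ltW.
    have : ep * (4 * C) * `|u *m S| <= kap * `|u *m S| by rewrite ler_wpM2r// ltW.
    lra.
  have h5 : kap * `|u *m S| <= kap * (`|u *m T i| + ep / 2 * `|u|) by rewrite ler_wpM2l// ltW.
  have h6 : kap * (ep / 2 * `|u|) <= ep / 2 * `|u|.
    by rewrite ler_piMl ?(ltW kap1)// mulr_ge0// divr_ge0// ltW.
  have h7 : 0 <= ep * `|u| by rewrite mulr_ge0// ltW.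
  by split; lra.
have ai : adm i by move=> u; exact: (key u).1.
have uT := adm_unit _ ai.
exists (pickle i); rewrite pickleK/=.
  have [_ _ /(_ ai) + _] := QP i; apply; split; first exact: hdd.
  rewrite /cell/= mulrC -ltr_pdivlMr ?mulr_gt0//.
  apply: (@le_lt_trans _ _ (m.+1%:R^-1 / 2 / (2 * k.+1%:R) / 2)).
    by apply/rV_norm_le => [|j]; [exact: ltW|rewrite !mxE; exact: qcP].
  by rewrite ltr_pdivrMr// ltr_pMr ?ltr1n// !divr_gt0// ?mulr_gt0// invr_gt0.
case: asboolP => // _.
(* Factor [S] as [T] times [T^-1 S]; the second factor stretches by at most [1 + kap]. *)
rewrite -{1}(mulKVmx uT S) det_mulmx normrM mulrC ler_wpM2r//.
apply: det_le_lipschitz => //.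
- by rewrite unitmx_mul unitmx_inv uT.
- by rewrite addr_gt0.
- move=> u; rewrite mulmxA; have := (key (u *m invmx (T i))).2.
  by rewrite mulmxKV.
Qed.

End pieces.

(** * The area inequality for one map *)

Section area.
Context {R : realType} {k : nat}.
Local Notation Rk := 'rV[R]_k.+1.
Local Notation Mk := 'M[R]_k.+1.
Local Notation X := (caratheodory_type (@leb R k)).
Implicit Types (x y u : Rk) (A B : set Rk) (S T : Mk).
Variables (Om : set Rk).
Hypotheses (oOm : open Om).

(** Measurability of [F] speaks of preimages of open sets. Compact subsets of [B] are closed and
    exhaust it up to a null set, whose preimage is null. *)
Lemma measurable_preimage (F : Rk -> Rk) B : lmeas_fun Om F ->
  (forall M, leb M = 0%E -> leb (Om `&` F @^-1` M) = 0%E) ->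
  measurable (B : set X) -> measurable (Om `&` F @^-1` B : set X).
Proof.
move=> mF nF mB; have [C [cC CB C0]] := measurable_sigma_compact mB.
rewrite (_ : Om `&` F @^-1` B = (\bigcup_p (Om `&` F @^-1` C p)) `|`
    (Om `&` F @^-1` (B `\` \bigcup_p C p))); last first.
  apply/seteqP; split => x.
    move=> [Ox Bx]; have [[p _ Cx]|nC] := pselect ((\bigcup_p C p) (F x)); last by right.
    by left; exists p.
  by move=> [[p _ [Ox /CB Bx]]|[Ox []]].
apply: measurableU; last by apply: null_measurable; exact: nF.
apply: countable_bigcupT_measurable; first exact: countableP.
move=> p; rewrite (_ : _ `&` _ = Om `\` (Om `&` F @^-1` (~` C p))); last first.
  apply/seteqP; split => x; first by move=> [Ox Cx]; split => // -[].
  by move=> [Ox h]; split => //; apply: contrapT => nC; apply: h.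
apply: measurableD; first exact: measurable_open_rV.
apply: mF; rewrite openC; apply: compact_closed => //; exact: norm_hausdorff.
Qed.

(** Each piece is cut down to the points where [gam] is at most the constant [cc i], a measurable
    replacement for the comparison with the Jacobian. On disjoint pieces [leb_piece_ge] then trades
    the determinant for the measure of the image. *)
Lemma area_pieces (F : Rk -> Rk) (gam : Rk -> R) (c kap : R) : lmeas_fun Om F ->
  (forall M, M `<=` Om -> leb M = 0%E -> leb (F @` M) = 0%E) ->
  (forall M, leb M = 0%E -> leb (Om `&` F @^-1` M) = 0%E) ->
  measurable_fun (Om : set X) (gam : X -> R) -> (forall x, 0 <= gam x) ->
  leb (Om `&` [set x | ~ gam x <= c * `|Jac Om F x|]) = 0%E -> 0 <= c -> 0 < kap < 1 ->
  exists Q : nat -> set Rk, [/\ trivIset setT Q, forall j, Q j `<=` Om,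
    forall j, measurable (F @` Q j : set X) &
    forall B, measurable (B : set X) ->
      (\int[@lebX R k]_(x in Om `&` F @^-1` B) (gam x)%:E <=
       \sum_(j <oo) (c * ((1 + kap) / (1 - kap)) ^+ k.+1)%:E * leb (B `&` F @` Q j))%E].
Proof.
move=> mF luzin nF mgam gam0 Z0 c0 kap01; have /andP[kap0 kap1] := kap01.
have [PT [mP POm uT Plip Pcov]] := linear_pieces oOm mF kap01.
pose cc i := c * ((1 + kap) ^+ k.+1 * `|\det (PT i).2|).
have k0 : 0 < 1 + kap by rewrite addr_gt0.
have k1 : 0 < 1 - kap by rewrite subr_gt0.
have cc0 i : 0 <= cc i by rewrite !mulr_ge0// exprn_ge0// ltW.
have mOm : measurable (Om : set X) by exact: measurable_open_rV.
pose P' i : set X := (PT i).1 `&` (Om `&` [set x | gam x <= cc i]).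
have mP' i : measurable (P' i).
  apply: measurableI; first exact: mP.
  by apply: (measurable_fun_le mOm mgam); exact: measurable_cst.
pose Q := seqDU P'.
have mQ i : measurable (Q i).
  by apply: measurableD => //; apply: bigsetU_measurable => j _; exact: mP'.
have QP i : Q i `<=` P' i by move=> x [].
have QOm i : Q i `<=` Om by move=> x /QP[_ []].
have Qlip i x y : Q i x -> Q i y -> `|F x - F y - (x - y) *m (PT i).2| <= kap * `|(x - y) *m (PT i).2|.
  by move=> /QP[Px _] /QP[Py _]; exact: Plip.
exists Q; split => //.
- exact: trivIset_seqDU.
- move=> j; have [C C0 hC] := norm_mulmx_bound (PT j).2.
  apply: (@measurable_image_lipschitz _ _ Om F (Q j) ((1 + kap) * C)) => //.
    move=> x y Qx Qy; have h1 := Qlip j x y Qx Qy; have h2 := hC (x - y).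
    have h3 := ler_normD (F x - F y - (x - y) *m (PT j).2) ((x - y) *m (PT j).2).
    rewrite subrK in h3.
    rewrite -mulrA; apply: le_trans (ler_wpM2l (ltW k0) h2).
    by rewrite (le_trans h3)// mulrDl mul1r addrC lerD2l.
  by rewrite mulr_gt0.
move=> B mB.
have mE := measurable_preimage mF nF mB.
set E : set X := Om `&` F @^-1` B in mE *.
have mgamE (D : set X) : D `<=` Om -> measurable_fun D (fun x => (gam x)%:E).
  move=> DOm; apply/measurable_EFinP; apply: measurable_funS DOm mgam.
  exact: mOm.
have gE0 (D : set X) x : D x -> (0 <= (gam x)%:E)%E by rewrite lee_fin.
set U : set X := \bigcup_j Q j.
have mU : measurable U by apply: bigcup_measurable => j _; exact: mQ.
have mEU : measurable (E `&` U) by exact: measurableI.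
have mEDU : measurable (E `\` U) by exact: measurableD.
have EOm : E `<=` Om by move=> x [].
(* Off the pieces [gam] vanishes almost everywhere: [0 < gam x <= c |J|] gives a nonzero Jacobian,
   hence an invertible approximate differential and a piece containing [x]. *)
have int_out : (\int[@lebX R k]_(x in E `\` U) (gam x)%:E = 0)%E.
  set Z := Om `&` [set x | ~ gam x <= c * `|Jac Om F x|] in Z0.
  have mZ : measurable (Z : set X) by exact: null_measurable.
  have mg : measurable_fun (E `\` U) (fun x => (gam x)%:E) by apply: mgamE => x [/EOm].
  rewrite (@ge0_negligible_integral _ _ _ (@lebX R k) _ Z _ mZ mEDU mg (gE0 _) Z0).
  apply: integral0_eq => x [[Ex nUx] nZx]; congr EFin; apply/eqP.
  rewrite eq_le gam0 andbT leNgt; apply/negP => gx.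
  have Ox := EOm _ Ex.
  have gJ : gam x <= c * `|Jac Om F x|.
    by apply: contrapT => h; apply: nZx.
  have J0 : Jac Om F x != 0.
    by apply: contraTneq gJ => ->; rewrite normr0 mulr0 -ltNge.
  move: gJ J0; rewrite /Jac; case: pselect => [h|]; last by rewrite eqxx.
  move=> gJ J0; have [i Pix Si] := Pcov x _ Ox (projT2 (cid h)) J0.
  apply: nUx; rewrite /U /Q -seqDU_bigcup_eq; exists i => //; split => //; split => //=.
  by rewrite (le_trans gJ)// ler_wpM2l.
have dEU : [disjoint E `&` U & E `\` U].
  by rewrite disj_set2E; apply/eqP/seteqP; split => x // -[[_ Ux] [_ nUx]].
have mgU : measurable_fun ((E `&` U) `|` (E `\` U)) (fun x => (gam x)%:E).
  by rewrite setUIDK; exact: mgamE.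
rewrite -{1}(setUIDK E U) (ge0_integral_setU _ mEU mEDU mgU (gE0 _) dEU).
rewrite int_out adde0 (_ : E `&` U = \bigcup_j (E `&` Q j)); last by rewrite setI_bigcupr.
rewrite ge0_integral_bigcup; [|by move=> j; exact: measurableI
  |by apply: mgamE => x [j _ [/EOm]]|exact: gE0|]; last first.
  apply/trivIsetP => i j _ _ ij; apply/seteqP; split => x // -[[_ Qi] [_ Qj]].
  have /trivIsetP/(_ i j Logic.I Logic.I ij)/seteqP[/(_ x)] := trivIset_seqDU P'.
  by move=> h _; apply: h; split.
apply: lee_nneseries => j _; first by move=> _; apply: integral_ge0 => x _; rewrite lee_fin.
have mEQ : measurable (E `&` Q j) by exact: measurableI.
apply: (@le_trans _ _ (\int[@lebX R k]_(x in E `&` Q j) (cst (cc j)%:E) x)%E).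
  apply: ge0_le_integral.
  - exact: mEQ.
  - exact: gE0.
  - by apply: mgamE => x [/EOm].
  - exact: measurable_cst.
  - by move=> x [_ /QP[_ [_ gx]]]; rewrite lee_fin.
rewrite integral_cst//.
have Elip x y : (E `&` Q j) x -> (E `&` Q j) y ->
    `|F x - F y - (x - y) *m (PT j).2| <= kap * `|(x - y) *m (PT j).2|.
  by move=> [_ Qx] [_ Qy]; exact: Qlip.
have := leb_piece_ge kap01 (uT j) Elip.
have -> : F @` (E `&` Q j) = B `&` F @` Q j.
  apply/seteqP; split => [_ [x [[Ox Bx] Qx] <-]|y [By [x Qx xE]]].
    by split => //; exists x.
  by exists x => //; split => //; split; [exact: QOm Qx|rewrite /= xE].
move=> h; rewrite /cc mulrA EFinM -muleA.
rewrite exprMn mulrA [X in (_ <= X * _)%E]EFinM -muleA.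
apply: lee_wpmul2l; last exact: h.
by rewrite lee_fin mulr_ge0// exprn_ge0// ltW.
Qed.

(** A point in the images of [K + 1] disjoint pieces would have [K + 1] distinct preimages. *)
Lemma truncated_count (J : nat -> set Rk) (F : Rk -> Rk) (K m : nat) y :
  trivIset setT J -> (forall j, J j `<=` Om) ->
  ~ (exists s : seq Rk, [/\ uniq s, size s = K.+1 & forall x, x \in s -> Om x /\ F x = y]) ->
  (\sum_(j < m) (\1_(F @` J j) y : R) <= K%:R)%R.
Proof.
move=> tJ JOm noS.
have -> : \sum_(j < m) (\1_(F @` J j) y : R) = (count (fun j => y \in F @` J j) (iota 0 m))%:R.
  rewrite -(big_mkord xpredT (fun j => \1_(F @` J j) y)) -sum1_count natr_sum [RHS]big_mkcond/=.
  rewrite /index_iota subn0; apply: eq_bigr => j _.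
  by rewrite indicE; case: (_ \in _).
rewrite ler_nat leqNgt; apply/negP => Klt; apply: noS.
pose js := [seq j <- iota 0 m | y \in F @` J j].
have /choice[g gP] j : exists x, y \in F @` J j -> J j x /\ F x = y.
  have [|] := boolP (y \in F @` J j); last by exists 0.
  by rewrite inE => -[x Jx xy]; exists x.
have gJ j : j \in js -> J j (g j) /\ F (g j) = y by rewrite mem_filter => /andP[/gP].
exists (take K.+1 (map g js)); split.
- apply: take_uniq; rewrite map_inj_in_uniq ?filter_uniq ?iota_uniq//.
  move=> i j /gJ[Ji _] /gJ[Jj _] gij; apply: contrapT => /eqP ij.
  have := tJ => /trivIsetP/(_ i j Logic.I Logic.I ij)/seteqP[+ _] => /(_ (g i)).
  by apply; split => //; rewrite gij.
- by rewrite size_takel// size_map size_filter.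
- move=> x /mem_take/mapP[j /gJ[Jj Fj] ->]; split => //; exact: JOm Jj.
Qed.

End area.

(** * Multiplicities of several maps *)

Section multiplicity.
Context {R : realType} {k : nat}.
Local Notation Rk := 'rV[R]_k.+1.
Local Notation X := (caratheodory_type (@leb R k)).
Variables (N : nat) (Om : set Rk) (f : 'I_N -> Rk -> Rk) (K : nat).
Hypotheses (oOm : open Om) (fOm : forall n x, Om x -> Om (f n x)).
Hypotheses (mf : forall n, lmeas_fun Om (f n)).
Hypothesis (luzin : forall n M, M `<=` Om -> leb M = 0%E -> leb (f n @` M) = 0%E).
Hypothesis (nullf : forall n M, leb M = 0%E -> leb (Om `&` f n @^-1` M) = 0%E).
Hypothesis (fK : forall n, leb [set x | Om x /\ exists s : seq Rk,
       [/\ uniq s, size s = K.+1 & forall y, y \in s -> Om y /\ f n y = x]] = 0%E).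
Let L := Lconst Om f.

Definition overlap : set Rk := \bigcup_(S : {set 'I_N})
  (if (L < #|S|)%N then \bigcap_(n in [set n | n \in S]) (f n @` Om) else set0).

(** More than [L] ranges meeting in positive measure would contradict the maximum in [Lconst], and
    there are finitely many families of ranges. *)
Lemma overlap_null : leb overlap = 0%E.
Proof.
apply: null_bigcup_count => S; case: ifPn => [LS|_]; last exact: leb0.
apply/eqP; rewrite eq_le leb_ge0 andbT leNgt; apply/negP => S0.
move: LS; rewrite ltnNge; apply/negP; rewrite negbK.
by apply: (@leq_bigmax_cond _ _ (fun S : {set 'I_N} => #|S|)); apply/asboolP.
Qed.

Lemma overlap_count y : ~ overlap y -> (#|[set n | `[< (f n @` Om) y >]]%SET| <= L)%N.
Proof.
move=> no; rewrite leqNgt; apply/negP => LS; apply: no.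
exists [set n | `[< (f n @` Om) y >]]%SET => //; rewrite LS => n /=.
by rewrite inE => /asboolP.
Qed.

Variables (gam : 'I_N -> Rk -> R) (alpha : R).
Hypotheses (mgam : forall n, measurable_fun (Om : set X) (gam n : X -> R)).
Hypotheses (gam0 : forall n x, 0 <= gam n x) (alpha0 : 0 <= alpha).
Hypothesis gamJ : forall n, leb (Om `&` [set x | ~ gam n x <=
  alpha / (K * L)%:R * `|Jac Om (f n) x|]) = 0%E.

(** Almost every point lies in at most [L] ranges, and in at most [K] images of pieces for each of
    them. The images thus overlap at most [K * L] times, which cancels the denominator of [c]. *)
Lemma area_bound_approx B (kap : R) : measurable (B : set X) -> 0 < kap < 1 ->
  (\sum_n \int[@lebX R k]_(x in Om `&` f n @^-1` B) (gam n x)%:E <=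
   (alpha * ((1 + kap) / (1 - kap)) ^+ k.+1)%:E * leb B)%E.
Proof.
move=> mB kap01; have /andP[kap0 kap1] := kap01.
have gJ := gamJ; set c := alpha / (K * L)%:R in gJ.
have c0 : 0 <= c by rewrite divr_ge0.
set rho := ((1 + kap) / (1 - kap)) ^+ k.+1.
have rho0 : 0 <= rho.
  by apply: exprn_ge0; apply: divr_ge0; [rewrite addr_ge0// ltW|rewrite subr_ge0 ltW].
have /choice[Q QP] n : exists Q : nat -> set Rk, [/\ trivIset setT Q, forall j, Q j `<=` Om,
    forall j, measurable (f n @` Q j : set X) &
    forall B, measurable (B : set X) ->
      (\int[@lebX R k]_(x in Om `&` f n @^-1` B) (gam n x)%:E <=
       \sum_(j <oo) (c * rho)%:E * leb (B `&` f n @` Q j))%E].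
  by apply: area_pieces => //; [exact: luzin|exact: nullf].
have mD n j : measurable (f n @` Q n j : set X) by have [] := QP n.
apply: (@le_trans _ _ (\sum_n \sum_(j <oo) (c * rho)%:E * leb (B `&` f n @` Q n j))%E).
  by apply: lee_sum => n _; have [_ _ _] := QP n; apply.
have crho0 : (0 <= (c * rho)%:E)%E by rewrite lee_fin mulr_ge0.
have indD n j : leb (B `&` f n @` Q n j) = (\int[@lebX R k]_(x in B) (\1_(f n @` Q n j) x)%:E)%E.
  by rewrite integral_indic// setIC.
have mind n j : measurable_fun (B : set X) (fun x : X => (\1_(f n @` Q n j) x)%:E : \bar R).
  by apply/measurable_EFinP; apply: measurable_indic; exact: mD.
have i0 n j x : (0 <= (\1_(f n @` Q n j) x)%:E :> \bar R)%E by rewrite lee_fin.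
have -> : (\sum_n \sum_(j <oo) (c * rho)%:E * leb (B `&` f n @` Q n j) =
  (c * rho)%:E * \int[@lebX R k]_(x in B) (\sum_n \sum_(j <oo) (\1_(f n @` Q n j) x)%:E))%E.
  rewrite ge0_integral_sum//; last 2 first.
  - by move=> n; apply: ge0_emeasurable_sum.
  - by move=> n x _; apply: nneseries_ge0.
  rewrite ge0_sume_distrr; last by move=> n _; apply: integral_ge0 => x _; apply: nneseries_ge0.
  apply: eq_bigr => n _; rewrite nneseriesZl//; last by move=> j _; exact: leb_ge0.
  by rewrite integral_nneseries//; congr (_ * _)%E; apply: eq_eseriesr => j _.
apply: (@le_trans _ _ ((c * rho)%:E * \int[@lebX R k]_(x in B) (cst (K * L)%:R%:E) x)%E).
  apply: lee_wpmul2l => //.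
  apply: ae_ge0_le_integral.
  - exact: mB.
  - by move=> x _; apply: sume_ge0 => n _; apply: nneseries_ge0.
  - by apply: emeasurable_sum => n; apply: ge0_emeasurable_sum.
  - by move=> x _; rewrite lee_fin.
  - exact: measurable_cst.
  - exists (overlap `|` \bigcup_n [set x | Om x /\ exists s : seq Rk,
       [/\ uniq s, size s = K.+1 & forall y, y \in s -> Om y /\ f n y = x]]).
    have nullZ : leb (overlap `|` \bigcup_n [set x | Om x /\ exists s : seq Rk,
       [/\ uniq s, size s = K.+1 & forall y, y \in s -> Om y /\ f n y = x]]) = 0%E.
      by apply: null_setU; [exact: overlap_null|exact: null_bigcup_count].
    split => //; first exact: null_measurable.
    move=> y /= /not_implyP[By hy]; apply: contrapT => /not_orP[no nb]; apply: hy.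
    apply: (@le_trans _ _ (\sum_(n < N) (if `[< (f n @` Om) y >] then K%:R else 0)%:E)%E).
      apply: lee_sum => n _; have [tQ QOm _ _] := QP n.
      case: asboolP => fy; last first.
        rewrite eseries0// => j _ _; rewrite indicE memNset// => -[x /QOm Ox xy].
        by apply: fy; exists x.
      apply: lime_le; first by apply: is_cvg_nneseries.
      apply: nearW => m; rewrite sumEFin lee_fin big_mkord.
      have := @truncated_count _ _ Om (Q n) (f n) K m y tQ QOm; apply => hs.
      apply: nb; exists n => //; split => //.
      by case: fy => x Ox <-; exact: fOm.
    rewrite sumEFin lee_fin -big_mkcond/= sumr_const -[leLHS]mulr_natr -natrM ler_nat.
    rewrite leq_mul2l; apply/orP; right.
    apply: leq_trans (overlap_count no); apply: eq_leq.
    by apply: eq_card => n; rewrite !inE.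
rewrite integral_cst// muleA -EFinM; apply: lee_wpmul2r; first exact: leb_ge0.
rewrite lee_fin mulrAC ler_wpM2r// /c.
(* Division by 0 yields 0, so the left side vanishes when [K * L = 0]. *)
have [->|KL0] := eqVneq (K * L)%N 0%N; first by rewrite mulr0.
by rewrite divfK// pnatr_eq0.
Qed.

Lemma area_bound B : measurable (B : set X) ->
  (\sum_n \int[@lebX R k]_(x in Om `&` f n @^-1` B) (gam n x)%:E <= alpha%:E * leb B)%E.
Proof.
move=> mB; set I := (\sum_n _)%E.
have I0 : (0 <= I)%E.
  by apply: sume_ge0 => n _; apply: integral_ge0 => x _; rewrite lee_fin.
(* For [kap = 1 / (m + 2)] the ratio [(1 + kap) / (1 - kap)] equals [1 + 2 / (m + 1)], the shape
   expected by [le_prod_limit]. *)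
have bnd (m : nat) : (I <= (alpha * \prod_(i < k.+1) (1 + 2 / m.+1%:R))%:E * leb B)%E.
  have kap01 : 0 < (m.+2%:R^-1 : R) < 1 by rewrite invr_gt0 ltr0n/= invf_lt1// ltr1n.
  have := area_bound_approx mB kap01; rewrite prodr_const card_ord.
  suff -> : (1 + m.+2%:R^-1) / (1 - m.+2%:R^-1) = 1 + 2 / m.+1%:R :> R by [].
  have m1 : m.+1%:R != 0 :> R by rewrite pnatr_eq0.
  have -> : m.+2%:R = m.+1%:R + 1 :> R by rewrite natr1.
  have m2 : m.+1%:R + 1 != 0 :> R by rewrite natr1 pnatr_eq0.
  by move: (m.+1%:R : R) m1 m2 => t t0 t1; field; rewrite ?t0 ?t1.
have [a0|a0] := eqVneq alpha 0; first by have := bnd 0%N; rewrite a0 mul0r.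
have alpha_gt0 : 0 < alpha by rewrite lt0r a0.
have [By|] := eqVneq (leb B) +oo%E; first by rewrite By gt0_muley ?leey// lte_fin.
rewrite -ltey => Bfin; have {}Bfin : leb B \is a fin_num by rewrite ge0_fin_numE ?leb_ge0.
have [B0|B0] := eqVneq (leb B) 0%E; first by have := bnd 0%N; rewrite B0 !mule0.
set be := fine (leb B); have beE : leb B = be%:E by rewrite fineK.
have be0 : 0 < be by rewrite fine_gt0// lt0e B0 leb_ge0/= -ge0_fin_numE ?leb_ge0.
have ab0 : 0 < alpha * be by rewrite mulr_gt0.
have : (((alpha * be)^-1)%:E * I <= (\prod_(i < k.+1) (1 : R))%:E)%E.
  apply: (@le_prod_limit _ _ _ _ (fun=> 2)) => m.
  have := bnd m; rewrite beE -EFinM mulrAC => h.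
  rewrite (le_trans (lee_wpmul2l _ h)) ?lee_fin ?invr_ge0 ?(ltW ab0)//.
  by rewrite mulrA mulVf ?mul1r// gt_eqF.
rewrite big1// => h.
have := lee_wpmul2l _ h => /(_ (alpha * be)%:E); rewrite lee_fin (ltW ab0) => /(_ isT).
by rewrite muleA -EFinM mulfV ?gt_eqF// mul1e mule1 EFinM -beE.
Qed.

End multiplicity.

(** * Vector-valued measurable functions *)

Section scalars.
Context {R : realType} {b : bool}.
Local Notation KK := (Kof R b).
Implicit Types (z w : KK) (r s : R).

(** Norms over the complex scalars live in [R[i]], where the order is partial; [RtoK] and [KtoR]
    move them to and from the reals. *)
Definition RtoK (r : R) : Kof R b :=
  match b return Kof R b with true => (r%:C)%C | false => r end.

Lemma RtoKK z : 0 <= z -> RtoK (KtoR z) = z.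
Proof.
rewrite /RtoK /KtoR; move: z; rewrite /Kof; case: b => //= z.
by move=> z0; apply: RRe_real; exact: ger0_real.
Qed.

Lemma KtoRK r : KtoR (RtoK r) = r.
Proof. by rewrite /RtoK /KtoR; case: b. Qed.

Lemma ler_RtoK r s : (RtoK r <= RtoK s) = (r <= s).
Proof. by rewrite /RtoK; case: b => //; rewrite lecR. Qed.

Lemma ltr_RtoK r s : (RtoK r < RtoK s) = (r < s).
Proof. by rewrite /RtoK; case: b => //; rewrite ltcR. Qed.

Lemma RtoK0 : RtoK 0 = 0.
Proof. by rewrite /RtoK; case: b. Qed.

Lemma RtoKD r s : RtoK (r + s) = RtoK r + RtoK s.
Proof. by rewrite /RtoK; case: b => //; rewrite rmorphD. Qed.

Lemma RtoKM r s : RtoK (r * s) = RtoK r * RtoK s.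
Proof. by rewrite /RtoK; case: b => //; rewrite rmorphM. Qed.

Variable V : normedModType KK.
Implicit Types u v : V.

Lemma VnormE v : `|v| = RtoK (Vnorm v).
Proof. by rewrite /Vnorm RtoKK. Qed.

Lemma Vnorm_ge0 v : 0 <= Vnorm v.
Proof. by rewrite -ler_RtoK -VnormE RtoK0. Qed.

Lemma KnormE z : `|z| = RtoK (Knorm z).
Proof. by rewrite /Knorm RtoKK. Qed.

Lemma Knorm_ge0 z : 0 <= Knorm z.
Proof. by rewrite -ler_RtoK -KnormE RtoK0. Qed.

Lemma VnormD u v : Vnorm (u + v) <= Vnorm u + Vnorm v.
Proof. by rewrite -ler_RtoK RtoKD -!VnormE ler_normD. Qed.

Lemma VnormZ z v : Vnorm (z *: v) = Knorm z * Vnorm v.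
Proof. by rewrite -[LHS]KtoRK -VnormE normrZ VnormE KnormE -RtoKM KtoRK. Qed.

Lemma VnormN v : Vnorm (- v) = Vnorm v.
Proof. by rewrite /Vnorm normrN. Qed.

Lemma Vnorm0 : Vnorm (0 : V) = 0.
Proof. by rewrite -[LHS]KtoRK -VnormE normr0 -RtoK0 KtoRK. Qed.

Lemma Vnorm_sum I (s : seq I) (P : pred I) (F : I -> V) :
  Vnorm (\sum_(i <- s | P i) F i) <= \sum_(i <- s | P i) Vnorm (F i).
Proof.
elim/big_ind2: _ => [|u1 r1 u2 r2 h1 h2|//]; first by rewrite Vnorm0.
by rewrite (le_trans (VnormD _ _))// lerD.
Qed.

Lemma Vnorm_dist u v : `|Vnorm u - Vnorm v| <= Vnorm (u - v).
Proof.
have h1 := VnormD (u - v) v; have h2 := VnormD (v - u) u.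
rewrite !subrK -[v - u]opprB VnormN in h1 h2.
by rewrite ler_norml; apply/andP; split; lra.
Qed.

Lemma Kpos_real (e : KK) : 0 < e -> exists2 r : R, 0 < r & e = RtoK r.
Proof.
move=> e0; exists (KtoR e); last by rewrite RtoKK// ltW.
by rewrite -ltr_RtoK RtoKK ?ltW// RtoK0.
Qed.

Lemma Vcvg_dist (F : nat -> V) v :
  (F @ \oo --> v) <-> (forall r : R, 0 < r -> \forall n \near \oo, Vnorm (v - F n) < r).
Proof.
split=> [/cvgrPdist_lt h r r0|h].
  have : 0 < RtoK r by rewrite -RtoK0 ltr_RtoK.
  by move=> /h; apply: filterS => n; rewrite VnormE ltr_RtoK.
apply/cvgrPdist_lt => e /Kpos_real[r r0 ->]; have := h r r0.
by apply: filterS => n; rewrite VnormE ltr_RtoK.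
Qed.

Lemma Vnorm_continuous : continuous (@Vnorm R b V).
Proof.
move=> v; apply/cvgrPdist_lt => r r0.
have e0 : 0 < RtoK r by rewrite -RtoK0 ltr_RtoK.
apply/nbhs_ballP; exists (RtoK r) => // w; rewrite -ball_normE/= VnormE ltr_RtoK.
exact: le_lt_trans (Vnorm_dist _ _).
Qed.

End scalars.

(** * Countable bases of separable spaces *)

Section bases.
Context {R : realType}.

(* A countable base, indexed by a countable type rather than given as a countable
   set of sets; empty members are allowed. *)
Definition has_base (T : topologicalType) := exists B : nat * nat -> set T,
  (forall i, open (B i)) /\ forall (U : set T) x, open U -> U x -> exists2 i, B i x & B i `<=` U.

(** The code [f] is injective on [D], so the union attached to an index is a single ball or empty,
    whatever the size of [D]. *)
Lemma separable_base (b : bool) (V : normedModType (Kof R b)) (D : set V) :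
  countable D -> (forall v (r : R), 0 < r -> exists2 d, D d & Vnorm (v - d) < r) ->
  has_base V.
Proof.
move=> /countable_injP[f finj] Dd.
exists (fun i => \bigcup_(v in [set v | D v /\ f v = i.1]) ball v (RtoK (i.2.+1%:R^-1) : Kof R b)); split.
  by move=> i; apply: bigcup_open => v _; apply: ball_open; rewrite -RtoK0 ltr_RtoK invr_gt0.
move=> U x oU Ux.
have /nbhs_ballP[e /= /Kpos_real[r r0 ->] eU] := open_nbhs_nbhs (conj oU Ux).
have /ltr_add_invr[n] : 0 < r / 2 by rewrite divr_gt0.
rewrite add0r => nr; have n0 : 0 < n.+1%:R^-1 :> R by rewrite invr_gt0.
have [v Dv xv] := Dd x _ n0.
exists (f v, n); first by exists v => //; rewrite -ball_normE/= distrC VnormE ltr_RtoK.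
move=> y [w [/= Dw fw]]; have -> : w = v by apply: finj; rewrite ?inE.
rewrite -!ball_normE/= in eU *; rewrite VnormE ltr_RtoK => vy; apply: eU; rewrite /= VnormE ltr_RtoK.
rewrite -(subrK v x) -addrA (le_lt_trans (VnormD _ _))//.
by rewrite [ltRHS]splitr ltrD// (lt_trans _ nr).
Qed.

Definition ratK (b : bool) (p : rat * rat) : Kof R b :=
  match b return Kof R b with
  | true => (ratr p.1 +i* ratr p.2)%C | false => ratr p.1 end.

Lemma ratK_dense (b : bool) (z : Kof R b) (r : R) : 0 < r ->
  exists p, Knorm (z - ratK b p) < r.
Proof.
move=> r0; have r20 : 0 < r / 2 by rewrite divr_gt0.
have app (t : R) : exists q : rat, `|t - ratr q| < r / 2.
  have /rat_in_itvoo[q] : t - r / 2 < t + r / 2 by rewrite ltrBlDr -addrA ltrDl addr_gt0.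
  by rewrite in_itv/= => /andP[q1 q2]; exists q; rewrite distrC ltr_distl q1.
rewrite /Knorm /KtoR /ratK; move: z; rewrite /Kof; case: b => /= z; last first.
  have [q qz] := app z; exists (q, 0) => /=.
  by rewrite (lt_trans qz)// ltr_pdivrMr// ltr_pMr// ltr1n.
case: z => x y; have [p px] := app x; have [q qy] := app y; exists (p, q).
change (complex.Re (`| ((x +i* y)%C - (ratr p +i* ratr q)%C : R[i]) |) < r).
rewrite normc_def/=.
set u := x - ratr p in px *; set v := y - ratr q in qy *.
apply: (@le_lt_trans _ _ (`|u| + `|v|)); last by rewrite [ltRHS]splitr ltrD.
have -> : `|u| + `|v| = Num.sqrt ((`|u| + `|v|) ^+ 2).
  by rewrite sqrtr_sqr [RHS]ger0_norm// addr_ge0.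
apply: ler_wsqrtr.
have -> : u ^+ 2 = `|u| ^+ 2 by rewrite real_normK// num_real.
have -> : v ^+ 2 = `|v| ^+ 2 by rewrite real_normK// num_real.
have := mulr_ge0 (normr_ge0 u) (normr_ge0 v).
by move: `|u| `|v| => s t st; rewrite sqrrD; lra.
Qed.

Lemma Kof_base (b : bool) : has_base ((Kof R b)^o : normedModType (Kof R b)).
Proof.
apply: (@separable_base b (Kof R b)^o (range (ratK b))).
  by apply: card_le_trans (card_image_le _ _) _; exact: countableP.
by move=> z r /(ratK_dense z)[p pz]; exists (ratK b p).
Qed.

Lemma separable_space_base (b : bool) (V : normedModType (Kof R b)) :
  separable_space V -> has_base V.
Proof.
move=> [D [cD dD]]; apply: (separable_base cD) => v r r0.
have e0 : 0 < RtoK r :> Kof R b by rewrite -RtoK0 ltr_RtoK.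
have [||d [+ Dd]] := dD (ball v (RtoK r)).
- by exists v; exact: ballxx.
- exact: ball_open.
by rewrite -ball_normE/= VnormE ltr_RtoK => h; exists d.
Qed.

End bases.

(** * Measurability of sums, products and limits *)

Section measurable_vector.
Context {R : realType} {k : nat}.
Local Notation Rk := 'rV[R]_k.+1.
Local Notation X := (caratheodory_type (@leb R k)).
Variables (Om : set Rk) (oOm : open Om).

Lemma lmeas_fun_cst (T : topologicalType) (t : T) : lmeas_fun Om (fun=> t).
Proof.
move=> U oU; have [Ut|nUt] := pselect (U t).
  rewrite (_ : _ `&` _ = Om); first exact: measurable_open_rV.
  by apply/seteqP; split => x // [].
rewrite (_ : _ `&` _ = set0); first exact: (@measurable0 _ X).
by apply/seteqP; split => x // [].
Qed.

(** Rectangles from the two countable bases exhaust every open set of the product, so its preimage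
    is a countable union of measurable sets. Separability of [V] enters through this lemma. *)
Lemma lmeas_fun2 (S T W : topologicalType) (F : Rk -> S) (G : Rk -> T) (op : S * T -> W) :
  has_base S -> has_base T -> continuous op ->
  lmeas_fun Om F -> lmeas_fun Om G -> lmeas_fun Om (fun x => op (F x, G x)).
Proof.
move=> [B [oB bB]] [C [oC bC]] cop mF mG U oU.
pose I := ((nat * nat) * (nat * nat))%type.
rewrite (_ : _ `&` _ = \bigcup_(ij : I) (if `[< B ij.1 `*` C ij.2 `<=` op @^-1` U >]
   then (Om `&` F @^-1` B ij.1) `&` (Om `&` G @^-1` C ij.2) else set0)).
  have : measurable (\bigcup_(ij : I) (if `[< B ij.1 `*` C ij.2 `<=` op @^-1` U >]
   then (Om `&` F @^-1` B ij.1) `&` (Om `&` G @^-1` C ij.2) else set0) : set X); last by [].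
  apply: countable_bigcupT_measurable; first exact: countableP.
  move=> ij; case: asboolP => _; last exact: measurable0.
  by apply: measurableI; [exact: mF|exact: mG].
apply/seteqP; split => x; last first.
  by move=> [ij _]; case: asboolP => // h [[Ox Bx] [_ Cx]]; split => //; exact: (h (F x, G x)).
move=> [Ox Ux].
have oU' : open (op @^-1` U) by apply: open_comp => // p _; exact: cop.
have : nbhs (F x, G x) (op @^-1` U) by apply: open_nbhs_nbhs; split.
move=> [[A1 A2] /= [nA1 nA2] AU].
have [i Bi BiA] := bB _ (F x) (@open_interior _ A1) nA1.
have [j Cj CjA] := bC _ (G x) (@open_interior _ A2) nA2.
exists (i, j) => //; case: asboolP => [_|]; first by split.
case; move=> [s t] [/= Bs Ct]; apply: AU; split => /=.
  by have /interior_subset := BiA _ Bs.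
by have /interior_subset := CjA _ Ct.
Qed.

Lemma lmeas_fun_comp_map (T : topologicalType) (F : Rk -> Rk) (h : Rk -> T) :
  (forall x, Om x -> Om (F x)) -> lmeas_fun Om F ->
  (forall M, leb M = 0%E -> leb (Om `&` F @^-1` M) = 0%E) ->
  lmeas_fun Om h -> lmeas_fun Om (h \o F).
Proof.
move=> FOm mF nF mh U oU.
rewrite (_ : _ `&` _ = Om `&` F @^-1` (Om `&` h @^-1` U)); last first.
  apply/seteqP; split => x; first by move=> [Ox Ux]; split => //; split => //; exact: FOm.
  by move=> [Ox [_ Ux]].
by apply: (measurable_preimage oOm mF nF); exact: mh.
Qed.

Variables (b : bool) (V : normedModType (Kof R b)) (sV : has_base V).

Lemma lmeas_funD (F G : Rk -> V) : lmeas_fun Om F -> lmeas_fun Om G ->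
  lmeas_fun Om (fun x => F x + G x).
Proof.
move=> mF mG; apply: (lmeas_fun2 (op := fun p : V * V => p.1 + p.2) sV sV) => //.
exact: add_continuous.
Qed.

Lemma lmeas_funZ (a : Rk -> Kof R b) (F : Rk -> V) : lmeas_fun Om a -> lmeas_fun Om F ->
  lmeas_fun Om (fun x => a x *: F x).
Proof.
move=> ma mF.
apply: (@lmeas_fun2 (Kof R b)^o V V a F (fun p : (Kof R b)^o * V => p.1 *: p.2) (@Kof_base R b) sV) => //.
exact: scale_continuous.
Qed.

Lemma lmeas_fun_sum I (s : seq I) (F : I -> Rk -> V) : (forall i, lmeas_fun Om (F i)) ->
  lmeas_fun Om (fun x => \sum_(i <- s) F i x).
Proof.
move=> mF; elim: s => [|i s IH].
  by under eq_fun do rewrite big_nil; exact: lmeas_fun_cst.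
by under eq_fun do rewrite big_cons; exact: lmeas_funD.
Qed.

(** At a point of convergence, [G x] lies in [U] exactly when for some [j] the values [F m x]
    eventually keep distance [r j] from the complement of [U]. These are countably many closed
    conditions, and the other points form a null set. *)
Lemma lmeas_fun_lim (F : nat -> Rk -> V) (G : Rk -> V) : (forall m, lmeas_fun Om (F m)) ->
  leb (Om `&` [set x | ~ (F m x @[m --> \oo] --> G x)]) = 0%E -> lmeas_fun Om G.
Proof.
move=> mF Z0 U oU; set Z := Om `&` _ in Z0.
pose r (j : nat) : R := j.+1%:R^-1.
have r0 j : 0 < r j by rewrite invr_gt0.
pose C j := [set v : V | forall w, Vnorm (w - v) < r j -> U w].
have cC j : open (~` C j).
  rewrite (_ : ~` C j = \bigcup_(w in ~` U) ball w (RtoK (r j) : Kof R b)).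
    by apply: bigcup_open => w _; apply: ball_open; rewrite -RtoK0 ltr_RtoK.
  apply/seteqP; split => v.
    move=> /existsNP[w /not_implyP[wv nUw]]; exists w => //.
    by rewrite -ball_normE/= VnormE ltr_RtoK.
  by move=> [w nUw]; rewrite -ball_normE/= VnormE ltr_RtoK => wv /(_ w wv).
pose E : set X := \bigcup_j \bigcup_M \bigcap_(m in [set m | (M <= m)%N]) (Om `&` F m @^-1` C j).
have mE : measurable E.
  apply: bigcup_measurable => j _; apply: bigcup_measurable => M _.
  apply: bigcap_measurable; first by exists M => /=.
  move=> m _; rewrite (_ : _ `&` _ = Om `\` (Om `&` F m @^-1` (~` C j))); last first.
    apply/seteqP; split => x; first by move=> [Ox Cx]; split => // -[].
    by move=> [Ox h]; split => //; apply: contrapT => nC; apply: h.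
  by apply: measurableD; [exact: measurable_open_rV|exact: mF].
have EG x : ~ Z x -> Om x -> (E x <-> U (G x)).
  move=> nZ Ox; have cv : F m x @[m --> \oo] --> G x by apply: contrapT => nc; apply: nZ.
  have {}cv := (Vcvg_dist _ _).1 cv; split.
    move=> [j _ [M _ hE]].
    have [m [/= mM md]] : exists m, (M <= m)%N /\ Vnorm (G x - F m x) < r j.
      have := cv _ (r0 j) => /(filterI (nbhs_infty_ge M)) /filter_ex[m [h1 h2]].
      by exists m.
    by have [_ hC] := hE m mM; exact: hC.
  move=> UG.
  have /nbhs_ballP[e /= /Kpos_real[s s0 ->] eU] := open_nbhs_nbhs (conj oU UG).
  have /ltr_add_invr[j] : 0 < s / 2 by rewrite divr_gt0.
  rewrite add0r => js; have [M _ hM] := cv _ (r0 j).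
  exists j => //; exists M => // m /= Mm; split => // w wF.
  apply: eU; rewrite -ball_normE/= VnormE ltr_RtoK.
  rewrite -(subrK (F m x) (G x)) -addrA (le_lt_trans (VnormD _ _))//.
  rewrite [ltRHS]splitr ltrD//; first by rewrite (lt_trans _ js)//; exact: hM.
  by rewrite -opprB VnormN (lt_trans _ js).
have : measurable ((E `\` Z) `|` (Om `&` G @^-1` U `&` Z) : set X).
  apply: measurableU; first by apply: measurableD => //; exact: null_measurable.
  by apply: null_measurable; apply: null_subset Z0 => x [].
rewrite (_ : _ `|` _ = Om `&` G @^-1` U) //.
apply/seteqP; split => x.
  move=> [[Ex nZ]|[]//].
  have Ox : Om x by case: Ex => j _ [M _ /(_ M (leqnn _))[]].
  by split => //; exact/(EG x nZ Ox).
move=> [Ox Ux]; have [Zx|nZ] := pselect (Z x); first by right; split.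
by left; split => //; exact/(EG x nZ Ox).
Qed.

End measurable_vector.

(** * Absolutely convergent series in a Banach space *)

Section absolute_series.
Context {R : realType} {b : bool} {V : completeNormedModType (Kof R b)}.
Variables (a : nat -> V) (c : nat -> \bar R).
Hypotheses (ac : forall i, ((Vnorm (a i))%:E <= c i)%E)
  (cfin : (\sum_(0 <= i <oo) c i < +oo)%E).

Let c0 i : (0 <= c i)%E.
Proof. by apply: le_trans (ac i); rewrite lee_fin Vnorm_ge0. Qed.

Definition vsum j : V := lim ((fun m => \sum_(j <= i < m) a i) @ \oo).

Lemma vsum_cvg j : (fun m => \sum_(j <= i < m) a i) @ \oo --> vsum j.
Proof.
have tail : (\sum_(n <= i <oo) c i)%E @[n --> \oo] --> 0%E by exact: nneseries_tail_cvg.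
have cv0 : cvg (series a @ \oo).
  apply/cauchy_cvgP/cauchy_seriesP => e /Kpos_real[r r0 ->].
  have [M _ hM] := tail _ (nbhs_open_ereal_lt (f := fun=> r) r0).
  exists ([set n | (M <= n)%N], setT); first by split => //=; [exists M|exact: filterT].
  move=> [n m] [/= Mn _]; rewrite VnormE ltr_RtoK -lte_fin.
  apply: le_lt_trans (hM n Mn).
  apply: (@le_trans _ _ (\sum_(n <= i < m) (Vnorm (a i))%:E)%E).
    by rewrite sumEFin lee_fin Vnorm_sum.
  apply: (@le_trans _ _ (\sum_(n <= i < m) c i)%E); first by apply: lee_sum => i _.
  by apply: nneseries_lim_ge => i _ _.
suff h : (fun m => \sum_(j <= i < m) a i) @ \oo --> lim (series a @ \oo) - series a j.
  by rewrite /vsum; apply/cvg_ex; exists (lim (series a @ \oo) - series a j).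
have : (fun m => series a m - series a j) @ \oo --> lim (series a @ \oo) - series a j.
  by apply: cvgB => //; exact: cvg_cst.
apply: cvg_trans; apply: near_eq_cvg; near=> m.
have jm : (j <= m)%N by near: m; exact: nbhs_infty_ge.
by rewrite sub_series_geq.
Unshelve. all: by end_near. Qed.

Lemma vsum_split j m : (j <= m)%N -> vsum j = \sum_(j <= i < m) a i + vsum m.
Proof.
move=> jm.
suff h : (fun n => \sum_(j <= i < n) a i) @ \oo --> \sum_(j <= i < m) a i + vsum m.
  by rewrite {1}/vsum; apply: cvg_lim => //; exact: norm_hausdorff.
have : (fun n => \sum_(j <= i < m) a i + \sum_(m <= i < n) a i) @ \oo -->
    \sum_(j <= i < m) a i + vsum m.
  by apply: cvgD; [exact: cvg_cst|exact: vsum_cvg].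
apply: cvg_trans; apply: near_eq_cvg; near=> n.
have mn : (m <= n)%N by near: n; exact: nbhs_infty_ge.
by rewrite [RHS](big_cat_nat (n := m)) //=.
Unshelve. all: by end_near. Qed.

Lemma Vnorm_vsum j : ((Vnorm (vsum j))%:E <= \sum_(j <= i <oo) c i)%E.
Proof.
apply/lee_addgt0Pr => r r0.
have [M _ hM] := (Vcvg_dist _ _).1 (@vsum_cvg j) r r0.
have := hM M (leqnn M) => /= /ltW h.
apply: (@le_trans _ _ ((\sum_(j <= i < M) (Vnorm (a i))%:E) + r%:E)%E); last first.
  apply: leeD2r; apply: (@le_trans _ _ (\sum_(j <= i < M) c i)%E); first by apply: lee_sum => i _.
  by apply: nneseries_lim_ge => i _ _.
rewrite sumEFin -EFinD lee_fin.
rewrite -{1}(subrK (\sum_(j <= i < M) a i) (vsum j)) (le_trans (VnormD _ _))// addrC.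
by apply: lerD => //; exact: Vnorm_sum.
Qed.

End absolute_series.

(** * The elementary solution *)

Section psinorm_lemmas.
Context {R : realType} {k : nat}.
Local Notation Rk := 'rV[R]_k.+1.
Local Notation X := (caratheodory_type (@leb R k)).
Variables (psi : R -> R) (gpsi : good_psi psi) (Om : set Rk) (oOm : open Om).
Variables (b : bool) (V : completeNormedModType (Kof R b)).
Local Notation Rpos := [set s : R | (0 <= s)%R].
Local Notation lor := (lorentz (@lebX R k) (tau_inv psi)).
Let qpsi := tau_inv_quasiconcave gpsi.

Lemma measurable_distrib (D : set R) (f : \bar R -> \bar R) (C : set Rk) (u : Rk -> R) :
  measurable D -> {homo f : x y / (x <= y)%E} ->
  measurable_fun D (fun s : R => f (distrib C u s)).
Proof.
move=> mD homof; apply: nonincreasing_emeasurable => // s t st.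
by apply: homof; apply: le_leb => x [Cx tx]; split => //; exact: le_lt_trans st tx.
Qed.

(** Extension by 0 adds no point to a level set at a level [s >= 0], so the abstract functional on
    the whole space returns the norm on [Om]. *)
Definition Vnorm_on (h : Rk -> V) : X -> \bar R := (fun x => (Vnorm (h x))%:E) \_ Om.

Lemma Vnorm_onE h x : Om x -> Vnorm_on h x = (Vnorm (h x))%:E.
Proof. by move=> Ox; rewrite /Vnorm_on patchT// inE. Qed.

Lemma Vnorm_on_ge0 h x : (0 <= Vnorm_on h x)%E.
Proof. by rewrite /Vnorm_on /patch; case: ifP => // _; rewrite lee_fin Vnorm_ge0. Qed.

Lemma lmeas_Vnorm (h : Rk -> V) : lmeas_fun Om h -> lmeas_fun Om (fun x => Vnorm (h x)).
Proof. by move=> mh; apply: (lmeas_fun_comp mh); exact: Vnorm_continuous. Qed.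

Lemma measurable_Vnorm_on h : lmeas_fun Om h -> measurable_fun setT (Vnorm_on h).
Proof.
move=> mh; apply/(measurable_restrictT _ _).1; first exact: measurable_open_rV.
by apply/measurable_EFinP; apply: lmeas_fun_measurable => //; exact: lmeas_Vnorm.
Qed.

Lemma lorentz_Vnorm_on h : lor (Vnorm_on h) = psinorm psi Om h.
Proof.
apply: eq_integral => s /[!inE] /= s0; congr (tau_inv psi); congr (leb _).
apply/seteqP; split => x /=.
  rewrite /Vnorm_on /patch; case: ifPn => [|_]; last by rewrite lte_fin ltNge s0.
  by rewrite inE => Ox; rewrite lte_fin => sx; split => //; rewrite ger0_norm// Vnorm_ge0.
by move=> [Ox]; rewrite ger0_norm ?Vnorm_ge0// => sx; rewrite Vnorm_onE// lte_fin.
Qed.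

Lemma psinorm_le (w : Rk -> V) (H : X -> \bar R) : measurable_fun setT H ->
  leb (Om `&` [set x | ~ ((Vnorm (w x))%:E <= H x)%E]) = 0%E ->
  (psinorm psi Om w <= lor H)%E.
Proof.
move=> mH; set Z := Om `&` _ => Z0.
have mR := @measurable_Rpos R.
apply: ge0_le_integral => //.
- by move=> s _; apply: (qc_ge0 qpsi); exact: leb_ge0.
- by apply: measurable_distrib => //; exact: qc_homo.
- exact: (measurable_distribution (@lebX R k) mH mR (qc_homo qpsi)).
move=> s _; apply: (qc_homo qpsi).
apply: (@le_trans _ _ (leb ([set x | (s%:E < H x)%E] `|` Z))).
  apply: le_leb => x [Ox]; rewrite ger0_norm ?Vnorm_ge0// => sx.
  have [wH|nwH] := pselect ((Vnorm (w x))%:E <= H x)%E; last by right.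
  by left; apply: lt_le_trans wH; rewrite lte_fin.
apply: le_trans (outer_measureU2 leb _ _) _.
by rewrite [X in (_ + X <= _)%E]Z0 adde0.
Qed.

(** On a compact set of measure [c] the distribution function is at most [c], so the chord
    inequality bounds it by [c / phi c] times the integrand of the norm. *)
Lemma psinorm_L1loc (u : Rk -> R) : (psinormR psi Om u < +oo)%E -> L1loc Om u.
Proof.
move=> ufin C cC COm; have mR := @measurable_Rpos R.
have Cfin : (leb C < +oo)%E.
  have /compact_bounded[M [_ hM]] := cC.
  pose n := (Num.trunc (`|M| + 1)).+1.
  apply: le_lt_trans (leb_cube_fin n); apply: le_leb => x Cx; apply/cubeP.
  apply: (@le_trans _ _ (`|M| + 1)); last first.
    by apply: ltW; have /andP[] := truncn_itv (addr_ge0 (normr_ge0 M) ler01).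
  by apply: hM => //; rewrite (le_lt_trans (ler_norm M))// ltrDl.
have dC s : (distrib C u s <= leb C)%E by apply: le_leb => x [].
have dOm s : (distrib C u s <= distrib Om u s)%E by apply: le_leb => x [/COm].
have d0 s : (0 <= distrib C u s)%E by exact: leb_ge0.
have [C0|C0] := eqVneq (leb C) 0%E.
  rewrite /int_abs integral0_eq// => s _; apply/eqP; rewrite eq_le d0 andbT -C0.
  exact: dC.
have {}Cfin : leb C \is a fin_num by rewrite ge0_fin_numE ?leb_ge0.
set c := fine (leb C); have cE : leb C = c%:E by rewrite fineK.
have c0 : 0 < c by rewrite -lte_fin -cE lt0e C0 leb_ge0.
have ph0 : (0 < tau_inv psi c%:E)%E by exact: (qc_gt0 qpsi c0).
have phcf : tau_inv psi c%:E \is a fin_num.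
  by rewrite (ge0_fin_numE (ltW ph0)) (qc_fin qpsi).
set p := fine (tau_inv psi c%:E); have pE := esym (fineK phcf : p%:E = _).
have p0 : 0 < p by rewrite -lte_fin -pE.
have pt s : (distrib C u s <= (c / p)%:E * tau_inv psi (distrib Om u s))%E.
  have dc := dC s; rewrite cE in dc; have h := qc_chord qpsi c0 (d0 s) dc.
  rewrite pE in h.
  rewrite mulrC EFinM -muleA muleC lee_pdivlMr//; apply: le_trans h _.
  by apply: lee_wpmul2l; [rewrite lee_fin ltW|apply: (qc_homo qpsi)].
apply: (@le_lt_trans _ _ ((c / p)%:E * psinormR psi Om u)%E).
  rewrite -ge0_integralZl//; last 3 first.
  - by apply: measurable_distrib => //; exact: qc_homo.
  - by move=> s _; apply: (qc_ge0 qpsi); exact: leb_ge0.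
  - by rewrite lee_fin divr_ge0// ltW.
  apply: ge0_le_integral => //.
  - by apply: (@measurable_distrib _ id).
  - apply: measurable_funeM; apply: measurable_distrib => //; exact: qc_homo.
by rewrite lte_mul_pinfty// lee_fin divr_ge0// ltW.
Qed.

Lemma Lpsi_intro (w : Rk -> V) : lmeas_fun Om w -> (psinorm psi Om w < +oo)%E -> Lpsi psi Om w.
Proof.
move=> mw wfin; split => //; split; first exact: lmeas_Vnorm.
by split => //; exact: psinorm_L1loc.
Qed.

End psinorm_lemmas.

(** * Almost everywhere statements on [Om] *)

Section ae_on_lemmas.
Context {R : realType} {k : nat}.
Local Notation Rk := 'rV[R]_k.+1.
Variable Om : set Rk.
Implicit Types P Q : Rk -> Prop.

Lemma ae_onS P Q : (forall x, Om x -> P x -> Q x) -> ae_on Om P -> ae_on Om Q.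
Proof. by move=> PQ; apply: null_subset => x [Ox nQ]; split => // /(PQ _ Ox). Qed.

Lemma ae_onT P : (forall x, P x) -> ae_on Om P.
Proof.
move=> hP; apply: (@null_subset _ _ _ set0); last exact: leb0.
by move=> x [_ /(_ (hP x))].
Qed.

Lemma ae_on_all (I : countType) (P : I -> Rk -> Prop) :
  (forall i, ae_on Om (P i)) -> ae_on Om (fun x => forall i, P i x).
Proof.
move=> hP; apply: null_subset (null_bigcup_count hP) => x [Ox /existsNP[i nP]].
by exists i.
Qed.

Lemma ae_onI P Q : ae_on Om P -> ae_on Om Q -> ae_on Om (fun x => P x /\ Q x).
Proof.
move=> hP hQ; apply: null_subset (null_setU hP hQ) => x [Ox /not_andP[nP|nQ]].
  by left.
by right.
Qed.

Lemma ae_on_comp (F : Rk -> Rk) P : (forall x, Om x -> Om (F x)) ->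
  (forall M, leb M = 0%E -> leb (Om `&` F @^-1` M) = 0%E) ->
  ae_on Om P -> ae_on Om (fun x => P (F x)).
Proof.
move=> FOm nF hP; apply: null_subset (nF _ hP) => x [Ox nP]; split => //.
by split => //; exact: FOm.
Qed.

End ae_on_lemmas.

(** * The series, the equation and uniqueness *)

Section elementary_solution.
Context {R : realType} {k N : nat} {b : bool} {V : completeNormedModType (Kof R b)}.
Local Notation Rk := 'rV[R]_k.+1.
Local Notation X := (caratheodory_type (@leb R k)).
Variables (Om : set Rk) (f : 'I_N -> Rk -> Rk) (g : 'I_N -> Rk -> Kof R b).
Variables (K : nat) (psi : R -> R) (alpha : R).
Hypotheses (N0 : (0 < N)%N) (oOm : open Om) (sV : has_base V).
Hypothesis fOm : forall n x, Om x -> Om (f n x).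
Hypothesis mf : forall n, lmeas_fun Om (f n).
Hypothesis luzin : forall n M, M `<=` Om -> leb M = 0%E -> leb (f n @` M) = 0%E.
Hypothesis nullf : forall n M, leb M = 0%E -> leb (Om `&` f n @^-1` M) = 0%E.
Hypothesis fK : forall n, leb [set x | Om x /\ exists s : seq Rk,
  [/\ uniq s, size s = K.+1 & forall y, y \in s -> Om y /\ f n y = x]] = 0%E.
Hypothesis mg : forall n, lmeas_fun Om (g n).
Hypothesis gpsi : good_psi psi.
Hypotheses (alpha0 : 0 <= alpha) (ahalf : alpha < 1 / 2).
Hypothesis gbound : forall n, ae_on Om (fun x => Knorm (g n x) <=
  alpha * Num.min (`|Jac Om (f n) x| / (K * Lconst Om f)%:R) (N%:R)^-1).

Local Notation P := (Pop g f).
Local Notation lor := (lorentz (@lebX R k) (tau_inv psi)).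
Let qpsi := tau_inv_quasiconcave gpsi.

(** The minimum with [alpha / N] makes [sum_weight] hold at every point, as the abstract operator
    demands; almost everywhere it equals [Knorm (g n x)]. *)
Definition weight n : X -> R := (fun x => Num.min (Knorm (g n x)) (alpha / N%:R)) \_ Om.

(* Outside [Om] the weights vanish, so the values of [selfmap] there are irrelevant. *)
Definition selfmap n : X -> X := fun x => if x \in Om then f n x else x.

Lemma weight_in n x : Om x -> weight n x = Num.min (Knorm (g n x)) (alpha / N%:R).
Proof. by move=> Ox; rewrite /weight patchT// inE. Qed.

Lemma weight_out n x : ~ Om x -> weight n x = 0.
Proof. by move=> Ox; rewrite /weight patchC// inE. Qed.

Lemma selfmap_in n x : Om x -> selfmap n x = f n x.
Proof. by move=> Ox; rewrite /selfmap mem_set. Qed.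

Lemma weight_ge0 n x : 0 <= weight n x.
Proof.
have [Ox|Ox] := pselect (Om x); last by rewrite weight_out.
by rewrite weight_in// le_min Knorm_ge0 divr_ge0.
Qed.

Lemma sum_weight x : \sum_n weight n x <= alpha.
Proof.
have N1 : N%:R != 0 :> R by rewrite pnatr_eq0 -lt0n.
apply: (@le_trans _ _ (\sum_(n < N) alpha / N%:R)); last first.
  by rewrite sumr_const card_ord -(mulr_natr (alpha / _)) divfK.
apply: ler_sum => n _; have [Ox|Ox] := pselect (Om x).
  by rewrite weight_in// ge_min lexx orbT.
by rewrite weight_out// divr_ge0.
Qed.

Lemma measurable_weight n : measurable_fun setT (weight n).
Proof.
apply/(measurable_restrictT _ _).1; first exact: measurable_open_rV.
apply: measurable_minr; last exact: measurable_cst.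
apply: lmeas_fun_measurable => //.
by apply: (lmeas_fun_comp (mg n)); exact: (@Vnorm_continuous R b (Kof R b)^o).
Qed.

Lemma measurable_selfmap n : measurable_fun setT (selfmap n).
Proof.
move=> _ B mB; rewrite setTI.
rewrite (_ : _ @^-1` B = (Om `&` f n @^-1` B) `|` (B `\` Om)); last first.
  apply/seteqP; split => x; rewrite /selfmap /=.
    by case: ifPn => [/set_mem Ox Bx|/negP nO Bx]; [left|right; split => // Ox; apply: nO; rewrite inE].
  by move=> [[Ox]|[Bx Ox]]; [rewrite mem_set|rewrite memNset].
apply: measurableU; first exact: (measurable_preimage oOm (mf n) (@nullf n) mB).
by apply: measurableD => //; exact: measurable_open_rV.
Qed.

Lemma weight_Jac n : ae_on Om (fun x => weight n x <=
  alpha / (K * Lconst Om f)%:R * `|Jac Om (f n) x|).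
Proof.
apply: ae_onS (gbound n) => x Ox h; rewrite weight_in// ge_min; apply/orP; left.
by rewrite (le_trans h)// mulrAC -mulrA ler_wpM2l// ge_min lexx.
Qed.

Lemma weight_Knorm : ae_on Om (fun x => forall n, weight n x = Knorm (g n x)).
Proof.
apply: ae_on_all => n; apply: ae_onS (gbound n) => x Ox h.
by rewrite weight_in//; apply/min_idPl; rewrite (le_trans h)// ler_wpM2l// ge_min lexx orbT.
Qed.

Lemma weight_int (A : set X) : measurable A ->
  (\int[@lebX R k]_x (\sum_n (weight n x)%:E * (\1_A (selfmap n x))%:E) <= alpha%:E * lebX A)%E.
Proof.
move=> mA; rewrite ge0_integral_sum//; last 2 first.
- move=> n; apply: emeasurable_funM.
    by apply/measurable_EFinP; exact: measurable_weight.
  apply/measurable_EFinP.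
  by apply: (measurableT_comp (measurable_indic mA)); exact: measurable_selfmap.
- by move=> n x _; rewrite mule_ge0// lee_fin ?weight_ge0.
apply: le_trans (area_bound oOm fOm mf luzin nullf fK _ weight_ge0 alpha0 weight_Jac mA).
  apply: lee_sum => n _; rewrite [leRHS]integral_mkcond; rewrite le_eqVlt.
  apply/orP; left; apply/eqP; apply: eq_integral => x _; rewrite /patch.
  have [Ox|Ox] := pselect (Om x); last first.
    by rewrite weight_out// mul0e memNset// => -[].
  rewrite selfmap_in// indicE; have [Ax|Ax] := pselect (A (f n x)).
    by rewrite !mem_set// mule1.
  by rewrite !memNset ?mule0// => -[].
by move=> n; apply: measurable_funS (measurable_weight n).
Qed.

Local Notation Q := (transfer weight selfmap).
Local Notation tail := (transfer_tail weight selfmap).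
Local Notation mod h := (Vnorm_on Om h).
Implicit Types h u : Rk -> V.

Lemma measurable_Pop h : lmeas_fun Om h -> lmeas_fun Om (P h).
Proof.
move=> mh; apply: lmeas_fun_sum => // n; apply: lmeas_funZ => //.
exact: (lmeas_fun_comp_map oOm (@fOm n) (mf n) (@nullf n) mh).
Qed.

Lemma measurable_iter_Pop i h : lmeas_fun Om h -> lmeas_fun Om (iter i P h).
Proof. by move=> mh; elim: i => // i; exact: measurable_Pop. Qed.

(** Each step evaluates the previous inequality at the points [f n x]; null preimages of null sets
    keep the exceptional set null. *)
Lemma iter_Pop_le h : ae_on Om (fun x => forall i,
  ((Vnorm (iter i P h x))%:E <= iter i Q (mod h) x)%E).
Proof.
apply: ae_on_all; elim => [|i IH].
  by apply: (ae_onS _ (ae_onT _ (fun=> Logic.I))) => x Ox _; rewrite /= Vnorm_onE.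
have IHf : ae_on Om (fun x => forall n,
    ((Vnorm (iter i P h (f n x)))%:E <= iter i Q (mod h) (f n x))%E).
  by apply: ae_on_all => n; exact: (ae_on_comp (@fOm n) (@nullf n) IH).
apply: ae_onS (ae_onI IHf weight_Knorm) => x Ox [hf hw] /=.
apply: (@le_trans _ _ (\sum_n (Knorm (g n x) * Vnorm (iter i P h (f n x)))%:E)%E).
  rewrite sumEFin lee_fin (le_trans (Vnorm_sum _ _ _))//.
  by apply: ler_sum => n _; rewrite VnormZ.
apply: lee_sum => n _; rewrite selfmap_in// hw EFinM.
by apply: lee_wpmul2l => //; rewrite lee_fin Knorm_ge0.
Qed.

Let mQ h j : lmeas_fun Om h -> measurable_fun setT (tail j (mod h)).
Proof.
move=> mh; apply: measurable_transfer_tail.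
- exact: measurable_weight.
- exact: measurable_selfmap.
- exact: weight_ge0.
- exact: measurable_Vnorm_on.
- exact: Vnorm_on_ge0.
Qed.

Let Qge0 h i x : (0 <= iter i Q (mod h) x)%E.
Proof. by apply: iter_transfer_ge0; [exact: weight_ge0|exact: Vnorm_on_ge0]. Qed.

Lemma lorentz_tail_le j h : Lpsi psi Om h ->
  (lor (tail j (mod h)) <= ((2 * alpha) ^+ j / (1 - 2 * alpha))%:E * psinorm psi Om h)%E.
Proof.
move=> [mh [_ [_ hfin]]]; rewrite -lorentz_Vnorm_on.
apply: (lorentz_transfer_tail_le measurable_weight measurable_selfmap weight_ge0 sum_weight weight_int
  alpha0 qpsi j ahalf (measurable_Vnorm_on oOm mh) (Vnorm_on_ge0 Om h)).
by rewrite lorentz_Vnorm_on.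
Qed.

Lemma tail_bound_fin j h : Lpsi psi Om h ->
  (((2 * alpha) ^+ j / (1 - 2 * alpha))%:E * psinorm psi Om h < +oo)%E.
Proof.
move=> [_ [_ [_ hfin]]]; apply: lte_mul_pinfty => //.
have a0 := alpha0; have a1 := ahalf; have h2 : 0 <= 2 * alpha by lra.
have h1 : 0 <= 1 - 2 * alpha by lra.
by rewrite lee_fin divr_ge0// exprn_ge0.
Qed.

Lemma tail_fin h : Lpsi psi Om h -> ae_on Om (fun x => (tail 0 (mod h) x < +oo)%E).
Proof.
move=> Lh; have mh : lmeas_fun Om h by case: Lh.
have := lorentz_pinfty (mu := @lebX R k) qpsi (mQ 0 mh)
  (le_lt_trans (lorentz_tail_le 0 Lh) (tail_bound_fin 0 Lh)).
apply: null_subset => x [_ /negP]; rewrite -leNgt leye_eq => /eqP; exact.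
Qed.

Definition summable h x := (forall i, ((Vnorm (iter i P h x))%:E <= iter i Q (mod h) x)%E) /\
  (tail 0 (mod h) x < +oo)%E.

Lemma ae_summable h : Lpsi psi Om h -> ae_on Om (summable h).
Proof. by move=> Lh; apply: ae_onI; [exact: iter_Pop_le|exact: tail_fin]. Qed.

Definition series_tail h j x := vsum (fun i => iter i P h x) j.

Lemma series_tail_cvg h j x : summable h x ->
  \sum_(j <= i < m) iter i P h x @[m --> \oo] --> series_tail h j x.
Proof. by case=> h1 h2; exact: (vsum_cvg h1 h2). Qed.

Lemma measurable_series_tail h j : Lpsi psi Om h -> lmeas_fun Om (series_tail h j).
Proof.
move=> Lh; have mh : lmeas_fun Om h by case: Lh.
apply: (@lmeas_fun_lim _ _ _ oOm b V (fun m x => \sum_(j <= i < m) iter i P h x)).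
  by move=> m; apply: lmeas_fun_sum => // i; exact: measurable_iter_Pop.
by apply: ae_onS (ae_summable Lh) => x Ox; exact: series_tail_cvg.
Qed.

Lemma psinorm_series_tail h j : Lpsi psi Om h ->
  (psinorm psi Om (series_tail h j) <=
    ((2 * alpha) ^+ j / (1 - 2 * alpha))%:E * psinorm psi Om h)%E.
Proof.
move=> Lh; have mh : lmeas_fun Om h by case: Lh.
apply: le_trans (lorentz_tail_le j Lh); apply: psinorm_le => //; first exact: mQ.
by apply: ae_onS (ae_summable Lh) => x Ox [h1 h2]; exact: (Vnorm_vsum h1 h2).
Qed.

Lemma Lpsi_series_tail h j : Lpsi psi Om h -> Lpsi psi Om (series_tail h j).
Proof.
move=> Lh; apply: Lpsi_intro => //; first exact: measurable_series_tail.
exact: le_lt_trans (psinorm_series_tail j Lh) (tail_bound_fin j Lh).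
Qed.

(** The iterate is dominated by a single term of the tail from 0, whose norm is already
    controlled. *)
Lemma Lpsi_iter_Pop i h : Lpsi psi Om h -> Lpsi psi Om (iter i P h).
Proof.
move=> Lh; have mh : lmeas_fun Om h by case: Lh.
apply: Lpsi_intro => //; first exact: measurable_iter_Pop.
apply: le_lt_trans (le_lt_trans (lorentz_tail_le 0 Lh) (tail_bound_fin 0 Lh)).
apply: psinorm_le => //; first exact: mQ.
apply: ae_onS (iter_Pop_le h) => x Ox /(_ i) /le_trans; apply.
apply: (@le_trans _ _ (\sum_(0 <= l < i.+1) iter l Q (mod h) x)%E).
  by rewrite big_nat_recr//= leeDr// sume_ge0.
by apply: nneseries_lim_ge.
Qed.

(** For [m >= j] the difference is minus the tail from [m], whose norm is bounded by a geometric
    sequence. *)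
Lemma series_tail_psinorm_cvg h j : Lpsi psi Om h ->
  (fun m => psinorm psi Om (fun x => \sum_(j <= i < m) iter i P h x - series_tail h j x))
    @ \oo --> 0%E.
Proof.
move=> Lh; have mh : lmeas_fun Om h by case: Lh.
have hfin : psinorm psi Om h \is a fin_num.
  rewrite ge0_fin_numE; first by case: Lh => _ [_ []].
  by rewrite -lorentz_Vnorm_on; apply: lorentz_ge0.
apply: (@squeeze_cvge _ _ _ _ (fun=> 0%E) _
  (fun m => (geometric (fine (psinorm psi Om h) / (1 - 2 * alpha)) (2 * alpha) m)%:E)).
- near=> m; have jm : (j <= m)%N by near: m; exact: nbhs_infty_ge.
  apply/andP; split.
    by rewrite -lorentz_Vnorm_on; apply: lorentz_ge0.
  apply: (@le_trans _ _ (lor (tail m (mod h)))).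
    apply: psinorm_le => //; first exact: mQ.
    apply: ae_onS (ae_summable Lh) => x Ox [h1 h2].
    by rewrite /series_tail (vsum_split h1 h2 jm) opprD addrA subrr sub0r VnormN; exact: (Vnorm_vsum h1 h2).
  apply: le_trans (lorentz_tail_le m Lh) _.
  rewrite -[X in (_ * X)%E](fineK hfin) -EFinM lee_fin /=.
  by rewrite [leLHS]mulrC mulrCA mulrC lexx.
- exact: cvg_cst.
- apply: cvg_EFin; first exact: nearW.
  have a0 := alpha0; have a1 := ahalf; have h2 : 0 <= 2 * alpha by lra.
  by apply: cvg_geometric; rewrite ger0_norm//; lra.
Unshelve. all: by end_near. Qed.

Lemma Pop_partial_sum h m x : \sum_(0 <= i < m.+1) iter i P h x =
  P (fun y => \sum_(0 <= i < m) iter i P h y) x + h x.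
Proof.
rewrite big_nat_recl//= addrC; congr (_ + _).
by rewrite exchange_big/=; apply: eq_bigr => n _; rewrite scaler_sumr.
Qed.

(** The partial sums satisfy the equation up to a shift of the index. The limit passes through [P]
    because, for almost every [x], the series is summable at [x] and at all [f n x]. *)
Lemma series_tail_solves h : Lpsi psi Om h -> solves Om g f h (series_tail h 0).
Proof.
move=> Lh; have sh := ae_summable Lh.
have shf : ae_on Om (fun x => forall n, summable h (f n x)).
  by apply: ae_on_all => n; exact: (ae_on_comp (@fOm n) (@nullf n) sh).
apply: ae_onS (ae_onI sh shf) => x Ox [sx sfx].
have c1 : \sum_(0 <= i < m.+1) iter i P h x @[m --> \oo] --> series_tail h 0 x.
  by have := @series_tail_cvg h 0 x sx; rewrite -(cvg_shiftS _ (nbhs _)).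
have c2 : \sum_(0 <= i < m.+1) iter i P h x @[m --> \oo] --> P (series_tail h 0) x + h x.
  under eq_cvg do rewrite Pop_partial_sum.
  apply: cvgD; last exact: cvg_cst.
  rewrite /Pop; apply: (@cvg_big V _ +%R 0 _ (@add_continuous V)) => n _.
  by apply: cvgZl_tmp; exact: series_tail_cvg.
exact: (cvg_unique (@norm_hausdorff _ V) c1 c2).
Qed.

Lemma solves_expand h u : solves Om g f h u ->
  ae_on Om (fun x => forall m, u x = \sum_(0 <= i < m) iter i P h x + iter m P u x).
Proof.
move=> su; apply: ae_on_all; elim => [|m IH].
  by apply: ae_onT => x; rewrite big_geq// add0r.
have IHf : ae_on Om (fun x => forall n,
    u (f n x) = \sum_(0 <= i < m) iter i P h (f n x) + iter m P u (f n x)).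
  by apply: ae_on_all => n; exact: (ae_on_comp (@fOm n) (@nullf n) IH).
apply: ae_onS (ae_onI su IHf) => x Ox [-> hf].
rewrite Pop_partial_sum addrAC; congr (_ + _); rewrite /= /Pop -big_split/=.
by apply: eq_bigr => n _; rewrite hf scalerDr.
Qed.

Lemma solution_unique h u : Lpsi psi Om h -> Lpsi psi Om u -> solves Om g f h u ->
  ae_on Om (fun x => u x = series_tail h 0 x).
Proof.
move=> Lh Lu /solves_expand su.
apply: ae_onS (ae_onI su (ae_onI (ae_summable Lh) (ae_summable Lu))) => x Ox [ux [sh [u1 u2]]].
have c1 : \sum_(0 <= i < m) iter i P h x @[m --> \oo] --> u x.
  apply/Vcvg_dist => r r0.
  have tl : (\sum_(n <= i <oo) iter i Q (mod u) x)%E @[n --> \oo] --> 0%E.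
    exact: nneseries_tail_cvg.
  have [M _ hM] := tl _ (nbhs_open_ereal_lt (f := fun=> r) r0).
  exists M => // m /= Mm; rewrite {1}(ux m) addrAC subrr add0r -lte_fin.
  apply: le_lt_trans (u1 m) _; apply: le_lt_trans (hM m Mm).
  apply: (@le_trans _ _ (\sum_(m <= l < m.+1) iter l Q (mod u) x)%E).
    by rewrite big_nat1.
  exact: nneseries_lim_ge.
exact: (cvg_unique (@norm_hausdorff _ V) c1 (@series_tail_cvg h 0 x sh)).
Qed.

End elementary_solution.

Theorem theorem4p8 (R : realType) (k N : nat) (b : bool)
  (V : completeNormedModType (Kof R b))
  (Om : set 'rV[R]_k)
  (f : 'I_N -> 'rV[R]_k -> 'rV[R]_k) (g : 'I_N -> 'rV[R]_k -> Kof R b)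
  (h0 : 'rV[R]_k -> V) (K L : nat) (psi : R -> R) (alpha : R) :
  (0 < k)%N -> (0 < N)%N ->
  open Om ->
  separable_space V ->
  (forall n x, Om x -> Om (f n x)) ->
  hypH Om f g h0 K L ->
  good_psi psi ->
  Lpsi psi Om h0 ->
  0 <= alpha -> alpha < 1 / 2 ->
  (forall n, ae_on Om (fun x =>
      Knorm (g n x) <= alpha * Num.min (`|Jac Om (f n) x| / (K * L)%:R) (N%:R)^-1)) ->
  exists phi : 'rV[R]_k -> V,
    [/\ (* the elementary solution exists: every term lies in L^{psi,1}, the
           series converges in L^{psi,1} to phi, and phi is a solution *)
        (forall i, Lpsi psi Om (iter i (Pop g f) h0)),
        Lpsi psi Om phi /\
        (fun m => psinorm psi Om
            (fun x => \sum_(0 <= i < m) iter i (Pop g f) h0 x - phi x))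
          @ \oo --> 0%E,
        solves Om g f h0 phi,
        (* uniqueness in L^{psi,1} *)
        (forall phi' : 'rV[R]_k -> V, Lpsi psi Om phi' -> solves Om g f h0 phi' ->
            ae_on Om (fun x => phi' x = phi x))
      & (* tail estimate *)
        (forall j : nat, exists T : 'rV[R]_k -> V,
           [/\ Lpsi psi Om T,
               (fun m => psinorm psi Om
                   (fun x => \sum_(j <= i < m) iter i (Pop g f) h0 x - T x))
                 @ \oo --> 0%E
             & (psinorm psi Om T <=
                  ((2 * alpha) ^+ j / (1 - 2 * alpha))%:E * psinorm psi Om h0)%E])].
Proof.
case: k Om f g h0 => // k Om f g h0 _ N0 oOm /separable_space_base sV fOm.
move=> [mf [_ [luzin [nullf [_ [fK [mg [_ ->]]]]]]]] gpsi Lh alpha0 ahalf gbound.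
exists (series_tail f g h0 0); split.
- move=> i; exact: Lpsi_iter_Pop gbound i h0 Lh.
- split; first exact: Lpsi_series_tail gbound h0 0%N Lh.
  exact: series_tail_psinorm_cvg gbound h0 0%N Lh.
- exact: series_tail_solves gbound h0 Lh.
- move=> u Lu su; exact: solution_unique gbound h0 u Lh Lu su.
- move=> j; exists (series_tail f g h0 j); split.
  + exact: Lpsi_series_tail gbound h0 j Lh.
  + exact: series_tail_psinorm_cvg gbound h0 j Lh.
  + exact: psinorm_series_tail gbound h0 j Lh.
Qed.
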